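(* Let $(X,d,\mu)$, $\Omega$, $\theta\in[0,1)$, the boundary measure $\mathscr H$ on $\partial\Omega$, the double-phase function $\mathcal H$, the trace operator $T$ and the functionals $\mathcal J_f$ be as in the context. Assume that $\Omega$ is bounded, that $\mathcal H$ satisfies the local comparability condition on $\overline\Omega$, that $\Omega$ supports the weak $(1,1)$-Poincaré inequality, that $\Omega$ satisfies the global $\mathcal H$-Poincaré inequality, and that $N^{1,\mathcal H}(\Omega)$ is reflexive. Write $I(h)=\inf_{u\in N^{1,\mathcal H}_*(\Omega)}\mathcal J_h(u)$. Let $(f_k)\subset L^{\widetilde{\mathcal H}}(\partial\Omega)$ satisfy $\int_{\partial\Omega}f_k\,d\mathscr H=0$ for every $k\in\mathbb N$ and $f_k\to f$ in $L^{\widetilde{\mathcal H}}(\partial\Omega)$. Suppose $u_k\in N^{1,\mathcal H}_*(\Omega)$ satisfy $\mathcal J_{f_k}(u_k)=I(f_k)$ for every $k$. Then $\int_{\partial\Omega}f\,d\mathscr H=0$, and there exist integers $N(k)\ge k$ and coefficients $\lambda_{j,k}\ge0$, $j=k,\dots,N(k)$, with $\sum_{j=k}^{N(k)}\lambda_{j,k}=1$, such that $\sum_{j=k}^{N(k)}\lambda_{j,k}u_j$ converges strongly in $N^{1,\mathcal H}(\Omega)$, as $k\to\infty$, to some $u\in N^{1,\mathcal H}_*(\Omega)$, and $\mathcal J_f(u)=I(f)$.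
   Context: Setting. $(X,d,\mu)$ is a complete metric measure space, where $\mu$ is a $\sigma$-finite Borel regular measure with $0<\mu(B(x,r))<\infty$ for every open ball. $\Omega\subset X$ is a domain such that $0<\mu(B(x,r)\cap\Omega)<\infty$ for all $x\in\overline\Omega$, $r>0$, and $\mu$ satisfies the restricted doubling condition on $\Omega$: there is $C\ge1$ with $\mu(B(x,2r)\cap\Omega)\le C\mu(B(x,r)\cap\Omega)$ for all $x\in\overline\Omega$, $r>0$. $\mathscr H$ is a $\sigma$-finite Borel regular measure on $\partial\Omega$ satisfying, for a fixed $0\le\theta<1$, the upper codimension-$\theta$ condition: there is $C_\theta>0$ with $\mathscr H(B(x,r)\cap\partial\Omega)\le C_\theta\, r^{-\theta}\mu(B(x,r)\cap\Omega)$ for all $x\in\partial\Omega$, $r>0$. Double-phase function. $\mathcal H(x,\xi)=\xi^{p(x)}+a(x)\xi^{q(x)}$ for $x\in\overline\Omega$, $\xi\ge0$, where $p,q,a$ are measurable on $\overline\Omega$, $1<p(x)<q(x)<\infty$ for all $x$, $1<p^-:=\operatorname{ess\,inf}p\le p^+:=\operatorname{ess\,sup}p<\infty$, $1<q^-:=\operatorname{ess\,inf}q\le q^+:=\operatorname{ess\,sup}q<\infty$, and $0\le a\in L^\infty$. These conditions are assumed on $\overline\Omega$ with respect to $\mu$, and on $\partial\Omega$ with respect to $\mathscr H$. The complementary function is $\widetilde{\mathcal H}(x,\xi)=\sup_{s\ge0}\{s\xi-\mathcal H(x,s)\}$. Spaces. $L^{\mathcal H}(\Omega)$ is the space of measurable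 $u$ on $\Omega$ with $\varrho_{\mathcal H}(u)=\int_\Omega\mathcal H(x,|u|)\,d\mu<\infty$, with Luxemburg norm $\|u\|=\inf\{\tau>0:\varrho_{\mathcal H}(u/\tau)\le1\}$; $L^{\mathcal H}(\partial\Omega)$ and $L^{\widetilde{\mathcal H}}(\partial\Omega)$ are defined in the same way on $\partial\Omega$ with measure $\mathscr H$ and functions $\mathcal H$, $\widetilde{\mathcal H}$ respectively. Rectifiable curves are nonconstant, continuous, of finite length $\ell_\gamma$ and parametrized on $[0,\ell_\gamma]$. The $\mathcal H$-modulus of a family $\Gamma$ of rectifiable curves in $\Omega$ is $\inf\int_\Omega\mathcal H(x,h)\,d\mu$ over Borel $h\ge0$ (values in $[0,\infty]$) with $\int_\gamma h\,ds\ge1$ for all $\gamma\in\Gamma$ ($\infty$ if there is no such $h$). A nonnegative Borel function $g$ on $\Omega$ is an $\mathcal H$-weak upper gradient of a measurable $u:\Omega\to[-\infty,\infty]$ if $|u(\gamma(0))-u(\gamma(\ell_\gamma))|\le\int_\gamma g\,ds$ for all rectifiable curves $\gamma$ in $\Omega$ outside a family of $\mathcal H$-modulus zero (with $|(\pm\infty)-(\pm\infty)|=\infty$). If $u$ has an $\mathcal H$-weak upper gradient in $L^{\mathcal H}(\Omega)$, then $g_u$ denotes the minimal one ($g_u\le g$ $\mu$-a.e. for every $\mathcal H$-weak upper gradient $g\in L^{\mathcal H}(\Omega)$ of $u$), which exists and is $\mu$-a.e. unique. $N^{1,\mathcal H}(\Omega)$ is the (Banach) space of everywhere-defined $u\in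 L^{\mathcal H}(\Omega)$ having an $\mathcal H$-weak upper gradient in $L^{\mathcal H}(\Omega)$, with norm $\|u\|_{N^{1,\mathcal H}(\Omega)}=\|u\|_{L^{\mathcal H}(\Omega)}+\|g_u\|_{L^{\mathcal H}(\Omega)}$, modulo $u\sim v$ iff $\|u-v\|=0$. $N^{1,\mathcal H}_*(\Omega)=\{u\in N^{1,\mathcal H}(\Omega):\int_\Omega u\,d\mu=0\}$. Local comparability. $\mathcal H$ satisfies the local comparability condition on $E$ if there exist $C\ge1$ and $R_0>0$ such that for every ball $B\subset X$ of radius less than $R_0$, all $x,y\in B\cap E$ and all $\xi\in[0,\infty)$, $\mathcal H(x,\xi)\le C\,\mathcal H(y,C\xi)$. Weak $(1,1)$-Poincaré inequality. $\Omega$ supports it if there are $C>0$, $\lambda>1$ such that for every $u\in L^1_{\mathrm{loc}}(\Omega)$ (integrable on bounded subsets of $\Omega$) with minimal $\mathcal H$-weak upper gradient $g_u$, $\frac1{\mu(B)}\int_B|u-u_B|\,d\mu\le C r\frac1{\mu(\lambda B\cap\Omega)}\int_{\lambda B\cap\Omega}g_u\,d\mu$ for every ball $B=B(x,r)\subset\Omega$; by convention, this assumption includes the same inequality with $B$ replaced by $B\cap\Omega$ on the left-hand side (averages over $B\cap\Omega$) for every ball $B=B(x,r)$ with $x\in\overline\Omega$. Here $u_A=\frac1{\mu(A)}\int_A u\,d\mu$ and $\lambda B=B(x,\lambda r)$. Global $\mathcal H$-Poincaré inequality. There is $C>0$ with $\|u-u_\Omega\|_{L^{\mathcal H}(\Omega)}\le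 C\|g_u\|_{L^{\mathcal H}(\Omega)}$ for every $u\in N^{1,\mathcal H}(\Omega)$. Trace and energy. Under boundedness of $\Omega$, local comparability on $\overline\Omega$ and the weak $(1,1)$-Poincaré inequality, there is a bounded linear trace operator $T:N^{1,\mathcal H}(\Omega)\to L^{\mathcal H}(\partial\Omega)$ characterized by $\lim_{r\to0}\frac1{\mu(B(z,r)\cap\Omega)}\int_{B(z,r)\cap\Omega}|u-Tu(z)|\,d\mu=0$ for $\mathscr H$-a.e. $z\in\partial\Omega$. With $\mathcal A(x,\xi)=\frac{\xi^{p(x)}}{p(x)}+a(x)\frac{\xi^{q(x)}}{q(x)}$, for $h\in L^{\widetilde{\mathcal H}}(\partial\Omega)$ set $$\mathcal J_h(u)=\int_\Omega\mathcal A(x,g_u)\,d\mu+\int_{\partial\Omega}h\,Tu\,d\mathscr H,\quad u\in N^{1,\mathcal H}(\Omega).$$ *)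

(* Defs.v *)
From HB Require Import structures.
From mathcomp Require Import all_boot all_order all_algebra.
From mathcomp Require Import all_classical all_reals all_analysis.
From mathcomp Require Import measurable_realfun.
Set Implicit Arguments.
Unset Strict Implicit.
Unset Printing Implicit Defensive.
Import Order.TTheory GRing.Theory Num.Theory.
Import numFieldNormedType.Exports.
Local Open Scope classical_set_scope.
Local Open Scope ring_scope.

#[short(type="completeMetricType")]
HB.structure Definition CompleteMetric (R : numDomainType) :=
  {T of Metric R T & Complete T}.

(* Functions on a subset D of a type T are total functions T -> \bar R of which
   only the values on D matter.  Extended real values are allowed everywhere;
   note that `|+oo - +oo|%E = `|-oo - -oo|%E = +oo in the library. *)

Section musielak_orlicz.
Context d (T : measurableType d) (R : realType).
Variable m : {measure set T -> \bar R}.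
Implicit Types (D : set T) (Phi : T -> \bar R -> \bar R) (u : T -> \bar R).
Local Open Scope ereal_scope.

(* The library's ess_sup and ess_inf are taken over the whole type. *)
Definition ess_sup_on D (f : T -> R) : \bar R :=
  ereal_inf [set y | \forall x \ae m, D x -> (f x)%:E <= y].

Definition ess_inf_on D (f : T -> R) : \bar R :=
  ereal_sup [set y | \forall x \ae m, D x -> y <= (f x)%:E].

(* The inequalities p^- <= p^+ and q^- <= q^+ are automatic unless m D = 0. *)
Definition double_phase_data D (p q a : T -> R) : Prop :=
  [/\ [/\ measurable_fun D p, measurable_fun D q & measurable_fun D a],
      forall x, D x -> (1 < p x < q x)%R,
      1 < ess_inf_on D p /\ ess_sup_on D p < +oo,
      1 < ess_inf_on D q /\ ess_sup_on D q < +oo &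
      (forall x, D x -> (0 <= a x)%R) /\
      ess_sup_on D (fun x => `|a x|%R) < +oo].

Definition modular Phi D u : \bar R := \int[m]_(x in D) Phi x `|u x|.

Definition orlicz_space Phi D u : Prop :=
  measurable_fun D u /\ modular Phi D u < +oo.

Definition luxemburg Phi D u : \bar R :=
  ereal_inf [set tau%:E | tau in
    [set tau : R | (0 < tau)%R /\
                   modular Phi D (fun x => (tau^-1)%:E * u x) <= 1]].

Definition average D u : \bar R := ((fine (m D))^-1)%:E * \int[m]_(x in D) u x.

End musielak_orlicz.

Section phase_functions.
Context {T : Type} {R : realType}.
Implicit Types (p q a : T -> R) (x : T) (xi : \bar R).
Local Open Scope ereal_scope.

Definition double_phase p q a x xi : \bar R :=
  xi `^ p x + (a x)%:E * xi `^ q x.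

Definition energy_density p q a x xi : \bar R :=
  xi `^ p x * ((p x)^-1)%:E + (a x)%:E * (xi `^ q x * ((q x)^-1)%:E).

Definition complementary (Phi : T -> \bar R -> \bar R) x xi : \bar R :=
  ereal_sup [set s%:E * xi - Phi x s%:E | s in [set s : R | (0 <= s)%R]].

End phase_functions.

(* Reflexivity of the normed space P / {N = 0}, where P is a set of functions
   stable under the (pointwise) operations add and scale and N is a seminorm on
   P.  A bounded linear functional on the quotient is a linear functional on P
   bounded by a multiple of N; the values of phi outside P are irrelevant (two
   functionals that agree on P have a difference of dual norm 0, hence are
   identified by every element of the bidual). *)
Section reflexivity.
Context {R : realType} {E : Type}.
Variables (P : set E) (add : E -> E -> E) (scale : R -> E -> E).
Variable N : E -> \bar R.

Definition dual_space (phi : E -> R) : Prop :=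
  [/\ forall u v, P u -> P v -> phi (add u v) = phi u + phi v,
      forall c u, P u -> phi (scale c u) = c * phi u &
      exists C : R, forall u, P u -> (`|phi u|%:E <= C%:E * N u)%E].

Definition dual_norm (phi : E -> R) : \bar R :=
  ereal_sup [set `|phi u|%:E | u in [set u | P u /\ (N u <= 1)%E]].

Definition bidual_space (Lam : (E -> R) -> R) : Prop :=
  [/\ forall phi psi, dual_space phi -> dual_space psi ->
        Lam (fun u => phi u + psi u) = Lam phi + Lam psi,
      forall c phi, dual_space phi -> Lam (fun u => c * phi u) = c * Lam phi &
      exists C : R, forall phi, dual_space phi ->
        (`|Lam phi|%:E <= C%:E * dual_norm phi)%E].

Definition reflexive_space : Prop :=
  forall Lam, bidual_space Lam ->
    exists2 u, P u & forall phi, dual_space phi -> Lam phi = phi u.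

End reflexivity.

Section metric.
Context {R : realType} {X : completeMetricType R}.
Implicit Types (A D Omega : set X) (mu nu : {outer_measure set X -> \bar R}).

(* Borel regular measures are outer measures, as usual in analysis on metric
   spaces: integrals and measurability refer to the sigma-algebra of Caratheodory
   mu-measurable sets, which contains the Borel sets and is mu-complete. *)
Definition cara mu : {measure set (caratheodory_type mu) -> \bar R} :=
  (mu : set (caratheodory_type mu) -> \bar R).

Definition borel_regular mu : Prop :=
  (forall A, <<s open >> A -> mu.-caratheodory A) /\
  (forall A, exists B, [/\ <<s open >> B, A `<=` B & mu B = mu A]).

Definition metric_bounded A : Prop := exists x r, A `<=` ball x r.

Definition boundary A : set X := closure A `\` A^°.

Definition domain Omega : Prop :=
  [/\ open Omega, connected Omega & Omega !=set0].

Definition restricted_doubling mu Omega : Prop :=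
  exists2 C : R, 1 <= C & forall x r, closure Omega x -> 0 < r ->
    (mu (ball x (2 * r) `&` Omega) <= C%:E * mu (ball x r `&` Omega))%E.

Definition upper_codimension mu nu Omega (theta : R) : Prop :=
  exists2 C : R, 0 < C & forall x r, boundary Omega x -> 0 < r ->
    (nu (ball x r `&` boundary Omega) <=
     (C * r `^ (- theta))%:E * mu (ball x r `&` Omega))%E.

Definition local_comparability (Phi : X -> \bar R -> \bar R) (E : set X) :
    Prop :=
  exists C R0 : R, [/\ 1 <= C, 0 < R0 &
    forall z r, 0 < r < R0 ->
    forall x y, (ball z r `&` E) x -> (ball z r `&` E) y ->
    forall xi : R, 0 <= xi -> (Phi x xi%:E <= C%:E * Phi y (C * xi)%:E)%E].

(* A curve is given by its length and its arc-length parametrization; the values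
   of cpath outside `[0, clen] are irrelevant. *)
Record curve := Curve { clen : R ; cpath : R -> X }.

Definition path_length (s t : R) (c : R -> X) : \bar R :=
  ereal_sup [set (\sum_(0 <= i < size l)
                    mdist (c (nth t (s :: l) i)) (c (nth t (s :: l) i.+1)))%:E
            | l in itv_partition s t].

Definition rectifiable_in Omega (g : curve) : Prop :=
  [/\ 0 < clen g,
      {within `[0, clen g], continuous (cpath g)},
      forall s t, 0 <= s -> s <= t -> t <= clen g ->
        path_length s t (cpath g) = (t - s)%:E &
      forall t, 0 <= t <= clen g -> Omega (cpath g t)].

Definition line_integral (g : curve) (h : X -> \bar R) : \bar R :=
  (\int[lebesgue_measure]_(t in `[0%R, clen g]) h (cpath g t))%E.

Definition nonneg_borel_on Omega (h : X -> \bar R) : Prop :=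
  measurable_fun (Omega : set (g_sigma_algebraType (@open X)))
    (h : g_sigma_algebraType (@open X) -> \bar R) /\
  (forall x, Omega x -> (0 <= h x)%E).

Section newtonian.
Variables (mu : {outer_measure set X -> \bar R}) (Omega : set X).
Variable Phi : X -> \bar R -> \bar R.
Implicit Types (u v g h : X -> \bar R) (Gamma : set curve).
Local Open Scope ereal_scope.

Definition modulus Gamma : \bar R :=
  ereal_inf [set modular (cara mu) Phi Omega h | h in
    [set h | nonneg_borel_on Omega h /\
             forall c, Gamma c -> 1 <= line_integral c h]].

Definition weak_upper_gradient u g : Prop :=
  [/\ measurable_fun (Omega : set (caratheodory_type mu))
        (u : caratheodory_type mu -> \bar R),
      nonneg_borel_on Omega g &
      exists Gamma, [/\ Gamma `<=` rectifiable_in Omega, modulus Gamma = 0 &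
        forall c, rectifiable_in Omega c -> ~ Gamma c ->
          `|u (cpath c 0%R) - u (cpath c (clen c))| <= line_integral c g]].

Definition orlicz_weak_upper_gradient u g : Prop :=
  weak_upper_gradient u g /\ orlicz_space (cara mu) Phi Omega g.

Definition minimal_weak_upper_gradient u g : Prop :=
  orlicz_weak_upper_gradient u g /\
  forall g', orlicz_weak_upper_gradient u g' ->
    \forall x \ae cara mu, Omega x -> g x <= g' x.

(* A representative of g_u; unspecified when u has no weak upper gradient in
   the Orlicz space. *)
Definition min_grad u : X -> \bar R :=
  xget (cst 0) [set g | minimal_weak_upper_gradient u g].

Definition newtonian u : Prop :=
  orlicz_space (cara mu) Phi Omega u /\
  exists g, orlicz_weak_upper_gradient u g.

Definition newtonian_norm u : \bar R :=
  luxemburg (cara mu) Phi Omega u + luxemburg (cara mu) Phi Omega (min_grad u).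

Definition newtonian_star u : Prop :=
  newtonian u /\ \int[cara mu]_(x in Omega) u x = 0.

Definition newtonian_reflexive : Prop :=
  reflexive_space newtonian (fun u v x => u x + v x)
    (fun (c : R) u x => c%:E * u x) newtonian_norm.

Definition locally_integrable u : Prop :=
  forall A : set (caratheodory_type mu), measurable A -> A `<=` Omega ->
    metric_bounded A -> (cara mu).-integrable A u.

(* The first inequality is the Poincare inequality on balls contained in Omega,
   the second one is its version on B `&` Omega for balls centered in the closure
   of Omega. *)
Definition weak_11_poincare : Prop :=
  exists C lam : R, [/\ (0 < C)%R, (1 < lam)%R &
    forall u, locally_integrable u ->
    (exists g, orlicz_weak_upper_gradient u g) ->
    forall (x : X) (r : R), (0 < r)%R ->
    let oscillation (A : set X) :=
      average (cara mu) A (fun y => `|u y - average (cara mu) A u|) in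
    let bound := (C * r)%:E *
      average (cara mu) (ball x (lam * r)%R `&` Omega) (min_grad u) in
    (ball x r `<=` Omega -> oscillation (ball x r) <= bound) /\
    (closure Omega x -> oscillation (ball x r `&` Omega) <= bound)].

Definition global_poincare : Prop :=
  exists2 C : R, (0 < C)%R & forall u, newtonian u ->
    luxemburg (cara mu) Phi Omega (fun x => u x - average (cara mu) Omega u) <=
    C%:E * luxemburg (cara mu) Phi Omega (min_grad u).

(* T is the bounded linear trace operator from the Newtonian space of Omega to the
   Orlicz space of (boundary Omega, nu); the last clause determines T u nu-a.e. *)
Definition trace_operator (nu : {outer_measure set X -> \bar R})
    (T : (X -> \bar R) -> (X -> \bar R)) : Prop :=
  [/\ forall u, newtonian u -> orlicz_space (cara nu) Phi (boundary Omega) (T u),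
      forall u v, newtonian u -> newtonian v -> \forall z \ae cara nu,
        boundary Omega z -> T (fun x => u x + v x) z = T u z + T v z,
      forall (c : R) u, newtonian u -> \forall z \ae cara nu,
        boundary Omega z -> T (fun x => c%:E * u x) z = c%:E * T u z,
      exists C : R, forall u, newtonian u ->
        luxemburg (cara nu) Phi (boundary Omega) (T u) <=
        C%:E * newtonian_norm u &
      forall u, newtonian u -> \forall z \ae cara nu, boundary Omega z ->
        (fun r : R => average (cara mu) (ball z r `&` Omega)
                        (fun x => `|u x - T u z|)) @ 0%R^'+ --> 0].

End newtonian.

Section functional.
Variables (mu nu : {outer_measure set X -> \bar R}) (Omega : set X).
Variables (p q a : X -> R) (T : (X -> \bar R) -> (X -> \bar R)).
Implicit Types (f u : X -> \bar R).
Local Open Scope ereal_scope.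

Definition energy f u : \bar R :=
  \int[cara mu]_(x in Omega)
    energy_density p q a x (min_grad mu Omega (double_phase p q a) u x) +
  \int[cara nu]_(z in boundary Omega) (f z * T u z).

Definition energy_inf f : \bar R :=
  ereal_inf [set energy f u | u in newtonian_star mu Omega (double_phase p q a)].

End functional.

End metric.

(* Main.v *)
(* Minimality against 0, Hölder's inequality on the boundary, the bound for T and the
   global Poincaré inequality give J_{f_k}(u_k) <= 0 with an energy that grows
   superlinearly in the norm, so (u_k) is bounded.  Testing the bidual with the
   functional phi |-> lim phi(u_k) along a nonprincipal ultrafilter, reflexivity
   provides a weak limit u, and Mazur's lemma (a separation argument, i.e.
   Hahn-Banach) convex combinations of the tails that converge to u in norm.  The
   energy is convex and bounded on the unit ball, hence norm continuous, while
   |J_{f_k} - J_f| is at most a null sequence times the norm; so the combinations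
   almost minimize J_f and u is a minimizer.

   The minimal weak upper gradient of every Newtonian function must be shown to
   exist.  The usual lattice argument is bypassed: if g_u did not exist, min_grad u
   would be the default value 0, the global Poincaré inequality would make u constant
   almost everywhere, and then 0 would be its minimal weak upper gradient. *)
Require Import Defs.
From HB Require Import structures.
From mathcomp Require Import all_boot all_order all_algebra.
From mathcomp Require Import all_classical all_reals all_analysis.
From mathcomp Require Import measurable_realfun.
From mathcomp Require Import ring lra.
Import Order.TTheory GRing.Theory Num.Theory.
Import numFieldNormedType.Exports.
Local Open Scope classical_set_scope.
Local Open Scope ring_scope.
Set Implicit Arguments.
Unset Strict Implicit.
Unset Printing Implicit Defensive.

(** * Hahn-Banach, Mazur's lemma and convex minimization *)

(** Extended real functions do not form a vector space under pointwise operations, whereas the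
    abstract argument needs a module. It is therefore carried out on the real-valued Newtonian
    functions with their seminorm; the quotient by its kernel is not formed. The passage back rests
    on two facts. A Newtonian function is infinite only on an exceptional set, because at an
    infinite endpoint value the left-hand side of the upper gradient inequality is +oo. And a
    measurable change on an exceptional set leaves the weak upper gradients, hence [min_grad] and
    the norm, unchanged. Equality almost everywhere is too weak for this: upper gradients see the
    values at the ends of every curve.

    The same point makes the existence of g_u delicate: a function that is constant only almost
    everywhere must be shown to have 0 as a weak upper gradient. Being Newtonian, it varies along
    almost every curve by at most the integral of some g, which is small over short subcurves, and
    almost every curve visits the set of good points in each subinterval of its parameter. *)

Section hahn_banach.
Context {R : realType} {V : lmodType R}.
Implicit Types (S q : V -> R).

Definition sublinear S : Prop :=
  (forall u v, S (u + v) <= S u + S v) /\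
  (forall c u, 0 <= c -> S (c *: u) = c * S u).

Lemma sublinear0 S : sublinear S -> S 0 = 0.
Proof. by move=> [_ h]; have := h 0 0 (lexx _); rewrite scale0r mul0r. Qed.

Lemma sublinear_ge_opp S v : sublinear S -> - S (- v) <= S v.
Proof.
move=> sS; have := sS.1 v (- v); rewrite subrr (sublinear0 sS); lra.
Qed.

(** The bound is the pointwise infimum of the chain, finite because each member satisfies q v >= - q
    (- v) >= - S (- v). For subadditivity the infima at u and v are approached by two members of the
    chain, and the smaller of the two serves at both points. An empty chain is bounded by S
    itself. *)
Lemma chain_sublinear_lower_bound S (A : set (V -> R)) :
  sublinear S -> (forall q, A q -> sublinear q /\ forall v, q v <= S v) ->
  (forall q q', A q -> A q' ->
    (forall v, q v <= q' v) \/ (forall v, q' v <= q v)) ->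
  exists2 q, sublinear q /\ (forall v, q v <= S v) &
    forall q', A q' -> forall v, q v <= q' v.
Proof.
move=> sS AS tA.
have [[q0 Aq0]|A0] := pselect (A !=set0); last first.
  by exists S => // q' Aq'; exfalso; apply: A0; exists q'.
pose B v := [set q v | q in A].
have lB v : lbound (B v) (- S (- v)).
  move=> _ [q Aq <-]; have [sq qS] := AS _ Aq.
  apply: le_trans (sublinear_ge_opp v sq); by rewrite lerN2 qS.
have hB v : has_inf (B v) by split; [exists (q0 v), q0|exists (- S (- v))].
pose r v := inf (B v).
have rle q v : A q -> r v <= q v.
  by move=> Aq; apply: ge_inf; [exact: (hB v).2|exists q].
exists r => //; last by move=> q' Aq' v; exact: rle.
split; last first.
  by move=> v; apply: le_trans (rle _ v Aq0) _; have [_] := AS _ Aq0.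
split.
- move=> u v; rewrite -lerBlDr; apply: lb_le_inf; first exact: (hB u).1.
  move=> _ [q Aq <-]; rewrite lerBlDr -lerBlDl; apply: lb_le_inf.
    exact: (hB v).1.
  move=> _ [q' Aq' <-]; rewrite lerBlDl.
  have [qq'|qq'] := tA _ _ Aq Aq'.
    apply: le_trans (rle _ (u + v) Aq) _.
    by apply: le_trans ((AS _ Aq).1.1 u v) _; rewrite lerD2l.
  apply: le_trans (rle _ (u + v) Aq') _.
  by apply: le_trans ((AS _ Aq').1.1 u v) _; rewrite lerD2r.
- move=> c u; rewrite le_eqVlt => /predU1P[<-|c0].
    rewrite scale0r mul0r; apply/eqP; rewrite eq_le; apply/andP; split.
      by rewrite (le_trans (rle _ 0 Aq0))// sublinear0//; have [] := AS _ Aq0.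
    apply: lb_le_inf; first exact: (hB 0).1.
    by move=> _ [q Aq <-]; rewrite sublinear0//; have [] := AS _ Aq.
  apply/eqP; rewrite eq_le; apply/andP; split.
    rewrite -ler_pdivrMl//; apply: lb_le_inf; first exact: (hB u).1.
    move=> _ [q Aq <-]; rewrite ler_pdivrMl//.
    by rewrite (le_trans (rle _ _ Aq))// (AS _ Aq).1.2// ltW.
  apply: lb_le_inf; first exact: (hB (c *: u)).1.
  move=> _ [q Aq <-]; rewrite (AS _ Aq).1.2 ?(ltW c0)//.
  by rewrite ler_pM2l// rle.
Qed.

(* The infimum over t >= 0 of q (v + t y) - t q(y) is again sublinear, and below
   q; for a minimal q it is q itself, which forces q (- y) = - q y. *)
Lemma minimal_sublinear_odd q y : sublinear q ->
  (forall q', sublinear q' -> (forall v, q' v <= q v) ->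
    forall v, q v <= q' v) ->
  q (- y) = - q y.
Proof.
move=> sq mq.
pose B v := [set q (v + t *: y) - t * q y | t in [set t : R | 0 <= t]].
have lB v : lbound (B v) (- q (- v)).
  move=> _ [t /= t0 <-].
  have := sq.1 (v + t *: y) (- v).
  rewrite addrAC subrr add0r sq.2//; lra.
have hB v : has_inf (B v).
  by split; [exists (q (v + 0 *: y) - 0 * q y), 0 => /=|exists (- q (- v))].
pose r v := inf (B v).
have rle v t : 0 <= t -> r v <= q (v + t *: y) - t * q y.
  by move=> t0; apply: ge_inf; [exact: (hB v).2|exists t].
have rq v : r v <= q v.
  by have := rle v 0 (lexx _); rewrite scale0r addr0 mul0r subr0.
have sr : sublinear r.
  split.
    move=> u v; rewrite -lerBlDr; apply: lb_le_inf; first exact: (hB u).1.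
    move=> _ [t /= t0 <-]; rewrite lerBlDr -lerBlDl; apply: lb_le_inf.
      exact: (hB v).1.
    move=> _ [s /= s0 <-]; rewrite lerBlDl.
    apply: le_trans (rle _ (t + s) (addr_ge0 t0 s0)) _.
    have := sq.1 (u + t *: y) (v + s *: y).
    rewrite addrACA -scalerDl mulrDl; lra.
  (* One inequality suffices: the reverse one is this one for c^-1 at the point c u. *)
  have pos c u : 0 < c -> c * r u <= r (c *: u).
    move=> c0; apply: lb_le_inf; first exact: (hB (c *: u)).1.
    move=> _ [t /= t0 <-].
    have := rle u (c^-1 * t) (mulr_ge0 (ltW (eqbRL (invr_gt0 c) c0)) t0).
    have -> : c *: u + t *: y = c *: (u + (c^-1 * t) *: y).
      by rewrite scalerDr scalerA mulrA mulfV ?mul1r// gt_eqF.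
    rewrite sq.2 ?(ltW c0)// -(ler_pM2l c0) => /le_trans; apply.
    by rewrite mulrBr !mulrA mulfV ?mul1r// gt_eqF.
  move=> c u; rewrite le_eqVlt => /predU1P[<-|c0].
    rewrite scale0r mul0r; apply/eqP; rewrite eq_le; apply/andP; split.
      by rewrite (le_trans (rq 0))// sublinear0.
    apply: lb_le_inf; first exact: (hB 0).1.
    move=> _ [t /= t0 <-]; by rewrite add0r sq.2// subrr.
  apply/eqP; rewrite eq_le pos// andbT.
  have := pos c^-1 (c *: u); rewrite invr_gt0 => /(_ c0).
  by rewrite scalerA mulVf ?gt_eqF// scale1r ler_pdivrMl.
have := mq _ sr rq (- y) => h.
(* At - y with t = 1 the modified functional is at most q 0 - q y = - q y. *)
have := rle (- y) 1 ler01; rewrite scale1r addNr (sublinear0 sq) mul1r.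
have := sublinear_ge_opp y sq; lra.
Qed.

(** No functional is extended from a subspace. Zorn's lemma gives a minimal sublinear functional
    below S; it is odd at every point, and oddness turns subadditivity and positive homogeneity into
    linearity. *)
Lemma hahn_banach S : sublinear S ->
  exists phi : V -> R, [/\ forall u v, phi (u + v) = phi u + phi v,
    forall c u, phi (c *: u) = c * phi u & forall v, phi v <= S v].
Proof.
move=> sS.
pose T := {q : V -> R | sublinear q /\ forall v, q v <= S v}.
(* The order is reversed, since [Zorn] produces maximal elements. *)
pose le (q q' : T) := `[< forall v, sval q' v <= sval q v >].
have [||||[q [sq qS]] mq] := @Zorn T le.
- by move=> q; apply/asboolP => v.
- move=> q q' q'' /asboolP h /asboolP h'; apply/asboolP => v.
  exact: le_trans (h' v) (h v).
- move=> [q hq] [q' hq'] /asboolP h /asboolP h'; apply: eq_exist => /=.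
  by apply/funext => v; apply/eqP; rewrite eq_le h h'.
- move=> A tA.
  have [||q hq qA] := @chain_sublinear_lower_bound S (sval @` A) sS.
  + by move=> _ [[q hq] _ <-].
  + move=> _ _ [q Aq <-] [q' Aq' <-].
    have [/asboolP h|/asboolP h] := tA _ _ Aq Aq'; by [right|left].
  + exists (exist _ q hq) => -[q' hq'] Aq'; apply/asboolP => v /=.
    by apply: qA; exists (exist _ q' hq').
have odd y : q (- y) = - q y.
  apply: minimal_sublinear_odd => // q' sq' q'q v.
  have hq' : sublinear q' /\ forall v, q' v <= S v.
    by split => // w; exact: le_trans (q'q w) (qS w).
  have := mq (exist _ q' hq').
  have -> : le (exist _ q (conj sq qS)) (exist _ q' hq') by apply/asboolP.
  by move=> /(_ isT)/(congr1 sval)/= ->.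
exists q; split => //.
  move=> u v; apply/eqP; rewrite eq_le sq.1/=.
  have := sq.1 (- u) (- v); rewrite -opprD !odd; lra.
move=> c u; have [c0|c0] := leP 0 c; first exact: sq.2.
have cN : 0 <= - c by lra.
have := sq.2 (- c) u cN; rewrite scaleNr odd; lra.
Qed.

End hahn_banach.

(** * Convex hulls and explicit convex combinations *)

Section convex_hull.
Context {R : realType} {V : lmodType R}.
Implicit Types (A K : set V).

Definition convex_closed K : Prop := forall (t : R) u v, 0 <= t <= 1 ->
  K u -> K v -> K (t *: u + (1 - t) *: v).

(** Generated by binary combinations, so that inclusion in a convex set is a plain induction; lists
    of coefficients appear only in [hull_tailP]. *)
Inductive hull A : V -> Prop :=
| hull_mem u : A u -> hull A u
| hull_comb (t : R) u v : 0 <= t <= 1 -> hull A u -> hull A v ->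
    hull A (t *: u + (1 - t) *: v).

Lemma hull_sub A K : convex_closed K -> A `<=` K -> hull A `<=` K.
Proof.
move=> cK AK u; elim=> {u} [u /AK//|t u v t01 _ Ku _ Kv]; exact: cK.
Qed.

Lemma hull_tailP (w : nat -> V) k v : hull [set w j | j in [set j | (k <= j)%N]] v ->
  exists n (l : nat -> R), [/\ (k <= n)%N, forall j, 0 <= l j,
    \sum_(k <= j < n.+1) l j = 1 & v = \sum_(k <= j < n.+1) l j *: w j].
Proof.
(* The coefficients are also required to vanish beyond n, so that two combinations can be summed
   over the common range up to [maxn n n']. *)
suff: hull [set w j | j in [set j | (k <= j)%N]] v ->
  exists n (l : nat -> R), [/\ (k <= n)%N, forall j, 0 <= l j,
    forall j, (n < j)%N -> l j = 0,
    \sum_(k <= j < n.+1) l j = 1 & v = \sum_(k <= j < n.+1) l j *: w j].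
  by move=> h /h[n [l [kn l0 _ l1 vE]]]; exists n, l.
elim=> {v} [_ [j /= kj <-]|t u v t01 _ [n [l [kn l0 ln l1 uE]]]
    _ [n' [l' [kn' l'0 ln' l'1 vE]]]].
  exists j, (fun i => (i == j)%:R); split => //.
  - by move=> i ji; rewrite gtn_eqF.
  - rewrite big_nat_recr//= eqxx big_nat big1 ?add0r// => i /andP[_ ij].
    by rewrite ltn_eqF.
  - rewrite big_nat_recr//= eqxx scale1r big_nat big1 ?add0r// => i /andP[_ ij].
    by rewrite ltn_eqF// scale0r.
have extend (W : lmodType R) (c : nat -> R) (z : nat -> W) m m' :
    (k <= m)%N -> (m <= m')%N -> (forall j, (m < j)%N -> c j = 0) ->
    \sum_(k <= j < m.+1) c j *: z j = \sum_(k <= j < m'.+1) c j *: z j.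
  move=> km mm' c0; rewrite [RHS](@big_cat_nat _ _ _ m.+1)//=; last exact: leqW.
  rewrite [X in _ = _ + X]big_nat [X in _ = _ + X]big1 ?addr0// => i /andP[mi _].
  by rewrite c0// scale0r.
have extend1 (c : nat -> R) m m' :
    (k <= m)%N -> (m <= m')%N -> (forall j, (m < j)%N -> c j = 0) ->
    \sum_(k <= j < m.+1) c j = \sum_(k <= j < m'.+1) c j.
  move=> km mm' c0; have := @extend R^o c (fun=> 1) m m' km mm' c0.
  by under eq_bigr do rewrite [_ *: _]mulr1; under [RHS]eq_bigr do rewrite [_ *: _]mulr1.
exists (maxn n n'), (fun j => t * l j + (1 - t) * l' j); split => //.
- by rewrite leq_max kn.
- move=> j; have := l0 j; have := l'0 j; nra.
- by move=> j; rewrite gtn_max => /andP[/ln -> /ln' ->]; rewrite !mulr0 addr0.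
- rewrite big_split/= -!mulr_sumr.
  rewrite -(extend1 _ _ _ kn (leq_maxl _ _) ln) l1.
  by rewrite -(extend1 _ _ _ kn' (leq_maxr _ _) ln') l'1; ring.
- rewrite uE vE (extend _ _ _ _ _ kn (leq_maxl n n') ln).
  rewrite (extend _ _ _ _ _ kn' (leq_maxr n n') ln').
  under [RHS]eq_bigr do rewrite scalerDl -!scalerA.
  by rewrite big_split/= !scaler_sumr.
Qed.

End convex_hull.

Lemma fmap_ultra (T U : Type) (f : T -> U) (G : set_system T) :
  UltraFilter G -> UltraFilter (f @ G).
Proof.
move=> GU; split; first exact: fmap_proper_filter.
move=> H HH GH; rewrite predeqE => A; split; last exact: GH.
move=> HA; have [//|GnA] := in_ultra_setVsetC (f @^-1` A) GU.
have HnA : H (~` A) by exact: GH.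
by have /filter_ex[y []] : H (A `&` ~` A) by exact: filterI.
Qed.

(** * Separation, weak limits and convex minimization in a reflexive seminormed space *)

Section reflexive_minimization.
Context {R : realType} {V : lmodType R}.
Variable N : V -> R.
Hypothesis N_triangle : forall u v, N (u + v) <= N u + N v.
Hypothesis N_scale : forall c u, N (c *: u) = `|c| * N u.

Definition bounded_linear (phi : V -> R) : Prop :=
  [/\ forall u v, phi (u + v) = phi u + phi v,
      forall c u, phi (c *: u) = c * phi u &
      exists C, forall u, `|phi u| <= C * N u].

Let N0 : N 0 = 0.
Proof. by have := N_scale 0 0; rewrite scale0r normr0 mul0r. Qed.

Let N_opp u : N (- u) = N u.
Proof. by rewrite -scaleN1r N_scale normrN1 mul1r. Qed.

Let N_ge0 u : 0 <= N u.
Proof. have := N_triangle u (- u); rewrite subrr N0 N_opp; lra. Qed.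

(** Hahn-Banach is applied to S v, the infimum of N (v + s (u - w)) - delta s over s >= 0 and w in
    K. It stays above - N v because N (s (u - w)) >= delta s. A linear phi below S is bounded by N,
    and the choice s = 1 at v = - (u - w) yields phi (u - w) >= delta. *)
Lemma separation (K : set V) u delta : convex_closed K -> K !=set0 -> 0 < delta ->
  (forall w, K w -> delta <= N (u - w)) ->
  exists phi, bounded_linear phi /\ forall w, K w -> delta <= phi u - phi w.
Proof.
move=> cK [w0 Kw0] d0 Kd.
pose B v := [set N (v + x.1 *: (u - x.2)) - delta * x.1 | x in
  [set x : R * V | 0 <= x.1 /\ K x.2]].
have lB v : lbound (B v) (- N v).
  move=> _ [[s w]/= [s0 Kw] <-].
  have : delta * s <= N (s *: (u - w)).
    by rewrite N_scale ger0_norm// mulrC ler_wpM2l// Kd.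
  have := N_triangle (v + s *: (u - w)) (- v).
  rewrite addrAC subrr add0r N_opp; lra.
have hB v : has_inf (B v).
  split; last by exists (- N v).
  by exists (N (v + 0 *: (u - w0)) - delta * 0), (0, w0).
pose S v := inf (B v).
have Sle v s w : 0 <= s -> K w -> S v <= N (v + s *: (u - w)) - delta * s.
  by move=> s0 Kw; apply: ge_inf; [exact: (hB v).2|exists (s, w)].
have SN v : S v <= N v.
  by have := Sle v 0 w0 (lexx _) Kw0; rewrite scale0r addr0 mulr0 subr0.
have sS : sublinear S.
  split.
    move=> v v'; rewrite -lerBlDr; apply: lb_le_inf; first exact: (hB v).1.
    move=> _ [[s w]/= [s0 Kw] <-]; rewrite lerBlDr -lerBlDl; apply: lb_le_inf.
      exact: (hB v').1.
    move=> _ [[s' w']/= [s'0 Kw'] <-]; rewrite lerBlDl.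
    have [ss0|ss0] := eqVneq (s + s') 0.
      have [-> ->] : s = 0 /\ s' = 0 by lra.
      rewrite !scale0r !addr0 !mulr0 !subr0; apply: le_trans (SN _) _.
      exact: N_triangle.
    have sp : 0 < s + s' by rewrite lt_def ss0 addr_ge0.
    (* With this weight s (u - w) + s' (u - w') = (s + s') (u - (t w + (1 - t) w')), and the
       averaged point lies in K by convexity. *)
    pose t := s / (s + s').
    have t01 : 0 <= t <= 1.
      by rewrite /t divr_ge0 ?(ltW sp)//= ler_pdivrMr// mul1r lerDl.
    have -> : N (v + s *: (u - w)) - delta * s + (N (v' + s' *: (u - w')) - delta * s')
      = N (v + s *: (u - w)) + N (v' + s' *: (u - w')) - delta * (s + s') by ring.
    apply: le_trans (Sle _ _ _ (ltW sp) (cK t _ _ t01 Kw Kw')) _.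
    rewrite lerD2r; apply: le_trans (N_triangle _ _); rewrite le_eqVlt; apply/orP; left.
    apply/eqP; congr (N _); rewrite [RHS]addrACA; congr (_ + _).
    have tE : (s + s') * t = s by rewrite /t mulrCA mulfV ?mulr1.
    have tE' : (s + s') * (1 - t) = s' by rewrite mulrBr tE mulr1; ring.
    rewrite !scalerBr scalerDr !scalerA tE tE' scalerDl opprD.
    by rewrite addrACA.
  have pos c v : 0 < c -> c * S v <= S (c *: v).
    move=> c0; apply: lb_le_inf; first exact: (hB (c *: v)).1.
    move=> _ [[s w]/= [s0 Kw] <-].
    have := Sle v (c^-1 * s) w (mulr_ge0 (ltW (eqbRL (invr_gt0 c) c0)) s0) Kw.
    rewrite -(ler_pM2l c0) => /le_trans; apply.
    have -> : c *: v + s *: (u - w) = c *: (v + (c^-1 * s) *: (u - w)).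
      by rewrite [RHS]scalerDr scalerA mulrA mulfV ?mul1r// gt_eqF.
    rewrite N_scale (ger0_norm (ltW c0)) mulrBr.
    by rewrite (_ : c * (delta * _) = delta * s)//; field; rewrite gt_eqF.

  have S0 : S 0 = 0.
    apply/eqP; rewrite eq_le -{1}N0 SN/=; apply: lb_le_inf; first exact: (hB 0).1.
    by move=> x /lB; rewrite N0 oppr0.
  move=> c v; rewrite le_eqVlt => /predU1P[<-|c0]; first by rewrite scale0r mul0r.
  apply/eqP; rewrite eq_le pos// andbT.
  have := pos c^-1 (c *: v); rewrite invr_gt0 => /(_ c0).
  by rewrite scalerA mulVf ?gt_eqF// scale1r ler_pdivrMl.
have [phi [pD pZ pS]] := hahn_banach sS.
have pN v : phi (- v) = - phi v by rewrite -scaleN1r pZ mulN1r.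
exists phi; split; first split => //.
  exists 1 => v; rewrite mul1r ler_norml lerNl -pN -{1}(N_opp v).
  by rewrite !(le_trans (pS _) (SN _)).
move=> w Kw; rewrite -pN -pD.
have := le_trans (pS _) (Sle (- (u - w)) 1 w ler01 Kw).
rewrite scale1r addNr N0 mulr1 sub0r pN; lra.
Qed.
Hypothesis N_reflexive :
  reflexive_space [set: V] +%R *:%R (fun v => (N v)%:E).

Lemma bounded_linearP phi : bounded_linear phi <->
  dual_space [set: V] +%R *:%R (fun v => (N v)%:E) phi.
Proof.
split=> [[pD pZ [C pC]]|[pD pZ [C pC]]]; split.
- by move=> u v _ _; exact: pD.
- by move=> c u _; exact: pZ.
- by exists C => u _; rewrite -EFinM lee_fin.
- by move=> u v; exact: pD.
- by move=> c u; exact: pZ.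
- by exists C => u; rewrite -lee_fin EFinM pC.
Qed.

Lemma bounded_linear_opp phi : bounded_linear phi ->
  bounded_linear (fun v => - phi v).
Proof.
move=> [pD pZ [C pC]]; split.
- by move=> u v; rewrite pD opprD.
- by move=> c u; rewrite pZ mulrN.
- by exists C => u; rewrite normrN.
Qed.

(** The limit is recorded through one-sided bounds valid on a tail, the form in which both Mazur's
    argument and the linear constraint use it. Such bounds pass to the ultralimit because the
    ultrafilter refines [\oo]; the ultralimits exist since the values phi (x k) stay in a compact
    interval. *)
Lemma bounded_weak_limit (x : nat -> V) (M : R) : (forall k, N (x k) <= M) ->
  exists u, forall phi, bounded_linear phi -> forall c k0,
    (forall k, (k0 <= k)%N -> phi (x k) <= c) -> phi u <= c.
Proof.
move=> xM.
have [G [GU ooG]] := @ultraFilterLemma nat \oo _.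
pose Lam (phi : V -> R) : R := lim (phi (x k) @[k --> G]).
have Lam_cvg phi : bounded_linear phi -> phi (x k) @[k --> G] --> Lam phi.
  move=> [_ _ [C pC]].
  suff: cvg (phi (x k) @[k --> G]) by [].
  have := @segment_compact R (- (`|C| * M)) (`|C| * M).
  rewrite compact_ultra => /(_ (phi (x k) @[k --> G]) (fmap_ultra _ GU))[].
    have : G [set k | phi (x k) \in `[- (`|C| * M), `|C| * M]].
      apply: filterE => k /=; rewrite in_itv/= -ler_norml.
      apply: (le_trans (pC _)).
      by apply: le_trans (ler_wpM2r (N_ge0 _) (ler_norm C)) _; rewrite ler_wpM2l.
    by [].
  by move=> l [_ ?]; apply/cvg_ex; exists l.
have Lam_bidual : bidual_space [set: V] +%R *:%R (fun v => (N v)%:E) Lam.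
  split.
  - move=> phi psi /bounded_linearP/Lam_cvg h /bounded_linearP/Lam_cvg h'.
    by apply/cvg_lim => //; exact: cvgD.
  - move=> c phi /bounded_linearP/Lam_cvg h.
    by apply/cvg_lim => //; exact: cvgMr.
  (* The summand 1 makes the factor positive, so that x k divided by it is a point of the unit ball
     over which [dual_norm] is a supremum. *)
  - exists (`|M| + 1) => phi.
    move=> /[dup] dphi /bounded_linearP bphi.
    have M0 : 0 < `|M| + 1 by rewrite ltr_wpDl.
    have pN k : (`|phi (x k)|%:E <= (`|M| + 1)%:E *
        dual_norm [set: V] (fun v => (N v)%:E) phi)%E.
      pose v := (`|M| + 1)^-1 *: x k.
      have -> : x k = (`|M| + 1) *: v by rewrite scalerA mulfV ?gt_eqF// scale1r.
      have [_ -> _] := bphi; rewrite normrM (gtr0_norm M0) EFinM lee_pmul2l//.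
      apply: ereal_sup_ubound; exists v => //; split => //.
      rewrite lee_fin N_scale gtr0_norm ?invr_gt0// ler_pdivrMl// mulr1.
      by rewrite (le_trans (xM k))// (le_trans (ler_norm _))// lerDl.
    (* The bound is compared by cases on its value: +oo makes the claim trivial and -oo contradicts
       [pN]. *)
    move: pN; case: (_ * _)%E => [d pN||]; last 2 first.
    - by move=> _; rewrite leey.
    - by move=> /(_ 0%N).
    have cL := Lam_cvg _ bphi.
    rewrite lee_fin -(cvg_lim (@Rhausdorff R) cL) ler_norml; apply/andP; split.
    - apply: limr_ge; first by apply/cvg_ex; eexists; exact: cL.
      by apply: filterE => k; have := pN k; rewrite lee_fin ler_norml => /andP[].
    - apply: limr_le; first by apply/cvg_ex; eexists; exact: cL.
      by apply: filterE => k; have := pN k; rewrite lee_fin ler_norml => /andP[].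
have [u _ uLam] := N_reflexive Lam_bidual.
exists u => phi bphi c k0 xc.
rewrite -uLam; last exact/bounded_linearP.
have cL := Lam_cvg _ bphi.
rewrite -(cvg_lim (@Rhausdorff R) cL).
apply: limr_le; first by apply/cvg_ex; eexists; exact: cL.
by apply: ooG; exists k0.
Qed.

(** If the hull of a tail stayed at distance e from u, a separating phi would satisfy phi (x j) <=
    phi u - e along that tail, and the weak limit would give phi u <= phi u - e. *)
Lemma mazur (x : nat -> V) (M : R) : (forall k, N (x k) <= M) ->
  exists u, (forall phi, bounded_linear phi -> forall c k0,
      (forall k, (k0 <= k)%N -> phi (x k) <= c) -> phi u <= c) /\
    forall k (e : R), 0 < e ->
      exists2 w, hull [set x j | j in [set j | (k <= j)%N]] w & N (u - w) < e.
Proof.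
move=> xM; have [u uP] := bounded_weak_limit xM; exists u; split=> // k e e0.
apply: contrapT => h.
have [||w|phi [bphi phiK]] := @separation
  (hull [set x j | j in [set j | (k <= j)%N]]) u e _ _ e0.
- by move=> t v v' t01; exact: hull_comb.
- by exists (x k); apply: hull_mem; exists k => //=.
- by move=> Kw; rewrite leNgt; apply/negP => ue; apply: h; exists w.
have := uP _ bphi (phi u - e) k _.
have {}phiK j : (k <= j)%N -> phi (x j) <= phi u - e.
  move=> kj; have : hull [set x j | j in [set j | (k <= j)%N]] (x j).
    by apply: hull_mem; exists j.
  by move=> /phiK; lra.
move=> /(_ phiK); lra.
Qed.

(* u is the convex combination of (1 - t) u and 2 u with weights 1 / (1 + t) and
   t / (1 + t), and (1 - t) u is the one of w and (1 - t) / t (u - w) with weights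
   1 - t and t; the latter point lies in the unit ball. *)
Lemma convex_semicontinuity (E : V -> R) u w (t : R) :
  (forall (s : R) v v', 0 <= s <= 1 ->
    E (s *: v + (1 - s) *: v') <= s * E v + (1 - s) * E v') ->
  (forall v, N v < 1 -> E v <= 1) -> (forall v, 0 <= E v) ->
  0 < t < 1 -> N (u - w) < t ->
  E u <= E w + t * (1 + E (2 *: u)).
Proof.
move=> cE E1 E0 /andP[t0 t1] ut.
have t11 : 1 + t != 0 by rewrite gt_eqF//; lra.
have h1 : E u <= (1 + t)^-1 * E ((1 - t) *: u) + (1 - (1 + t)^-1) * E (2 *: u).
  have -> : E u = E ((1 + t)^-1 *: ((1 - t) *: u) +
      (1 - (1 + t)^-1) *: (2 *: u)).
    congr E; rewrite !scalerA -scalerDl -[LHS]scale1r; congr (_ *: _).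
    by field.
  by apply: cE; apply/andP; split; [rewrite invr_ge0|rewrite invf_le1]; lra.
have h2 : E ((1 - t) *: u) <= (1 - t) * E w + t * 1.
  have -> : (1 - t) *: u = (1 - t) *: w +
      (1 - (1 - t)) *: (((1 - t) / t) *: (u - w)).
    rewrite subKr scalerA mulrCA mulfV ?gt_eqF// mulr1 -scalerDr.
    by rewrite addrCA subrr addr0.
  have t01 : 0 <= 1 - t <= 1 by lra.
  apply: (le_trans (cE _ _ _ t01)); rewrite subKr lerD2l ler_wpM2l ?(ltW t0)//.
  apply: E1; rewrite N_scale ger0_norm; last by rewrite divr_ge0 ?(ltW t0)//; lra.
  by rewrite mulrAC ltr_pdivrMr// mul1r; have := N_ge0 (u - w); nra.
have t2 : (1 + t) * E u <= E ((1 - t) *: u) + t * E (2 *: u).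
  have p1 : 0 < 1 + t by lra.
  move: h1; rewrite -(ler_pM2l p1) => /le_trans; apply.
  by rewrite le_eqVlt; apply/orP; left; apply/eqP; field.
(* Nonnegativity allows dropping t E u on the left and - t E w on the right. *)
have := E0 u; have := E0 w; nra.
Qed.

(** In the application E is the gradient energy, L and Lk are the boundary pairings with the limit
    and with the approximating data, and M is the integral over Omega. Coercivity is asked only on
    the kernel of M, where the Poincaré inequality controls the whole norm by the gradient. *)
Theorem minimizers_hull_converge (E L : V -> R) (Lk : nat -> V -> R)
    (M : V -> R) (x : nat -> V) :
  (forall (s : R) v v', 0 <= s <= 1 ->
    E (s *: v + (1 - s) *: v') <= s * E v + (1 - s) * E v') ->
  (forall v, N v < 1 -> E v <= 1) -> (forall v, 0 <= E v) -> E 0 = 0 ->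
  bounded_linear L -> (forall k, Lk k 0 = 0) ->
  (forall e : R, 0 < e -> exists k0, forall k, (k0 <= k)%N ->
    forall v, `|Lk k v - L v| <= e * N v) ->
  bounded_linear M ->
  (forall c, exists S, forall v, M v = 0 -> S < N v -> c * N v < E v) ->
  (forall k, M (x k) = 0) ->
  (forall k v, M v = 0 -> E (x k) + Lk k (x k) <= E v + Lk k v) ->
  exists n (l : nat -> nat -> R) u,
    [/\ forall k, [/\ (k <= n k)%N, forall j, 0 <= l k j &
          \sum_(k <= j < (n k).+1) l k j = 1],
        M u = 0,
        forall k, N (\sum_(k <= j < (n k).+1) l k j *: x j - u) < k.+1%:R^-1 &
        forall v, M v = 0 -> E u + L u <= E v + L v].
Proof.
move=> cE E1 Ege0 E0 bL Lk0 LkL bM coer xM xmin.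
have [LD LZ [C LC]] := bL.
have M0 : M 0 = 0 by have [_ MZ _] := bM; have := MZ 0 0; rewrite scale0r mul0r.
have [k0 Lk0L] := LkL 1 ltr01.
(* For k >= k0 the functional Lk k is bounded by (C + 1) N, so comparison with the competitor 0
   gives E (x k) <= (C + 1) N (x k). This rate of growth is excluded once N (x k) > S. *)
have [S xS] := coer (C + 1).
have xb k : (k0 <= k)%N -> N (x k) <= S.
  move=> kk0; rewrite leNgt; apply/negP => /(xS _ (xM k)).
  have := xmin k 0 M0; rewrite E0 Lk0.
  have := Lk0L k kk0 (x k); have := LC (x k); rewrite !ler_norml; lra.
have [|u [uP uH]] := @mazur (fun k => x (k + k0)%N) S.
  by move=> k; apply: xb; exact: leq_addl.
(* The weak limit preserves upper bounds only, so the equation is obtained from M and from - M. *)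
have uM : M u = 0.
  have h1 : M u <= 0 by apply: (uP _ bM 0 0%N) => k _; rewrite xM.
  have h2 : - M u <= 0.
    by apply: (uP _ (bounded_linear_opp bM) 0 0%N) => k _; rewrite xM oppr0.
  lra.
(* The combination with index k is drawn from indices that are at least k, as the conclusion
   demands, and at least k0, where N (x j) <= S. *)
have uH' k : {w | hull [set x j | j in [set j | (maxn k k0 <= j)%N]] w &
    N (u - w) < k.+1%:R^-1}.
  apply/cid2; have [w Hw uw] := uH k k.+1%:R^-1 (ltac:(by rewrite invr_gt0)).
  exists w => //; move: w Hw {uw}; apply: hull_sub.
    by move=> t v v'; exact: hull_comb.
  move=> _ [j /= kj <-]; apply: hull_mem; exists (j + k0)%N => //=.
  by rewrite geq_max leq_addl andbT (leq_trans kj)// leq_addr.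
pose w k := s2val (uH' k).
have wk k : N (u - w k) < k.+1%:R^-1 := s2valP' (uH' k).
have wH k : hull [set x j | j in [set j | (maxn k k0 <= j)%N]] (w k) :=
  s2valP (uH' k).
have /choice[n /choice[l nl]] : forall k, exists n, exists l : nat -> R,
    [/\ (k <= n)%N, forall j, 0 <= l j,
    \sum_(k <= j < n.+1) l j = 1 & w k = \sum_(k <= j < n.+1) l j *: x j].
  move=> k; apply: hull_tailP; move: (w k) (wH k); apply: hull_sub.
    by move=> t v v'; exact: hull_comb.
  move=> _ [j /= kj <-]; apply: hull_mem; exists j => //=.
  by rewrite (leq_trans _ kj)// leq_maxl.
exists n, l, u; split => //.
- by move=> k; have [] := nl k.
- by move=> k; have [_ _ _ <-] := nl k; rewrite -N_opp opprB.
move=> v Mv; apply/ler_addgt0Pr => e e0.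
(* Three errors of size e / 4 are allowed: replacing Lk j by L at v and at x j, both of seminorm at
   most A, and passing from w k to u, which costs t B. *)
pose A := N v + `|S| + 1.
have A0 : 0 < A by rewrite /A ltr_wpDl// addr_ge0.
have [k1 Lk1L] := LkL (e / 4 / A) (ltac:(rewrite !divr_gt0//)).
pose B := 1 + E (2 *: u) + `|C|.
have B0 : 0 < B by rewrite /B -addrA ltr_wpDr// addr_ge0.
pose t := Num.min (2^-1) (e / 4 / B).
have t0 : 0 < t by rewrite lt_min invr_gt0 ltr0n/= !divr_gt0.
have t1 : t < 1 by rewrite gt_min; apply/orP; left; lra.
have [k2 k2t] : exists k, k.+1%:R^-1 < t.
  have [k _ h] := near_infty_natSinv_lt (PosNum t0).
  by exists k; apply: (h k) => /=.
pose k := maxn k1 k2.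
have ukt : N (u - w k) < t.
  apply: lt_trans (wk k) _; apply: le_lt_trans k2t.
  by rewrite lef_pV2 ?posrE// ler_nat ltnS leq_maxr.
have hE := convex_semicontinuity cE E1 Ege0 (introT andP (conj t0 t1)) ukt.
have hL : L u <= L (w k) + `|C| * t.
  have -> : L u = L (w k) + L (u - w k) by rewrite -LD addrC subrK.
  rewrite lerD2l; apply: le_trans (ler_norm _) _; apply: le_trans (LC _) _.
  apply: le_trans (ler_wpM2r (N_ge0 _) (ler_norm C)) _.
  by rewrite ler_wpM2l// ltW.
have hw : E (w k) + L (w k) <= E v + L v + e / 4 + e / 4.
  (* A sublevel set of E + L is convex, so the bound needs to be checked only at the points x j. *)
  move: (w k) (wH k); apply: (@hull_sub _ _ _ [set z | E z + L z <= E v + L v + e / 4 + e / 4]).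
    move=> s y z /= s01 hy hz; rewrite LD !LZ.
    by have := cE s y z s01; move: s01 => /andP[]; nra.
  move=> _ [j /= kj <-].
  have [k1j k0j] : (k1 <= j)%N /\ (k0 <= j)%N.
    by move: kj; rewrite !geq_max => /andP[/andP[]].
  have := xmin j v Mv.
  have small y : N y <= A -> `|Lk j y - L y| <= e / 4.
    move=> yA; apply: le_trans (Lk1L j k1j y) _.
    rewrite -[leRHS](divfK (lt0r_neq0 A0)) ler_wpM2l// !divr_ge0// ltW//.
  have S0 := normr_ge0 S; have := small (x j); have := small v; rewrite !ler_norml.
  have -> : N v <= A by rewrite /A; lra.
  have -> : N (x j) <= A.
    rewrite (le_trans (xb _ k0j))// (le_trans (ler_norm _))// /A.
    by have := N_ge0 v; lra.
  move=> /(_ isT) + /(_ isT); lra.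
have tB : t * B <= e / 4.
  by rewrite -ler_pdivlMr// /t ge_min lexx orbT.
move: tB hE hL hw; rewrite /B; lra.
Qed.

End reflexive_minimization.

(** * Double-phase modulars and Luxemburg norms *)

Section poweR_facts.
Context {R : realType}.
Implicit Types (x y : \bar R) (r t c : R).
Local Open Scope ereal_scope.

Lemma lee_poweR r x y : (0 <= r)%R -> 0 <= x -> x <= y -> x `^ r <= y `^ r.
Proof.
move=> r0 x0 xy; apply: gt0_ler_poweR; rewrite // in_itv/= leey andbT//.
exact: le_trans x0 xy.
Qed.

Lemma poweR_convex r t x y : (1 <= r)%R -> (0 <= t <= 1)%R -> 0 <= x -> 0 <= y ->
  (t%:E * x + (1 - t)%:E * y) `^ r <= t%:E * x `^ r + (1 - t)%:E * y `^ r.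
Proof.
move=> r1 /andP[t0 t1] x0 y0.
have r0 : r != 0%R by rewrite gt_eqF// (lt_le_trans _ r1).
have t1' : (0 <= 1 - t)%R by rewrite subr_ge0.
have [->|tn0] := eqVneq t 0%R; first by rewrite subr0 !mul0e !mul1e !add0e.
have [->|tn1] := eqVneq t 1%R; first by rewrite subrr !mul0e !mul1e !adde0.
have tp : (0 < t)%R by rewrite lt_def tn0.
have tp' : (0 < 1 - t)%R by rewrite subr_gt0 lt_def eq_sym tn1.
case: x x0 => // [x x0|_]; last first.
  rewrite poweRyr// !gt0_muley ?lte_fin// !addye ?leey// -ltNye;
    by rewrite (lt_le_trans (ltNyr 0%R))// mule_ge0 ?lee_fin ?poweR_ge0.
case: y y0 => // [y y0|_]; last first.
  by rewrite poweRyr// !gt0_muley ?lte_fin// addey// leey.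
rewrite -[leLHS]/(((t * x + (1 - t) * y) `^ r)%:E).
rewrite -[leRHS]/((t * x `^ r + (1 - t) * y `^ r)%:E) lee_fin.
have := @convex_powR R r r1 (Itv01 t0 t1) x y.
rewrite !inE/= !in_itv/= !andbT => /(_ x0 y0); rewrite !convRE.
by [].
Qed.

End poweR_facts.

Section generalized_phi.
Context d (T : measurableType d) (R : realType) (m : {measure set T -> \bar R}).
Variable D : set T.
Hypothesis mD : measurable D.
Implicit Types (Phi Psi : T -> \bar R -> \bar R) (u v w : T -> \bar R).
Local Open Scope ereal_scope.

(** Because the exponent varies with x, the power is rewritten as exp (p ln u) away from the values
    0 and +oo of u, which are treated separately. *)
Lemma measurable_fun_poweR u (p : T -> R) : measurable_fun D u ->
  measurable_fun D p -> (forall x, D x -> 0 <= u x) ->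
  (forall x, D x -> p x != 0%R) -> measurable_fun D (fun x => u x `^ p x).
Proof.
move=> mu_ mp u0 p0.
apply: (@eq_measurable_fun _ _ _ _ _ (fun x => if u x == +oo then +oo else
    (if fine (u x) == 0 then 0 else expR (p x * ln (fine (u x))))%:E)).
  move=> x; rewrite inE => Dx; have := u0 x Dx; have := p0 x Dx.
  case: (u x) => [r p0x r0|p0x _|//]; last by rewrite eqxx poweRyr.
  by rewrite poweR_EFin /powR (negbTE p0x).
apply: measurable_fun_if => //.
  by apply: measurable_fun_eqe => //; exact: measurable_cst.
set E := _ `&` _.
have mE : measurable E.
  by apply: (measurable_fun_eqe mu_ (measurable_cst _)).
have ED : E `<=` D by move=> x [].
have mv : measurable_fun E (fun x => fine (u x)).
  apply: measurableT_comp => //; exact: measurable_funS mu_.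
have mpE : measurable_fun E p by exact: measurable_funS mp.
apply/measurable_EFinP; apply: measurable_fun_if => //.
- by apply: measurable_fun_eqr => //; exact: measurable_cst.
- have mF : measurable (E `&` (fun x => fine (u x) == 0%R) @^-1` [set false]).
    by apply: (measurable_fun_eqr mv (measurable_cst _)).
  have FE : (E `&` (fun x => fine (u x) == 0%R) @^-1` [set false]) `<=` E by move=> x [].
  apply: measurableT_comp => //; apply: measurable_funM.
    exact: measurable_funS mpE.
  apply: measurableT_comp => //; exact: measurable_funS mv.
Qed.

(** The properties behind the modular and Luxemburg lemmas, isolated so that these apply to
    [double_phase] as well as to [energy_density]. Monotonicity and convexity include the argument
    +oo, since functions are extended real valued. *)
Definition generalized_phi Phi : Prop :=
  [/\ forall u, measurable_fun D u -> measurable_fun D (fun x => Phi x `|u x|),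
      forall x, D x -> Phi x 0 = 0,
      forall x (r s : \bar R), D x -> 0 <= r -> r <= s -> Phi x r <= Phi x s &
      forall x (t : R) (r s : \bar R), D x -> (0 <= t <= 1)%R -> 0 <= r -> 0 <= s ->
        Phi x (t%:E * r + (1 - t)%:E * s) <=
        t%:E * Phi x r + (1 - t)%:E * Phi x s].

Lemma generalized_phi_power (p : T -> R) : measurable_fun D p ->
  (forall x, D x -> (1 <= p x)%R) -> generalized_phi (fun x r => r `^ p x).
Proof.
move=> mp p1.
have p0 x : D x -> p x != 0%R by move=> /p1 ?; rewrite gt_eqF// (lt_le_trans ltr01).
split.
- move=> u mu_; apply: measurable_fun_poweR => //; exact: measurableT_comp.
- by move=> x Dx; rewrite poweR0r// p0.
- move=> x r s Dx r0 rs; apply: lee_poweR => //.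
  by rewrite (le_trans ler01)// p1.
- by move=> x t r s Dx *; apply: poweR_convex => //; exact: p1.
Qed.

Lemma generalized_phi_ge0 Phi x (r : \bar R) : generalized_phi Phi -> D x -> 0 <= r ->
  0 <= Phi x r.
Proof. by move=> [_ P0 Pmono _] Dx r0; rewrite -(P0 _ Dx) Pmono. Qed.

Lemma generalized_phiZ Phi (a : T -> R) : measurable_fun D a ->
  (forall x, D x -> (0 <= a x)%R) -> generalized_phi Phi ->
  generalized_phi (fun x r => (a x)%:E * Phi x r).
Proof.
move=> ma a0 gP; have [mP P0 Pmono Pconv] := gP; split.
- move=> u mu_; apply: emeasurable_funM; last exact: mP.
  exact/measurable_EFinP.
- by move=> x Dx; rewrite P0// mule0.
- by move=> x r s Dx r0 rs; rewrite lee_wpmul2l ?lee_fin ?a0// Pmono.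
- move=> x t r s Dx t01 r0 s0; have /andP[t0 t1] := t01.
  rewrite muleCA (muleCA (1 - t)%:E) -ge0_muleDr ?mule_ge0 ?lee_fin ?subr_ge0//;
    [|exact: generalized_phi_ge0..].
  by rewrite lee_wpmul2l ?lee_fin ?a0// Pconv.
Qed.

Lemma generalized_phiD Phi Psi : generalized_phi Phi -> generalized_phi Psi ->
  generalized_phi (fun x r => Phi x r + Psi x r).
Proof.
move=> gP gQ; have [mP P0 Pmono Pconv] := gP; have [mQ Q0 Qmono Qconv] := gQ; split.
- by move=> u mu_; apply: emeasurable_funD; [exact: mP|exact: mQ].
- by move=> x Dx; rewrite P0// Q0// adde0.
- by move=> x r s Dx r0 rs; rewrite leeD ?Pmono ?Qmono.
- move=> x t r s Dx t01 r0 s0; have /andP[t0 t1] := t01.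
  rewrite !ge0_muleDr; [|exact: generalized_phi_ge0..].
  by rewrite addeACA leeD ?Pconv ?Qconv.
Qed.

End generalized_phi.

Section modular_facts.
Context d (T : measurableType d) (R : realType) (m : {measure set T -> \bar R}).
Variables (D : set T) (Phi : T -> \bar R -> \bar R).
Hypotheses (mD : measurable D) (gP : generalized_phi D Phi).
Implicit Types (u v w : T -> \bar R).
Local Open Scope ereal_scope.
Local Notation rho := (modular m Phi D).
Local Notation lux := (luxemburg m Phi D).

Let phi_ge0 x (r : \bar R) : D x -> 0 <= r -> 0 <= Phi x r.
Proof. exact: generalized_phi_ge0. Qed.

Let mphi u : measurable_fun D u -> measurable_fun D (fun x => Phi x `|u x|).
Proof. by have [h _ _ _] := gP; exact: h. Qed.

Lemma modular_ge0 u : 0 <= rho u.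
Proof. by apply: integral_ge0 => x Dx; exact: phi_ge0. Qed.

Lemma le_modular u v : measurable_fun D u -> measurable_fun D v ->
  (\forall x \ae m, D x -> `|u x| <= `|v x|) -> rho u <= rho v.
Proof.
move=> mu_ mv uv; have [_ _ Pmono _] := gP.
apply: ae_ge0_le_integral => //; [|exact: mphi| |exact: mphi|].
- by move=> x Dx; exact: phi_ge0.
- by move=> x Dx; exact: phi_ge0.
- by apply: filterS uv => x uvx Dx; apply: Pmono => //; exact: uvx.
Qed.

Lemma modular_convex (t : R) u v w : (0 <= t <= 1)%R ->
  measurable_fun D u -> measurable_fun D v -> measurable_fun D w ->
  (\forall x \ae m, D x -> `|w x| <= t%:E * `|u x| + (1 - t)%:E * `|v x|) ->
  rho w <= t%:E * rho u + (1 - t)%:E * rho v.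
Proof.
move=> /[dup] t01 /andP[t0 t1] mu_ mv mw wuv; have [_ _ Pmono Pconv] := gP.
have Pu x : D x -> 0 <= Phi x `|u x| by move=> Dx; exact: phi_ge0.
have Pv x : D x -> 0 <= Phi x `|v x| by move=> Dx; exact: phi_ge0.
have t1' : (0 <= 1 - t)%R by rewrite subr_ge0.
rewrite /modular -!ge0_integralZl_EFin//; [|exact: mphi..].
rewrite -ge0_integralD//.
- apply: ae_ge0_le_integral => //.
  + by move=> x Dx; exact: phi_ge0.
  + exact: mphi.
  + by move=> x Dx; rewrite adde_ge0// mule_ge0 ?lee_fin// ?Pu ?Pv.
  + by apply: emeasurable_funD; apply: measurable_funeM; exact: mphi.
  + apply: filterS wuv => x wx Dx; apply: le_trans (Pconv _ _ _ _ Dx t01 _ _) => //.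
    by apply: Pmono => //; exact: wx.
- by move=> x Dx; rewrite mule_ge0 ?lee_fin ?Pu.
- by apply: measurable_funeM; exact: mphi.
- by move=> x Dx; rewrite mule_ge0 ?lee_fin ?Pv.
- by apply: measurable_funeM; exact: mphi.
Qed.

Lemma modular0 u : measurable_fun D u ->
  (\forall x \ae m, D x -> u x = 0) -> rho u = 0.
Proof.
move=> mu_ u0; apply/eqP; rewrite eq_le modular_ge0 andbT.
rewrite (@le_trans _ _ (rho (cst 0)))//.
  apply: le_modular => //.
  by apply: filterS u0 => x h Dx; rewrite h.
rewrite /modular integral0_eq// => x Dx; rewrite [cst _ _]/= abse0.
by have [_ P0 _ _] := gP; exact: P0.
Qed.

Lemma modular_shrink (t : R) u w : (0 <= t <= 1)%R ->
  measurable_fun D u -> measurable_fun D w ->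
  (\forall x \ae m, D x -> `|w x| <= t%:E * `|u x|) -> rho w <= t%:E * rho u.
Proof.
move=> t01 mu_ mw wu.
have := @modular_convex t u (cst 0) w t01 mu_ (measurable_cst _) mw.
rewrite (@modular0 (cst 0))//; last exact: aeW.
rewrite mule0 adde0; apply.
by apply: filterS wu => x h Dx; rewrite [cst _ _]/= abse0 mule0 adde0; exact: h.
Qed.

Lemma luxemburg_ge0 u : 0 <= lux u.
Proof.
by apply: le_ereal_inf_tmp => _ [t [t0 _] <-]; rewrite lee_fin ltW.
Qed.

Lemma luxemburg_le (t : R) u : (0 < t)%R -> rho (fun x => (t^-1)%:E * u x) <= 1 ->
  lux u <= t%:E.
Proof. by move=> t0 ut; apply: ereal_inf_lbound; exists t. Qed.

(** The admissible tau form an upward closed set, so any t strictly above the norm is admissible.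
    Later proofs work with such a t and a slack e instead of asking whether the infimum is
    attained. *)
Lemma luxemburg_lt (t : R) u : measurable_fun D u -> lux u < t%:E ->
  (0 < t)%R /\ rho (fun x => (t^-1)%:E * u x) <= 1.
Proof.
move=> mu_ /ereal_inf_lt[_ [s [s0 us] <-]]; rewrite lte_fin => st.
have t0 : (0 < t)%R by exact: lt_trans st.
split => //; apply: le_trans us; apply: le_modular; [exact: measurable_funeM..|].
apply: aeW => x _; rewrite !abseM lee_wpmul2r//= lee_fin.
by rewrite !gtr0_norm ?invr_gt0// lef_pV2 ?posrE// ltW.
Qed.

Lemma luxemburg_lty u : measurable_fun D u -> rho u < +oo -> lux u < +oo.
Proof.
(* For this t >= 1, convexity and vanishing at 0 give rho (u / t) <= rho u / t <= 1. *)
move=> mu_ uoo; pose t := (1 + fine (rho u))%R.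
have r0 : (0 <= fine (rho u))%R by rewrite fine_ge0// modular_ge0.
have t1 : (1 <= t)%R by rewrite lerDl.
have t0 : (0 < t)%R by exact: lt_le_trans t1.
apply: (@le_lt_trans _ _ t%:E); last exact: ltry.
apply: luxemburg_le => //.
apply: (@le_trans _ _ ((t^-1)%:E * rho u)).
  apply: modular_shrink => //; last 2 first.
  - exact: measurable_funeM.
  - by apply: aeW => x _; rewrite abseM /= gtr0_norm ?invr_gt0.
  - by rewrite invr_ge0 ltW//= invf_le1.
rewrite -(@fineK _ (rho u)) ?ge0_fin_numE ?modular_ge0//.
by rewrite -EFinM lee_fin mulrC ler_pdivrMr// mul1r lerDr.
Qed.

(** Stated for any w dominated by |u| + |v|, because minimal weak upper gradients are only
    subadditive, and only almost everywhere. *)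
Lemma luxemburg_triangle u v w :
  measurable_fun D u -> measurable_fun D v -> measurable_fun D w ->
  (\forall x \ae m, D x -> `|w x| <= `|u x| + `|v x|) ->
  lux w <= lux u + lux v.
Proof.
move=> mu_ mv mw wuv.
have := luxemburg_ge0 u; have := luxemburg_ge0 v.
case Eu : (lux u) => [a||//]; last first.
  by case: (lux v) => // *; rewrite leey.
case Ev : (lux v) => [b||//]; last by move=> _ _; exact: leey.
rewrite !lee_fin => b0 a0; apply/lee_addgt0Pr => e e0.
pose s := (a + e / 2)%R; pose t := (b + e / 2)%R.
have e2 : (0 < e / 2)%R by rewrite divr_gt0.
have [s0 us] : (0 < s)%R /\ rho (fun x => (s^-1)%:E * u x) <= 1.
  by apply: luxemburg_lt => //; rewrite Eu lte_fin ltrDl.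
have [t0 vt] : (0 < t)%R /\ rho (fun x => (t^-1)%:E * v x) <= 1.
  by apply: luxemburg_lt => //; rewrite Ev lte_fin ltrDl.
have st0 : (0 < s + t)%R by exact: addr_gt0.
have -> : a%:E + b%:E + e%:E = (s + t)%:E.
  by rewrite -!EFinD /s /t; congr EFin; field.
apply: luxemburg_le => //.
(* (u + v) / (s + t) is the convex combination of u / s and v / t with weight s / (s + t) on the
   first. *)
have k01 : (0 <= s / (s + t) <= 1)%R.
  by rewrite divr_ge0 ?(ltW s0) ?(ltW st0)//= ler_pdivrMr// mul1r lerDl ltW.
apply: (@le_trans _ _ ((s / (s + t))%:E * 1 + (1 - s / (s + t))%:E * 1)); last first.
  by rewrite !mule1 -EFinD addrCA subrr addr0.
have /andP[k0 k1] := k01.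
apply: le_trans _ (leeD (lee_wpmul2l _ us) (lee_wpmul2l _ vt)); rewrite ?lee_fin ?subr_ge0//.
apply: modular_convex => //; [exact: measurable_funeM..|].
apply: filterS wuv => x wx Dx; rewrite !abseM /= !gtr0_norm ?invr_gt0//.
rewrite !muleA -!EFinM.
have -> : (s / (s + t) / s = (s + t)^-1)%R by field; rewrite !gt_eqF.
have -> : ((1 - s / (s + t)) / t = (s + t)^-1)%R by field; rewrite !gt_eqF.
by rewrite -ge0_muleDr// lee_wpmul2l ?wx// lee_fin invr_ge0 ltW.
Qed.

Lemma le_luxemburg_scale (c : R) u w :
  measurable_fun D u -> measurable_fun D w ->
  (\forall x \ae m, D x -> `|w x| <= `|c|%:E * `|u x|) ->
  lux w <= `|c|%:E * lux u.
Proof.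
move=> mu_ mw wu.
have [c0|c0] := eqVneq c 0%R.
  rewrite c0 normr0 mul0e; apply/lee_addgt0Pr => e e0; rewrite add0e.
  apply: luxemburg_le => //; rewrite modular0//; first exact: measurable_funeM.
  apply: filterS wu => x + Dx; rewrite c0 normr0 mul0e => /(_ Dx).
  move=> wx0; have : `|w x| == 0 by rewrite eq_le wx0 abse_ge0.
  by rewrite abse_eq0 => /eqP ->; rewrite mule0.
have cp : (0 < `|c|)%R by rewrite normr_gt0.
have := luxemburg_ge0 u; case Eu : (lux u) => [a||//] a0; last first.
  by rewrite gt0_muley ?lte_fin// leey.
apply/lee_addgt0Pr => e e0.
have [s0 us] : (0 < a + e / `|c|)%R /\
    rho (fun x => ((a + e / `|c|)^-1)%:E * u x) <= 1.
  by apply: luxemburg_lt => //; rewrite Eu lte_fin ltrDl divr_gt0.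
have -> : `|c|%:E * a%:E + e%:E = (`|c| * (a + e / `|c|))%:E.
  rewrite -EFinM -EFinD; congr EFin; field; by rewrite gt_eqF.
apply: luxemburg_le; first exact: mulr_gt0.
apply: le_trans us; apply: le_modular; [exact: measurable_funeM..|].
set b := (a + e / `|c|)%R in s0 *.
apply: filterS wu => x wx Dx; rewrite !abseM.
have -> : `|(b^-1)%:E| = (b^-1)%:E by rewrite /= gtr0_norm ?invr_gt0.
have -> : `|((`|c| * b)^-1)%:E| = ((`|c| * b)^-1)%:E.
  by rewrite /= gtr0_norm// invr_gt0 mulr_gt0.
have -> : ((`|c| * b)^-1)%:E * `|w x| = (b^-1)%:E * ((`|c|^-1)%:E * `|w x|).
  by rewrite muleA -EFinM invfM mulrC.
rewrite lee_wpmul2l//; first by rewrite lee_fin invr_ge0 ltW.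
by rewrite lee_pdivrMl// wx.
Qed.

Lemma le_luxemburg u w : measurable_fun D u -> measurable_fun D w ->
  (\forall x \ae m, D x -> `|w x| <= `|u x|) -> lux w <= lux u.
Proof.
move=> mu_ mw wu; have := @le_luxemburg_scale 1 u w mu_ mw.
by rewrite normr1 mul1e; apply; apply: filterS wu => x; rewrite mul1e.
Qed.

(** The integral of a nonnegative function is a supremum over the simple functions below it, hence
    monotone without any measurability. It serves for Young majorants such as the complementary
    function, a supremum over uncountably many s. *)
Lemma ge0_le_integral_nonmeasurable (f g : T -> \bar R) :
  (forall x, D x -> 0 <= f x) -> (forall x, D x -> f x <= g x) ->
  \int[m]_(x in D) f x <= \int[m]_(x in D) g x.
Proof.
move=> f0 fg; rewrite !ge0_integralE//; last first.
  by move=> x Dx; exact: le_trans (f0 x Dx) (fg x Dx).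
apply: le_ereal_sup => _ [h hf <-]; exists h => //= x.
apply: le_trans (hf x) _; rewrite !patchE; case: ifPn => //.
by rewrite inE => /fg.
Qed.

(** Young's inequality is integrated at v / s, with s slightly above the norm of v. The majorant G
    is abstract: the complementary function gives Hölder's inequality, the constant 1 an L1
    bound. *)
Lemma holder_luxemburg (f G : T -> \bar R) (K : R) v :
  measurable_fun D f -> measurable_fun D v ->
  (forall x, D x -> 0 <= G x) -> \int[m]_(x in D) G x <= K%:E ->
  (forall x (r : \bar R), D x -> 0 <= r -> `|f x| * r <= G x + Phi x r) ->
  \int[m]_(x in D) `|f x * v x| <= (K + 1)%:E * lux v.
Proof.
move=> mf mv G0 GK young.
have K0 : (0 <= K)%R by rewrite -lee_fin; apply: le_trans GK; exact: integral_ge0.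
have K1 : (0 < K + 1)%R by rewrite ltr_wpDl.
have := luxemburg_ge0 v; case Ev : (lux v) => [a||//] a0; last first.
  by rewrite gt0_muley ?lte_fin// leey.
apply/lee_addgt0Pr => e e0.
set s := (a + e / (K + 1))%R.
have [s0 vs] : (0 < s)%R /\ rho (fun x => (s^-1)%:E * v x) <= 1.
  by apply: luxemburg_lt => //; rewrite Ev lte_fin ltrDl divr_gt0.
have -> : (K + 1)%:E * a%:E + e%:E = s%:E * (K + 1)%:E.
  rewrite -!EFinM -EFinD /s; congr EFin; field; by rewrite gt_eqF.
rewrite -lee_pdivrMl// -ge0_integralZl_EFin//; last 2 first.
- by apply: measurableT_comp => //; exact: emeasurable_funM.
- by rewrite invr_ge0 ltW.
pose w x := (s^-1)%:E * v x.
have mw : measurable_fun D w by exact: measurable_funeM.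
have mfw : measurable_fun D (fun x => `|f x| * `|w x|).
  by apply: emeasurable_funM; exact: measurableT_comp.
(* A measurable function below G, inserted because the integral of a sum is split and G is not
   assumed measurable. *)
pose H x := maxe 0 (`|f x| * `|w x| - Phi x `|w x|).
have mH : measurable_fun D H.
  apply: measurable_maxe => //; apply: emeasurable_funB => //; exact: mphi.
have H0 x : D x -> 0 <= H x by move=> _; rewrite le_max lexx.
apply: (@le_trans _ _ (\int[m]_(x in D) (H x + Phi x `|w x|))).
  apply: ge0_le_integral => //.
  - by move=> x Dx; rewrite mule_ge0// lee_fin invr_ge0 ltW.
  - by apply: measurable_funeM; apply: measurableT_comp => //; exact: emeasurable_funM.
  - by apply: emeasurable_funD => //; exact: mphi.
  - move=> x Dx.
    have -> : (s^-1)%:E * `|f x * v x| = `|f x| * `|w x|.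
      by rewrite /w !abseM /= gtr0_norm ?invr_gt0// muleCA.
    have := @phi_ge0 x `|w x| Dx (abse_ge0 _); have := H0 x Dx; rewrite /H.
    case: (Phi x `|w x|) => [r||] H0x r0 //; last first.
      by rewrite addey ?leey// -ltNye (lt_le_trans (ltNyr 0%R))// le_max lexx.
    rewrite -[leLHS](@subeK _ _ r%:E)//; apply: leeD => //.
    by rewrite le_max lexx orbT.
rewrite ge0_integralD//; last 2 first.
- by move=> x Dx; exact: phi_ge0.
- exact: mphi.
rewrite EFinD leeD//; apply: le_trans GK; apply: ge0_le_integral_nonmeasurable => // x Dx.
rewrite ge_max G0//=.
have := @phi_ge0 x `|w x| Dx (abse_ge0 _); have := young x `|w x| Dx (abse_ge0 _).
by case: (Phi x `|w x|) => [r| |//]; [rewrite leeBlDr|rewrite addeNy leNye].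
Qed.

End modular_facts.

Section double_phase_facts.
Context d (T : measurableType d) (R : realType) (m : {measure set T -> \bar R}).
Variables (D : set T) (p q a : T -> R).
Hypotheses (mD : measurable D) (dp : double_phase_data m D p q a).
Implicit Types (u v w f : T -> \bar R) (x : T) (r s : \bar R).
Local Open Scope ereal_scope.
Local Notation H := (double_phase p q a).
Local Notation A := (energy_density p q a).
Local Notation rho := (modular m H D).
Local Notation lux := (luxemburg m H D).

Let p1 x : D x -> (1 < p x)%R.
Proof. by have [_ h _ _ _] := dp; move=> /h /andP[]. Qed.

Let q1 x : D x -> (1 < q x)%R.
Proof. by have [_ h _ _ _] := dp; move=> /h /andP[]; exact: lt_trans. Qed.

Let p_gt0 x : D x -> (0 < p x)%R.
Proof. by move=> /p1; exact: lt_trans. Qed.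

Let q_gt0 x : D x -> (0 < q x)%R.
Proof. by move=> /q1; exact: lt_trans. Qed.

Let a0 x : D x -> (0 <= a x)%R.
Proof. by have [_ _ _ _ [h _]] := dp; exact: h. Qed.

Lemma double_phase_generalized_phi : generalized_phi D H.
Proof.
have [[mp mq ma] _ _ _ _] := dp.
apply: generalized_phiD; first by apply: generalized_phi_power => // x /p1/ltW.
by apply: generalized_phiZ => //; apply: generalized_phi_power => // x /q1/ltW.
Qed.

Lemma energy_density_generalized_phi : generalized_phi D A.
Proof.
have [[mp mq ma] _ _ _ _] := dp.
have minv (b : T -> R) : measurable_fun D b -> (forall x, D x -> (1 < b x)%R) ->
    measurable_fun D (fun x => (b x)^-1)%R.
  move=> mb b1; apply: (@eq_measurable_fun _ _ _ _ _ (fun x => expR (- ln (b x)))).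
    move=> x; rewrite inE => /b1 bx; rewrite expRN lnK// posrE; exact: lt_trans bx.
  apply: measurableT_comp => //; apply: measurableT_comp => //.
  exact: measurableT_comp.
have -> : A = (fun x r => ((p x)^-1)%:E * r `^ p x +
    (a x)%:E * (((q x)^-1)%:E * r `^ q x)).
  by apply/funext => x; apply/funext => r; rewrite /energy_density !(muleC _ (_^-1)%:E).
apply: generalized_phiD.
  apply: generalized_phiZ => //; first exact: minv.
    by move=> x /p_gt0 ?; rewrite invr_ge0 ltW.
  by apply: generalized_phi_power => // x /p1/ltW.
apply: generalized_phiZ => //; apply: generalized_phiZ => //; first exact: minv.
  by move=> x /q_gt0 ?; rewrite invr_ge0 ltW.
by apply: generalized_phi_power => // x /q1/ltW.
Qed.

Let gH := double_phase_generalized_phi.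
Let gA := energy_density_generalized_phi.

(** Real bounds extracted from the essential ones: r0 > 1 is the source of superlinear growth, Q
    controls scaling from above, and K makes the modular of constants finite on sets of finite
    measure. *)
Lemma exponents_bounded : exists r0 Q K : R, [/\ (1 < r0)%R, (1 < Q)%R, (0 <= K)%R &
  \forall x \ae m, D x -> [/\ (r0 <= p x)%R, (q x <= Q)%R & (a x <= K)%R]].
Proof.
have [_ pq [pinf _] [_ qsup] [_ asup]] := dp.
have {pinf} [r0 r1 pr] : exists2 r0 : R, (1 < r0)%R &
    \forall x \ae m, D x -> (r0 <= p x)%R.
  have [y hy y1] := ereal_sup_gt pinf; case: y hy y1 => [r0||//] /= hy.
    rewrite lte_fin => r1; exists r0 => //.
  (* The witness +oo means that D is null, and then any exponent above 1 serves. *)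
  move=> _; exists 2%R; first by rewrite ltr1n.
  by move: hy; apply: filterS => x h /h; rewrite leye_eq.
have bound (b : T -> R) : ess_sup_on m D b < +oo ->
    exists K : R, \forall x \ae m, D x -> (b x <= K)%R.
  move=> /ereal_inf_lt[[K|//|] /= hK _]; last first.
    by exists 0%R; apply: filterS hK => x /[apply]; rewrite leeNy_eq.
  by exists K; apply: filterS hK => x /[apply]; rewrite lee_fin.
have [Q qQ] := bound _ qsup.
have [K aK] := bound _ asup.
exists r0, (Num.max Q 2%R), (Num.max K 0%R); split => //.
- by rewrite lt_max ltr1n orbT.
- by rewrite le_max lexx orbT.
- apply: filterS3 pr qQ aK => x h1 h2 h3 Dx; split; first exact: h1.
    by rewrite le_max h2.
  by rewrite le_max (le_trans (ler_norm _) (h3 Dx)).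
Qed.

Lemma double_phase_ge0 x r : 0 <= r -> D x -> 0 <= H x r.
Proof. by move=> r0 Dx; exact: (generalized_phi_ge0 gH). Qed.

Lemma energy_density_le x r : D x -> A x r <= H x r.
Proof.
move=> Dx; apply: leeD.
  rewrite -[leRHS]mule1 lee_wpmul2l ?poweR_ge0// lee_fin invf_le1 ?p_gt0//.
  exact/ltW/p1.
apply: lee_wpmul2l; first by rewrite lee_fin a0.
rewrite -[leRHS]mule1 lee_wpmul2l ?poweR_ge0// lee_fin invf_le1 ?q_gt0//.
exact/ltW/q1.
Qed.

Lemma double_phase_le_energy (Q : R) x r : D x -> (q x <= Q)%R ->
  H x r <= Q%:E * A x r.
Proof.
move=> Dx qQ.
have pq : (p x < q x)%R by have [_ h _ _ _] := dp; have /andP[] := h x Dx.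
have p0 := p_gt0 Dx.
have q0 := q_gt0 Dx.
have le1 (b : R) : (0 < b)%R -> (b <= Q)%R -> (1 <= Q * b^-1)%R.
  by move=> b0 bQ; rewrite ler_pdivlMr// mul1r.
have Q0 : (0 <= Q)%R by rewrite (le_trans _ qQ)// ltW.
rewrite ge0_muleDr; last 2 first.
- by rewrite mule_ge0 ?poweR_ge0// lee_fin invr_ge0 ltW.
- by rewrite !mule_ge0 ?poweR_ge0// lee_fin ?a0// invr_ge0 ltW.
apply: leeD.
  rewrite -[leLHS]mule1 muleCA -EFinM lee_wpmul2l ?poweR_ge0// lee_fin le1//.
  by rewrite (le_trans (ltW pq)).
rewrite (muleCA Q%:E) lee_wpmul2l ?lee_fin ?a0//.
by rewrite -[leLHS]mule1 muleCA -EFinM lee_wpmul2l ?poweR_ge0// lee_fin le1.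
Qed.

Lemma double_phaseZ_ge (r0 t : R) x r : D x -> (r0 <= p x)%R -> (1 <= t)%R ->
  0 <= r -> (t `^ r0)%:E * H x r <= H x (t%:E * r).
Proof.
move=> Dx rp t1 r_ge0; have t0 : (0 <= t)%R by exact: le_trans t1.
have pq : (p x < q x)%R by have [_ h _ _ _] := dp; have /andP[] := h x Dx.
rewrite /double_phase !poweRM ?lee_fin//.
rewrite ge0_muleDr ?poweR_ge0 ?mule_ge0 ?lee_fin ?a0 ?poweR_ge0//.
rewrite !poweR_EFin (muleCA (t `^ r0)%:E); apply: leeD.
  by rewrite lee_wpmul2r ?poweR_ge0// lee_fin ler_powR.
rewrite lee_wpmul2l ?lee_fin ?a0// lee_wpmul2r ?poweR_ge0// lee_fin ler_powR//.
by rewrite (le_trans rp)// ltW.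
Qed.

(** A form of the Delta_2 condition, by which finiteness of the modular is preserved under multiples
    and sums. *)
Lemma double_phaseZ_le (Q t : R) x r : D x -> (q x <= Q)%R -> (1 <= t)%R ->
  0 <= r -> H x (t%:E * r) <= (t `^ Q)%:E * H x r.
Proof.
move=> Dx qQ t1 r_ge0; have t0 : (0 <= t)%R by exact: le_trans t1.
have pq : (p x < q x)%R by have [_ h _ _ _] := dp; have /andP[] := h x Dx.
rewrite /double_phase !poweRM ?lee_fin//.
rewrite ge0_muleDr ?poweR_ge0 ?mule_ge0 ?lee_fin ?a0 ?poweR_ge0//.
rewrite !poweR_EFin (muleCA (t `^ Q)%:E); apply: leeD.
  rewrite lee_wpmul2r ?poweR_ge0// lee_fin ler_powR//.
  by rewrite (le_trans (ltW pq)).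
by rewrite lee_wpmul2l ?lee_fin ?a0// lee_wpmul2r ?poweR_ge0// lee_fin ler_powR.
Qed.

Lemma le_add1_double_phase x r : D x -> 0 <= r -> r <= 1 + H x r.
Proof.
move=> Dx r0; have [r1|/ltW r1] := leP r 1.
  by rewrite (le_trans r1)// leeDl// double_phase_ge0.
apply: (@le_trans _ _ (r `^ p x)).
  case: r r0 r1 => [r||//] r0 r1; last by rewrite poweRyr// gt_eqF ?p_gt0.
  by rewrite poweR_EFin lee_fin le1r_powR// ltW// p1.
rewrite /double_phase addeCA leeDl// adde_ge0// mule_ge0 ?poweR_ge0// lee_fin.
exact: a0.
Qed.

Lemma double_phasey x : D x -> H x +oo = +oo.
Proof.
move=> Dx; apply/eqP; rewrite -leye_eq /double_phase.
rewrite poweRyr ?gt_eqF ?p_gt0//.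
by rewrite leeDl// mule_ge0 ?poweR_ge0// lee_fin a0.
Qed.

Lemma complementary_ge0 x r : D x -> 0 <= complementary H x r.
Proof.
move=> Dx; have [_ H0 _ _] := gH.
apply: ereal_sup_ubound; exists 0%R; first exact: lexx.
by rewrite [H x _]H0// mul0e sube0.
Qed.

Lemma young_complementary x r s : D x -> 0 <= r -> 0 <= s ->
  r * s <= complementary H x r + H x s.
Proof.
move=> Dx r0; case: s => [s||//] s0; last first.
  rewrite double_phasey// addey ?leey// -ltNye (lt_le_trans (ltNyr 0%R))//.
  exact: complementary_ge0.
have fs : H x s%:E \is a fin_num.
  by rewrite /double_phase !poweR_EFin -EFinM -EFinD.
rewrite -leeBlDr// muleC; apply: ereal_sup_ubound; exists s => //.
Qed.

Lemma modularZ_lty u w (c : R) : measurable_fun D u -> measurable_fun D w ->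
  (\forall x \ae m, D x -> `|w x| <= c%:E * `|u x|) -> rho u < +oo -> rho w < +oo.
Proof.
move=> mu_ mw wu uoo; have [r0 [Q [K [r1 Q1 K0 bnd]]]] := exponents_bounded.
pose t := Num.max 1%R c.
have t1 : (1 <= t)%R by rewrite le_max lexx.
apply: (@le_lt_trans _ _ ((t `^ Q)%:E * rho u)); last first.
  by rewrite lte_mul_pinfty// ?lee_fin ?powR_ge0.
rewrite -ge0_integralZl_EFin ?powR_ge0//; last 2 first.
- by move=> x Dx; exact: double_phase_ge0.
- by have [h _ _ _] := gH; exact: h.
apply: ae_ge0_le_integral => //.
- by move=> x Dx; exact: double_phase_ge0.
- by have [h _ _ _] := gH; exact: h.
- by move=> x Dx; rewrite mule_ge0 ?lee_fin ?powR_ge0// double_phase_ge0.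
- by apply: measurable_funeM; have [h _ _ _] := gH; exact: h.
apply: filterS2 wu bnd => x wx bx Dx; have [_ qQ _] := bx Dx.
apply: le_trans (double_phaseZ_le Dx qQ t1 (abse_ge0 _)).
have [_ _ Pmono _] := gH; apply: Pmono => //; apply: le_trans (wx Dx) _.
by rewrite lee_wpmul2r// lee_fin le_max lexx orbT.
Qed.

Lemma modularD_lty u v w :
  measurable_fun D u -> measurable_fun D v -> measurable_fun D w ->
  (\forall x \ae m, D x -> `|w x| <= `|u x| + `|v x|) ->
  rho u < +oo -> rho v < +oo -> rho w < +oo.
Proof.
move=> mu_ mv mw wuv uoo voo.
have h01 : (0 <= (2^-1 : R) <= 1)%R by rewrite invr_ge0 ler0n/= invf_le1// ler1n.
have m2 (z : T -> \bar R) : measurable_fun D z -> measurable_fun D (fun x => 2%:E * z x).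
  by move=> mz; exact: measurable_funeM.
have half : (1 - 2^-1 = 2^-1 :> R)%R by field.
apply: (@le_lt_trans _ _ ((2^-1)%:E * rho (fun x => 2%:E * u x) +
    (1 - 2^-1)%:E * rho (fun x => 2%:E * v x))).
  apply: (modular_convex mD gH h01 (m2 _ mu_) (m2 _ mv) mw).
  apply: filterS wuv => x wx Dx; rewrite half !abseM !muleA.
  by rewrite /= ger0_norm// -EFinM mulVf// !mul1e wx.
rewrite half lte_add_pinfty// lte_mul_pinfty ?lee_fin ?invr_ge0//.
- by apply: (modularZ_lty (c := 2) mu_ (m2 _ mu_)) => //; apply: aeW => x _; rewrite abseM /= ger0_norm.
- by apply: (modularZ_lty (c := 2) mv (m2 _ mv)) => //; apply: aeW => x _; rewrite abseM /= ger0_norm.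
Qed.

Lemma modular1_lty : m D < +oo -> rho (cst 1) < +oo.
Proof.
move=> Doo; have [r0 [Q [K [r1 Q1 K0 bnd]]]] := exponents_bounded.
apply: (@le_lt_trans _ _ (\int[m]_(x in D) cst (1 + K)%:E x)).
  apply: ae_ge0_le_integral => //.
  - by move=> x Dx; exact: double_phase_ge0.
  - by have [h _ _ _] := gH; apply: h; exact: measurable_cst.
  - by move=> x Dx; rewrite lee_fin addr_ge0.
  apply: filterS bnd => x bx Dx; have [_ _ aK] := bx Dx.
  by rewrite /double_phase /= normr1 !powR1 -EFinM -EFinD lee_fin mulr1 lerD2l.
by rewrite integral_cst// lte_mul_pinfty// lee_fin addr_ge0.
Qed.

Lemma integral_abs_le_luxemburg u : measurable_fun D u -> m D < +oo ->
  \int[m]_(x in D) `|u x| <= (fine (m D) + 1)%:E * lux u.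
Proof.
move=> mu_ Doo.
have -> : \int[m]_(x in D) `|u x| = \int[m]_(x in D) `|cst 1 x * u x|.
  by apply: eq_integral => x _; rewrite mul1e.
apply: (holder_luxemburg (G := cst 1) mD gH) => //.
- by rewrite integral_cst// mul1e fineK// ge0_fin_numE.
- by move=> x r Dx r0; rewrite /= normr1 mul1e; exact: le_add1_double_phase.
Qed.

(** The scale e is kept explicit so that it can be taken close to the Luxemburg norm of f, which
    makes the bound small when that norm is small. *)
Lemma holder_complementary f v (e K : R) : (0 < e)%R ->
  measurable_fun D f -> measurable_fun D v ->
  modular m (complementary H) D (fun x => (e^-1)%:E * f x) <= K%:E ->
  \int[m]_(x in D) `|f x * v x| <= e%:E * ((K + 1)%:E * lux v).
Proof.
move=> e0 mf mv fK.
rewrite -lee_pdivrMl// -ge0_integralZl_EFin//; last 2 first.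
- by apply: measurableT_comp => //; exact: emeasurable_funM.
- by rewrite invr_ge0 ltW.
have -> : \int[m]_(x in D) ((e^-1)%:E * `|f x * v x|) =
    \int[m]_(x in D) `|(e^-1)%:E * f x * v x|.
  by apply: eq_integral => x _; rewrite -muleA [RHS]abseM /= gtr0_norm ?invr_gt0.
apply: (holder_luxemburg
  (G := fun x => complementary H x `|(e^-1)%:E * f x|) mD gH) => //.
- exact: measurable_funeM.
- by move=> x Dx; exact: complementary_ge0.
- by move=> x r Dx r0; exact: young_complementary.
Qed.

End double_phase_facts.

(** * The pairing of complementary Orlicz spaces *)

Section duality_pairing.
Context d (T : measurableType d) (R : realType) (m : {measure set T -> \bar R}).
Variables (D : set T) (p q a : T -> R).
Hypotheses (mD : measurable D) (dp : double_phase_data m D p q a).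
Hypothesis Doo : (m D < +oo)%E.
Implicit Types (u v w f g : T -> \bar R).
Local Open Scope ereal_scope.
Local Notation H := (double_phase p q a).
Local Notation Hc := (complementary (double_phase p q a)).
Local Notation lux := (luxemburg m H D).

Let gH := double_phase_generalized_phi mD dp.

Let luxfin v : orlicz_space m H D v -> lux v \is a fin_num.
Proof.
move=> [mv voo]; rewrite ge0_fin_numE; last exact: luxemburg_ge0.
exact: (luxemburg_lty mD gH).
Qed.

Lemma pairing_bound f : orlicz_space m Hc D f ->
  exists2 K : R, (0 <= K)%R & forall v, orlicz_space m H D v ->
    \int[m]_(x in D) `|f x * v x| <= K%:E * lux v.
Proof.
move=> [mf foo].
have f0 : 0 <= modular m Hc D f.
  by apply: integral_ge0 => x Dx; exact: (complementary_ge0 mD dp).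
exists (fine (modular m Hc D f) + 1)%R; first by rewrite addr_ge0// fine_ge0.
move=> v [mv voo].
have := holder_complementary mD dp ltr01 mf mv (K := fine (modular m Hc D f)).
rewrite mul1e; apply; rewrite fineK ?ge0_fin_numE//.
have -> // : (fun x => (1^-1)%:E * f x) = f.
by apply/funext => x; rewrite invr1 mul1e.
Qed.

Lemma pairing_integrable f v : orlicz_space m Hc D f -> orlicz_space m H D v ->
  m.-integrable D (fun x => f x * v x).
Proof.
move=> Lf Lv; have [K K0 hK] := pairing_bound Lf; apply/integrableP; split.
  by apply: emeasurable_funM; [have [] := Lf|have [] := Lv].
apply: le_lt_trans (hK v Lv) _; rewrite -(fineK (luxfin Lv)) -EFinM; exact: ltry.
Qed.

Lemma orlicz1 : orlicz_space m H D (cst 1).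
Proof. by split => //; exact: (modular1_lty mD dp). Qed.

Lemma complementary_integrable f : orlicz_space m Hc D f -> m.-integrable D f.
Proof.
move=> Lf; have := pairing_integrable Lf orlicz1.
by under eq_fun do rewrite mule1.
Qed.

Lemma orlicz_ae_fin_num v : orlicz_space m H D v ->
  \forall x \ae m, D x -> v x \is a fin_num.
Proof.
move=> Lv; apply: integrable_ae => //; apply/integrableP; split; first by case: Lv.
apply: le_lt_trans (integral_abs_le_luxemburg mD dp _ Doo) _; first by case: Lv.
by rewrite -(fineK (luxfin Lv)) -EFinM; exact: ltry.
Qed.

Lemma pairing_abs_le f (K : R) v : orlicz_space m Hc D f -> orlicz_space m H D v ->
  \int[m]_(x in D) `|f x * v x| <= K%:E * lux v ->
  (`|fine (\int[m]_(x in D) (f x * v x))| <= K * fine (lux v))%R.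
Proof.
move=> Lf Lv fv; have If := pairing_integrable Lf Lv.
rewrite -lee_fin EFinM fineK ?luxfin// -abse_EFin fineK; last exact: integrable_fin_num.
apply: le_trans fv; apply: le_abse_integral => //; by case/integrableP: If.
Qed.

(** The relation between w, u and v is assumed only almost everywhere, as for traces. Distributivity
    may fail at infinite values, but f, u and v are finite almost everywhere. *)
Lemma pairingD f u v w : orlicz_space m Hc D f -> orlicz_space m H D u ->
  orlicz_space m H D v -> orlicz_space m H D w ->
  (\forall x \ae m, D x -> w x = u x + v x) ->
  fine (\int[m]_(x in D) (f x * w x)) =
  (fine (\int[m]_(x in D) (f x * u x)) + fine (\int[m]_(x in D) (f x * v x)))%R.
Proof.
move=> Lf Lu Lv Lw wuv.
have Iu := pairing_integrable Lf Lu; have Iv := pairing_integrable Lf Lv.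
have Iw := pairing_integrable Lf Lw.
rewrite -fineD; [|exact: integrable_fin_num..]; congr fine.
rewrite -integralD//; apply: ae_eq_integral => //.
- by case/integrableP: Iw.
- by apply: emeasurable_funD; [case/integrableP: Iu|case/integrableP: Iv].
- have hf := integrable_ae mD (complementary_integrable Lf).
  have hu := orlicz_ae_fin_num Lu; have hv := orlicz_ae_fin_num Lv.
  have : \forall x \ae m, D x -> (f x \is a fin_num) /\ w x = u x + v x.
    by apply: filterS2 hf wuv => x fx wx Dx; split; [exact: fx|exact: wx].
  move=> hfw; rewrite /ae_eq; apply: filterS3 hfw hu hv => x fwx ux vx Dx.
  have [fx ->] := fwx Dx.
  by rewrite muleDr// fin_num_adde_defl// vx.
Qed.

Lemma pairingZ f (c : R) v w : orlicz_space m Hc D f ->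
  orlicz_space m H D v -> orlicz_space m H D w ->
  (\forall x \ae m, D x -> w x = c%:E * v x) ->
  fine (\int[m]_(x in D) (f x * w x)) =
  (c * fine (\int[m]_(x in D) (f x * v x)))%R.
Proof.
move=> Lf Lv Lw wv.
have Iv := pairing_integrable Lf Lv; have Iw := pairing_integrable Lf Lw.
rewrite -[RHS]/(fine c%:E * _)%R -fineM//; last exact: integrable_fin_num.
congr fine; rewrite -integralZl//; apply: ae_eq_integral => //.
- by case/integrableP: Iw.
- by apply: measurable_funeM; case/integrableP: Iv.
- by rewrite /ae_eq; apply: filterS wv => x wx Dx; rewrite wx// muleCA.
Qed.

(** The factor 2 is K + 1 in Hölder's inequality with K = 1, the bound on the modular of (f - g) / t
    for an admissible t < e. *)
Lemma pairing_diff f g (e : R) v : orlicz_space m Hc D f -> orlicz_space m Hc D g ->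
  orlicz_space m H D v -> luxemburg m Hc D (fun x => f x - g x) < e%:E ->
  (`|fine (\int[m]_(x in D) (f x * v x)) - fine (\int[m]_(x in D) (g x * v x))| <=
   e * (2 * fine (lux v)))%R.
Proof.
move=> Lf Lg Lv /ereal_inf_lt[_ [t [t0 fgt] <-]]; rewrite lte_fin => te.
have If := pairing_integrable Lf Lv; have Ig := pairing_integrable Lg Lv.
have mfg : measurable_fun D (fun x => f x - g x).
  by apply: emeasurable_funB; [case: Lf|case: Lg].
have [mv _] := Lv.
have := holder_complementary mD dp t0 mfg mv fgt.
rewrite -fineB; [|exact: integrable_fin_num..].
rewrite -integralB// => hold.
have -> : \int[m]_(x in D) (f x * v x - g x * v x) =
    \int[m]_(x in D) ((f x - g x) * v x).
  apply: ae_eq_integral => //.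
  - by apply: emeasurable_funB; [case/integrableP: If|case/integrableP: Ig].
  - exact: emeasurable_funM.
  - have hf := integrable_ae mD (complementary_integrable Lf).
    have hg := integrable_ae mD (complementary_integrable Lg).
    have hv := orlicz_ae_fin_num Lv.
    have hfgv : \forall x \ae m, D x ->
        [/\ f x \is a fin_num, g x \is a fin_num & v x \is a fin_num].
      by apply: filterS3 hf hg hv => x fx gx vx Dx; split;
        [exact: fx|exact: gx|exact: vx].
    rewrite /ae_eq; apply: filterS hfgv => x fgvx Dx; have [fx gx vx] := fgvx Dx.
    by rewrite muleBl// fin_num_adde_defr.
have mfgv : measurable_fun D (fun x => (f x - g x) * v x) by exact: emeasurable_funM.
have L0 : (0 <= fine (lux v))%R by rewrite fine_ge0// luxemburg_ge0.
rewrite -lee_fin -abse_EFin fineK.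
  apply: le_trans (le_abse_integral m mD mfgv) _; apply: le_trans hold _.
  rewrite -(fineK (luxfin Lv)) -!EFinM lee_fin ler_wpM2r// ?mulr_ge0//.
  exact: ltW.
apply: integrable_fin_num => //; apply/integrableP; split => //.
apply: le_lt_trans hold _; rewrite -(fineK (luxfin Lv)) -!EFinM; exact: ltry.
Qed.

End duality_pairing.

(** * Linear subsets as modules *)

Section submodule_type.
Context {R : realType} {W : lmodType R}.

Definition linear_subset (P : set W) : Prop :=
  P 0 /\ forall (c : R) u v, P u -> P v -> P (c *: u + v).

(* The closure proof is a parameter so that the instances below can be inferred. *)
Definition submodule_pred (P : set W) & linear_subset P : {pred W} :=
  [pred w | `[< P w >]].

Fact submodule_pred_closed (P : set W) (h : linear_subset P) :
  submod_closed (submodule_pred h).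
Proof.
split; first by apply/asboolP; have [] := h.
move=> c u v /asboolP Pu /asboolP Pv; apply/asboolP.
by have [_ hc] := h; exact: hc.
Qed.

End submodule_type.

HB.instance Definition _ (R : realType) (W : lmodType R) (P : set W)
    (h : linear_subset P) :=
  GRing.isSubmodClosed.Build R W (submodule_pred h) (submodule_pred_closed h).

Definition submodule (R : realType) (W : lmodType R) (P : set W)
  (h : linear_subset P) := {w : W | w \in submodule_pred h}.

HB.instance Definition _ (R : realType) (W : lmodType R) (P : set W)
  (h : linear_subset P) := SubChoice.on (submodule h).
HB.instance Definition _ (R : realType) (W : lmodType R) (P : set W)
  (h : linear_subset P) := [SubChoice_isSubLmodule of submodule h by <:].

Lemma submodule_valZ (R : realType) (W : lmodType R) (P : set W)
  (h : linear_subset P) (c : R) (v : submodule h) : val (c *: v) = c *: val v.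
Proof. exact: linearZ. Qed.

(** * Curves, modulus and Newtonian functions *)

(** The function f is replaced by the real function F, its finite part extended by zero; the two
    agree almost everywhere on D because f is integrable. *)
Lemma integral_absolutely_continuous d (T : measurableType d) (R : realType)
    (m : {measure set T -> \bar R}) (D : set T) (f : T -> \bar R) (e : R) :
  measurable D -> measurable_fun D f -> (forall x, D x -> (0 <= f x)%E) ->
  (\int[m]_(x in D) f x < +oo)%E -> 0 < e ->
  exists2 r : R, 0 < r & forall A, measurable A -> A `<=` D -> (m A < r%:E)%E ->
    (\int[m]_(x in A) f x < e%:E)%E.
Proof.
move=> mD mf f0 foo e0.
have If : m.-integrable D f.
  apply/integrableP; split => //; rewrite (eq_integral f)// => x; rewrite inE => Dx.
  by rewrite gee0_abs ?f0.
pose F x := fine ((f \_ D) x).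
have mfD : measurable_fun setT (f \_ D).
  by apply/(measurable_restrictT _ mD).
have mF : measurable_fun setT F by exact: measurableT_comp.
have F0 x : 0 <= F x.
  by rewrite /F fine_ge0// patchE; case: ifPn => //; rewrite inE => /f0.
have IF A : measurable A -> A `<=` D ->
    (\int[m]_(x in A) f x = \int[m]_(x in A) (F x)%:E)%E.
  move=> mA AD; apply: ge0_ae_eq_integral => //.
  - exact: measurable_funS mf.
  - by apply/measurable_EFinP; exact: measurable_funTS.
  - by move=> x /AD; exact: f0.
  - by move=> x _; rewrite lee_fin.
  - have := integrable_ae mD If; apply: filterS => x fx Ax.
    by rewrite /F patchE mem_set ?fineK ?fx//; exact: AD.
have IFT : m.-integrable setT (EFin \o F).
  apply/integrableP; split; first exact/measurable_EFinP.
  rewrite (eq_integral (EFin \o F)); last by move=> x _; rewrite /= ger0_norm.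
  apply: le_lt_trans foo; rewrite (IF D)//.
  rewrite [leRHS]integral_mkcond; apply: ge0_le_integral => //.
  - by move=> x _; rewrite lee_fin.
  - exact/measurable_EFinP.
  - by apply/(measurable_restrictT _ mD)/measurable_EFinP/measurable_funTS.
  - move=> x _; rewrite patchE /=; case: ifPn => // Dx.
    by rewrite /F patchE (negbTE Dx).
have [r [r0 rP]] := integral_normr_continuous IFT e0.
exists r => // A mA AD Ar; rewrite IF//.
have IA : m.-integrable A (EFin \o F).
  exact: integrableS IFT.
have := rP A mA Ar; rewrite /Rintegral.
rewrite (eq_integral (EFin \o F)); last by move=> x _; rewrite /= ger0_norm.
by rewrite -lte_fin fineK//; exact: integrable_fin_num.
Qed.

Lemma lebesgue_measure_shift (R : realType) (s : R) (A : set R) : measurable A ->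
  pushforward lebesgue_measure (+%R s : _ -> measurableTypeR R) A =
  lebesgue_measure A.
Proof.
move=> mA.
have ms : measurable_fun setT (+%R s : R -> R).
  by apply: measurable_funD => //; exact: measurable_cst.
 apply/esym/lebesgue_measure_unique => //= _ [[a b]] /= _ <-.
rewrite /pushforward (_ : _ @^-1` _ = `]a - s, b - s]%classic).
  rewrite !lebesgue_measure_itv/= !lte_fin ltrD2r.
  by case: ifPn => // _; rewrite -!EFinB; congr EFin; ring.
by apply/seteqP; split=> x /=; rewrite !in_itv/= ltrBlDl lerBrDl.
Qed.

Lemma ge0_integral_shift (R : realType) (s a b : R) (f : R -> \bar R) :
  measurable_fun (`[s + a, s + b] : set R) f ->
  (forall r, s + a <= r <= s + b -> (0 <= f r)%E) ->
  (\int[lebesgue_measure]_(r in `[(s + a)%R, (s + b)%R]) f r =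
   \int[lebesgue_measure]_(r in `[a, b]) f (s + r)%R)%E.
Proof.
move=> mf f0.
have ms : measurable_fun setT (+%R s : R -> R).
  by apply: measurable_funD => //; exact: measurable_cst.
have -> : `[a, b]%classic = (+%R s : _ -> measurableTypeR R) @^-1` `[s + a, s + b].
  by apply/seteqP; split=> x /=; rewrite !in_itv/= !lerD2l.
rewrite -ge0_integral_pushforward//=; last first.
  by move=> r; rewrite inE/= in_itv; exact: f0.
apply: eq_measure_integral => // A mA _.
exact/esym/lebesgue_measure_shift.
Qed.

Section curves.
Context {R : realType} {X : completeMetricType R}.
Variable Omega : set X.
Hypothesis oOmega : open Omega.
Implicit Types (c : curve (R := R) (X := X)) (h : X -> \bar R).
Local Notation borel := (g_sigma_algebraType (@open X)).

Lemma measurable_cpath c : rectifiable_in Omega c ->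
  measurable_fun (`[0, clen c] : set R) (cpath c : R -> borel).
Proof.
move=> [_ cc _ _]; apply: (@measurability _ _ _ borel _ _ (@open X)) => //.
move=> _ [U oU <-]; apply: open_measurable_subspace => //.
by move/continuousP : cc; apply.
Qed.

Lemma measurable_borel : measurable (Omega : set borel).
Proof. exact: sub_sigma_algebra. Qed.

Lemma measurable_comp_cpath c h : rectifiable_in Omega c ->
  nonneg_borel_on Omega h ->
  measurable_fun (`[0, clen c] : set R) (fun t => h (cpath c t)).
Proof.
move=> rc [mh _]; apply: (measurable_comp (F := (Omega : set borel))) mh _ => //.
- exact: measurable_borel.
- by move=> _ [t /= t01 <-]; have [_ _ _] := rc; apply.
- exact: measurable_cpath.
Qed.

Lemma line_integral_ge0 c h : rectifiable_in Omega c -> nonneg_borel_on Omega h ->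
  (0 <= line_integral c h)%E.
Proof.
move=> [_ _ _ rc] [_ h0]; apply: integral_ge0 => t /= t01; apply/h0/rc.
by move: t01; rewrite in_itv.
Qed.

Let path0 c h t : rectifiable_in Omega c -> nonneg_borel_on Omega h ->
  t \in `[0, clen c] -> (0 <= h (cpath c t))%E.
Proof. by move=> [_ _ _ rc] [_ h0] t01; apply/h0/rc; move: t01; rewrite in_itv. Qed.

Lemma line_integralD c h h' : rectifiable_in Omega c ->
  nonneg_borel_on Omega h -> nonneg_borel_on Omega h' ->
  (line_integral c (fun x => h x + h' x) = line_integral c h + line_integral c h')%E.
Proof.
move=> rc bh bh'; apply: ge0_integralD => //; try exact: measurable_comp_cpath.
- by move=> t; exact: path0.
- by move=> t; exact: path0.
Qed.

Lemma line_integralZ c h (k : R) : rectifiable_in Omega c ->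
  nonneg_borel_on Omega h -> 0 <= k ->
  (line_integral c (fun x => k%:E * h x) = k%:E * line_integral c h)%E.
Proof.
move=> rc bh k0; apply: ge0_integralZl_EFin => //; try exact: measurable_comp_cpath.
by move=> t; exact: path0.
Qed.

Lemma le_line_integral c h h' : rectifiable_in Omega c ->
  nonneg_borel_on Omega h -> nonneg_borel_on Omega h' ->
  (forall x, Omega x -> (h x <= h' x)%E) ->
  (line_integral c h <= line_integral c h')%E.
Proof.
move=> rc bh bh' hh'; apply: ge0_le_integral => //; try exact: measurable_comp_cpath.
- by move=> t; exact: path0.
- move=> t /=; rewrite in_itv/= => t01; apply: hh'.
  by have [_ _ _] := rc; apply.
Qed.

Definition subcurve c (s t : R) : curve := Curve (t - s) (fun r => cpath c (s + r)).

Lemma path_length_shift_le (s a b : R) (f : R -> X) :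
  (path_length a b (fun r => f (s + r)%R) <= path_length (s + a)%R (s + b)%R f)%E.
Proof.
apply: le_ereal_sup => _ [l [pl /eqP lb] <-]; exists (map (+%R s) l).
  split; last by rewrite (last_map (+%R s)) lb.
  by rewrite path_map; apply: sub_path pl => x y /=; rewrite ltrD2l.
congr EFin; rewrite size_map big_nat [RHS]big_nat; apply: eq_bigr => i /= il.
have nE j : (j <= size l)%N ->
    nth (s + b) (s + a :: [seq s + j0 | j0 <- l]) j = s + nth b (a :: l) j.
  by move=> jl; rewrite -map_cons (nth_map b).
have h1 := nE _ il; rewrite /= in h1.
by rewrite /= h1 (nE _ (ltnW il)).
Qed.

Lemma path_length_shift (s a b : R) (f : R -> X) :
  path_length a b (fun r => f (s + r)) = path_length (s + a) (s + b) f.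
Proof.
apply/eqP; rewrite eq_le path_length_shift_le/=.
have := @path_length_shift_le (- s) (s + a) (s + b) (fun r => f (s + r)).
rewrite !addKr; apply: le_trans.
by under [X in (_ <= path_length _ _ X)%E]eq_fun do rewrite addrA subrr add0r.
Qed.

Lemma rectifiable_subcurve c s t : rectifiable_in Omega c ->
  0 <= s -> s < t -> t <= clen c -> rectifiable_in Omega (subcurve c s t).
Proof.
move=> [l0 cc lc cO] s0 st tl; split => /=.
- by rewrite subr_gt0.
- apply/subspace_continuousP => x /=; rewrite in_itv/= => xst.
  have xl : s + x \in `[0, clen c] by rewrite in_itv/=; lra.
  move/subspace_continuousP : cc => /(_ _ xl) cx.
  apply: cvg_comp cx => P /= [e /= e0 eP]; exists e => //= y /= xy yst.
  apply: eP; last by move: yst; rewrite /= !in_itv/=; lra.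
  by rewrite /= opprD addrACA subrr add0r.
- move=> x y x0 xy yst; rewrite path_length_shift lc; [|lra..].
  by congr EFin; ring.
- by move=> x xst; apply: cO; lra.
Qed.

Lemma line_integral_subcurve c s t h : rectifiable_in Omega c ->
  nonneg_borel_on Omega h -> 0 <= s -> s < t -> t <= clen c ->
  line_integral (subcurve c s t) h =
  (\int[lebesgue_measure]_(r in `[s, t]) h (cpath c r))%E.
Proof.
move=> rc bh s0 st tl; rewrite /line_integral /=.
have -> : `[s, t]%classic = `[s + 0, s + (t - s)]%classic.
  by rewrite addr0 addrC subrK.
have sub : `[s + 0, s + (t - s)]%classic `<=` `[0, clen c]%classic.
  by move=> r /=; rewrite !in_itv/=; lra.
rewrite ge0_integral_shift//.
- by apply: measurable_funS (measurable_comp_cpath rc bh).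
- by move=> r rst; apply: path0 => //; apply: sub; rewrite /= in_itv.
Qed.

Lemma line_integral_subcurve_le c s t h : rectifiable_in Omega c ->
  nonneg_borel_on Omega h -> 0 <= s -> s < t -> t <= clen c ->
  (line_integral (subcurve c s t) h <= line_integral c h)%E.
Proof.
move=> rc bh s0 st tl; rewrite line_integral_subcurve//.
apply: ge0_subset_integral => //.
- exact: measurable_comp_cpath.
- by move=> r; exact: path0.
- by move=> r /=; rewrite !in_itv/=; lra.
Qed.

End curves.

Section ereal_distance.
Context {R : realType}.
Implicit Types u v : \bar R.
Local Open Scope ereal_scope.

(** As soon as one argument is infinite the right-hand side is +oo, because even the difference of
    two equal infinities has absolute value +oo. *)
Lemma abse_distD u v u' v' : `|(u + v) - (u' + v')| <= `|u - u'| + `|v - v'|.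
Proof.
case: u => [u||]; case: v => [v||]; case: u' => [u'||]; case: v' => [v'||];
  rewrite ?leey//.
rewrite -[leLHS]/((`|(u + v) - (u' + v')|)%R%:E).
rewrite -[leRHS]/((`|u - u'| + `|v - v'|)%R%:E) lee_fin.
have -> : (u + v - (u' + v') = (u - u') + (v - v'))%R by ring.
exact: ler_normD.
Qed.

Lemma abse_distZ (c : R) u u' : `|c%:E * u - c%:E * u'| <= `|c|%:E * `|u - u'|.
Proof.
have [->|c0] := eqVneq c 0%R; first by rewrite !mul0e subee// abse0 normr0 mul0e.
have cy : `|c|%:E * +oo = +oo by rewrite gt0_muley// lte_fin normr_gt0.
case: u => [u||]; case: u' => [u'||]; try by rewrite [leRHS]cy leey.
by rewrite -[leLHS]/((`|c * u - c * u'|)%R%:E) -EFinM lee_fin -mulrBr normrM.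
Qed.

End ereal_distance.

(** * Null families of curves and weak upper gradients *)

Section weak_upper_gradients.
Context {R : realType} {X : completeMetricType R}.
Variables (mu : {outer_measure set X -> \bar R}) (Omega : set X) (p q a : X -> R).
Hypotheses (bmu : borel_regular mu) (oOmega : open Omega).
Hypothesis dp : double_phase_data (cara mu) Omega p q a.
Implicit Types (c : curve (R := R) (X := X)) (u v g h : X -> \bar R).
Implicit Types (Gamma : set (curve (R := R) (X := X))).
Local Notation H := (double_phase p q a).
Local Notation borel := (g_sigma_algebraType (@open X)).
Local Notation rho := (modular (cara mu) H Omega).
Local Notation lux := (luxemburg (cara mu) H Omega).
Local Notation T := (caratheodory_type mu).
Local Open Scope ereal_scope.

Lemma cara_measurable_Omega : measurable (Omega : set T).
Proof. by apply: bmu.1; exact: sub_sigma_algebra. Qed.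

Let mO := cara_measurable_Omega.
Let gH : generalized_phi (Omega : set T) H := double_phase_generalized_phi mO dp.

Lemma borel_cara_measurable h : nonneg_borel_on Omega h ->
  measurable_fun (Omega : set T) (h : T -> \bar R).
Proof.
move=> [mh _] _ Y mY; apply: bmu.1; apply: mh => //.
exact: measurable_borel.
Qed.

(** The intersection allows Gamma to be any predicate on curves, whatever it says about curves that
    are not rectifiable in Omega. *)
Definition null_family Gamma : Prop :=
  modulus mu Omega H (Gamma `&` rectifiable_in Omega) = 0.

Lemma null_familyP Gamma : null_family Gamma <->
  forall e : R, (0 < e)%R -> exists h, [/\ nonneg_borel_on Omega h,
    forall c, Gamma c -> rectifiable_in Omega c -> 1 <= line_integral c h &
    rho h <= e%:E].
Proof.
split=> [G0 e e0|Ge].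
  have : modulus mu Omega H (Gamma `&` rectifiable_in Omega) < e%:E by rewrite G0.
  move=> /ereal_inf_lt[_ [h [bh Gh] <-] he]; exists h; split => //.
  - by move=> c Gc rc; exact: Gh.
  - exact: ltW.
apply/eqP; rewrite eq_le; apply/andP; split; last first.
  by apply: le_ereal_inf_tmp => _ [h _ <-]; exact: modular_ge0.
apply/lee_addgt0Pr => e e0; rewrite add0e; have [h [bh Gh he]] := Ge e e0.
apply: le_trans he; apply: ereal_inf_lbound; exists h => //; split => //.
by move=> c [] /Gh.
Qed.

Lemma null_family_sub Gamma Gamma' :
  (forall c, rectifiable_in Omega c -> Gamma c -> Gamma' c) ->
  null_family Gamma' -> null_family Gamma.
Proof.
move=> sub /null_familyP G'; apply/null_familyP => e /G'[h [bh Gh he]].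
by exists h; split => // c Gc rc; apply: Gh => //; exact: sub.
Qed.

(** The maximum of two admissible functions is admissible for both families, and its modular is at
    most the sum of theirs. *)
Lemma null_familyU Gamma Gamma' : null_family Gamma -> null_family Gamma' ->
  null_family (Gamma `|` Gamma').
Proof.
move=> /null_familyP G /null_familyP G'; apply/null_familyP => e e0.
have [h [bh Gh he]] := G _ (divr_gt0 e0 (ltr0n _ 2)).
have [h' [bh' Gh' he']] := G' _ (divr_gt0 e0 (ltr0n _ 2)).
have bm : nonneg_borel_on Omega (fun x => maxe (h x) (h' x)).
  split; first by apply: measurable_maxe; [exact: bh.1|exact: bh'.1].
  by move=> x Ox; rewrite le_max bh.2.
exists (fun x => maxe (h x) (h' x)); split => //.
  move=> c [Gc|Gc] rc.
    apply: le_trans (Gh _ Gc rc) _; apply: (le_line_integral oOmega) => // x _.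
    by rewrite le_max lexx.
  apply: le_trans (Gh' _ Gc rc) _; apply: (le_line_integral oOmega) => // x _.
  by rewrite le_max lexx orbT.
have -> : e%:E = (e / 2)%:E + (e / 2)%:E by rewrite -EFinD; congr EFin; field.
apply: le_trans (leeD he he').
have [mphi _ _ _] := gH.
have mh := borel_cara_measurable bh; have mh' := borel_cara_measurable bh'.
have Hge0 x (r : \bar R) : Omega x -> 0 <= r -> 0 <= H x r.
  by move=> Ox r0; exact: (generalized_phi_ge0 gH).
rewrite /modular -ge0_integralD//; [|by move=> x Ox; exact: Hge0|exact: mphi
  |by move=> x Ox; exact: Hge0|exact: mphi].
apply: ge0_le_integral => //.
- by move=> x Ox; exact: Hge0.
- by apply: mphi; exact: borel_cara_measurable.
- by apply: emeasurable_funD; exact: mphi.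
- move=> x Ox; rewrite /maxe; case: ifPn => _.
    by rewrite leeDr// Hge0.
  by rewrite leeDl// Hge0.
Qed.

(** Every quotient g / k is admissible, and for k >= 1 convexity bounds its modular by rho g / k;
    the chosen k makes this at most e. *)
Lemma null_family_infinite g : nonneg_borel_on Omega g -> rho g < +oo ->
  null_family [set c | line_integral c g = +oo].
Proof.
move=> bg goo; apply/null_familyP => e e0.
have mg := borel_cara_measurable bg.
have g0 : (0 <= fine (rho g))%R by rewrite fine_ge0// modular_ge0.
pose k := (1 + fine (rho g) / e)%R.
have k1 : (1 <= k)%R by rewrite lerDl divr_ge0// ltW.
have k0 : (0 < k)%R by exact: lt_le_trans k1.
exists (fun x => (k^-1)%:E * g x); split.
- split; first by apply: measurable_funeM; exact: bg.1.
  by move=> x Ox; rewrite mule_ge0 ?bg.2// lee_fin invr_ge0 ltW.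
- move=> c /= cg rc; rewrite (line_integralZ oOmega)//; last by rewrite invr_ge0 ltW.
  by rewrite cg gt0_muley ?lte_fin ?invr_gt0// leey.
- apply: (@le_trans _ _ ((k^-1)%:E * rho g)).
    apply: (modular_shrink mO gH) => //.
    + by rewrite invr_ge0 ltW//= invf_le1.
    + exact: measurable_funeM.
    + by apply: aeW => x _; rewrite abseM /= gtr0_norm ?invr_gt0.
  rewrite -(@fineK _ (rho g)) ?ge0_fin_numE ?modular_ge0//.
  rewrite -EFinM lee_fin mulrC ler_pdivrMr// /k mulrDr mulr1 mulrCA mulfV ?gt_eqF//.
  by rewrite mulr1 lerDr ltW.
Qed.

(** The function equal to +oo on E and 0 elsewhere has modular zero, and its integral is infinite
    along any curve that spends positive time in E. *)
Lemma null_family_null_set (E : set X) : <<s open >> E -> mu (E `&` Omega) = 0 ->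
  null_family [set c | lebesgue_measure [set t | t \in `[0%R, clen c] /\ E (cpath c t)] > 0].
Proof.
move=> bE E0; apply/null_familyP => e e0.
pose h x := if x \in E then +oo else 0 : \bar R.
have bh : nonneg_borel_on Omega h.
  split; last by move=> x _; rewrite /h; case: ifPn.
  apply: measurable_fun_if => //; first exact: measurable_borel.
  apply: (measurable_fun_bool true) => /=.
  rewrite (_ : _ @^-1` _ = E); last by apply/seteqP; split => x /=; [exact: set_mem|exact: mem_set].
  by apply: measurableI => //; exact: measurable_borel.
exists h; split => //.
- move=> c /= cE rc.
  pose A := [set t | t \in `[0%R, clen c] /\ E (cpath c t)].
  have mA : measurable A.
    have := @measurable_cpath _ _ Omega c rc (measurable_itv _) _ (bE : measurable (E : set borel)).
    by congr measurable; apply/seteqP; split.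
  apply: (@le_trans _ _ (\int[lebesgue_measure]_(t in A) h (cpath c t))).
    rewrite (eq_integral (cst +oo)); last first.
      by move=> t; rewrite inE => -[_ Et]; rewrite /h mem_set.
    by rewrite integral_cst// gt0_mulye// leey.
  apply: ge0_subset_integral => //; first exact: measurable_comp_cpath bh.
  + by move=> t _; rewrite /h; case: ifPn.
  + by move=> t [].
- rewrite (modular0 mO gH) ?lee_fin ?(ltW e0)//; first exact: borel_cara_measurable.
  exists (E `&` Omega); split => //.
    by apply: measurableI => //; exact: bmu.1.
  move=> x /= /not_implyP[Ox]; rewrite /h; case: ifPn => //.
  by rewrite inE.
Qed.

(** A function admissible for a subcurve is admissible for the whole curve. Hence almost every curve
    has no bad subcurve at all. *)
Lemma null_family_subcurve Gamma : null_family Gamma ->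
  null_family [set c | exists s t, [/\ (0 <= s)%R, (s < t)%R, (t <= clen c)%R &
    Gamma (subcurve c s t)]].
Proof.
move=> /null_familyP G; apply/null_familyP => e /G[h [bh Gh he]].
exists h; split => // c [s [t [s0 st tl Gst]]] rc.
apply: le_trans (line_integral_subcurve_le oOmega rc bh s0 st tl).
by apply: Gh => //; exact: rectifiable_subcurve.
Qed.

Lemma weak_upper_gradientP u g : weak_upper_gradient mu Omega H u g <->
  [/\ measurable_fun (Omega : set T) (u : T -> \bar R), nonneg_borel_on Omega g &
    null_family [set c | ~ `|u (cpath c 0%R) - u (cpath c (clen c))| <=
      line_integral c g]].
Proof.
split=> [[mu_ bg [Gamma [Gr G0 Gu]]]|[mu_ bg G0]]; split => //.
  apply: (@null_family_sub _ Gamma); last by rewrite /null_family (setIidl Gr).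
  by move=> c rc /= h; apply: contrapT => /(Gu c rc).
exists ([set c | ~ `|u (cpath c 0%R) - u (cpath c (clen c))| <=
  line_integral c g] `&` rectifiable_in Omega); split => //.
by move=> c rc /= h; apply: contrapT => h'; apply: h.
Qed.

Lemma weak_upper_gradientD u v g h : weak_upper_gradient mu Omega H u g ->
  weak_upper_gradient mu Omega H v h ->
  weak_upper_gradient mu Omega H (fun x => u x + v x) (fun x => g x + h x).
Proof.
move=> /weak_upper_gradientP[mu_ bg G] /weak_upper_gradientP[mv bh G'].
apply/weak_upper_gradientP; split.
- exact: emeasurable_funD.
- split; first by apply: emeasurable_funD; [exact: bg.1|exact: bh.1].
  by move=> x Ox; rewrite adde_ge0 ?bg.2 ?bh.2.
- apply: null_family_sub (null_familyU G G') => c rc /= h0.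
  apply: contrapT => /not_orP[/contrapT h1 /contrapT h2]; apply: h0.
  rewrite (line_integralD oOmega)//; apply: le_trans (abse_distD _ _ _ _) _.
  exact: leeD.
Qed.

Lemma weak_upper_gradientZ (k : R) u g : weak_upper_gradient mu Omega H u g ->
  weak_upper_gradient mu Omega H (fun x => k%:E * u x) (fun x => `|k|%:E * g x).
Proof.
move=> /weak_upper_gradientP[mu_ bg G]; apply/weak_upper_gradientP; split.
- exact: measurable_funeM.
- split; first by apply: measurable_funeM; exact: bg.1.
  by move=> x Ox; rewrite mule_ge0 ?bg.2// lee_fin.
- apply: null_family_sub G => c rc /= h0 h1; apply: h0.
  rewrite (line_integralZ oOmega)//; apply: le_trans (abse_distZ _ _ _) _.
  by rewrite lee_wpmul2l// lee_fin.
Qed.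

(* Newtonian functions are determined only up to such sets, the analogue of sets of
   capacity zero; a modulus-zero condition on curves ending in E is enough here. *)
Definition exceptional (E : set X) : Prop :=
  mu (E `&` Omega) = 0 /\
  null_family [set c | E (cpath c 0%R) \/ E (cpath c (clen c))].

Lemma null_family0 : null_family set0.
Proof.
apply/null_familyP => e e0; exists (cst 0); split => //.
have -> : rho (cst 0) = 0 by apply: (modular0 mO gH) => //; exact: aeW.
by rewrite lee_fin ltW.
Qed.

Lemma outer_null_sub (A B : set X) : A `<=` B -> mu B = 0 -> mu A = 0.
Proof.
move=> AB B0; apply/eqP; rewrite eq_le outer_measure_ge0 andbT -B0.
exact: le_outer_measure.
Qed.

Lemma exceptional0 : exceptional set0.
Proof.
split; first by rewrite set0I outer_measure0.
by apply: null_family_sub null_family0 => c _ /= [].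
Qed.

Lemma exceptional_sub (A B : set X) : A `&` Omega `<=` B -> exceptional B ->
  exceptional A.
Proof.
move=> AB [B0 GB]; split.
  by apply: outer_null_sub B0 => x [Ax Ox]; split => //; exact: AB.
apply: null_family_sub GB => c [l0 _ _ cO] /= [Ac|Ac]; [left|right]; apply: AB.
  by split => //; apply: cO; rewrite lexx ltW.
by split => //; apply: cO; rewrite lexx ltW.
Qed.

Lemma exceptionalU (A B : set X) : exceptional A -> exceptional B ->
  exceptional (A `|` B).
Proof.
move=> [A0 GA] [B0 GB]; split.
  apply/eqP; rewrite eq_le outer_measure_ge0 andbT setIUl.
  by apply: le_trans (outer_measureU2 _ _ _) _; rewrite A0 B0 adde0.
apply: null_family_sub (null_familyU GA GB) => c _ /=.
by move=> [[]|[]]; [left; left|right; left|left; right|right; right].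
Qed.

Lemma exceptional_ae (E : set X) (P : X -> Prop) : exceptional E ->
  (forall x, Omega x -> ~ E x -> P x) -> \forall x \ae cara mu, Omega x -> P x.
Proof.
move=> [E0 _] EP; have [B [bB EB mB]] := bmu.2 (E `&` Omega).
exists B; split; [exact: bmu.1|by rewrite [LHS]mB|].
move=> x /= /not_implyP[Ox Px]; apply: EB; split => //.
by apply: contrapT => /(EP x Ox).
Qed.

Lemma weak_upper_gradient_exceptional u v g :
  exceptional [set x | u x <> v x] ->
  measurable_fun (Omega : set T) (v : T -> \bar R) ->
  weak_upper_gradient mu Omega H u g -> weak_upper_gradient mu Omega H v g.
Proof.
move=> [_ Guv] mv /weak_upper_gradientP[_ bg G]; apply/weak_upper_gradientP.
split => //; apply: null_family_sub (null_familyU Guv G) => c _ /= h.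
apply: contrapT => /not_orP[/not_orP[/contrapT e0 /contrapT e1]] /contrapT.
by rewrite e0 e1.
Qed.

(** * Newtonian functions, minimal gradients and the energy *)

Local Notation newt := (newtonian mu Omega H).
Local Notation owug := (orlicz_weak_upper_gradient mu Omega H).
Local Notation grad := (min_grad mu Omega H).
Hypothesis Ofin : mu Omega < +oo.

Let ae_mono (P Q : X -> Prop) : (forall x, P x -> Q x) ->
  (\forall x \ae cara mu, P x) -> \forall x \ae cara mu, Q x.
Proof.
by move=> PQ [N [mN N0 PN]]; exists N; split => // x nQ; apply: PN => /PQ.
Qed.

Let ae_mono2 (P Q S : X -> Prop) : (forall x, P x -> Q x -> S x) ->
  (\forall x \ae cara mu, P x) -> (\forall x \ae cara mu, Q x) ->
  \forall x \ae cara mu, S x.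
Proof.
move=> PQ [N [mN N0 PN]] [M [mM M0 QM]]; exists (N `|` M); split.
- exact: measurableU.
- by apply: null_set_setU.
- move=> x nS; apply: contrapT => /not_orP[/= h h']; apply: nS.
  by apply: PQ; apply: contrapT => nP; [exact/h/PN|exact/h'/QM].
Qed.

Let luxfin u : measurable_fun (Omega : set T) (u : T -> \bar R) -> rho u < +oo ->
  lux u \is a fin_num.
Proof.
move=> mu_ uoo; rewrite ge0_fin_numE; last exact: luxemburg_ge0.
exact: (luxemburg_lty mO gH).
Qed.

Lemma orlicz_integrable u : orlicz_space (cara mu) H Omega u ->
  (cara mu).-integrable (Omega : set T) (u : T -> \bar R).
Proof.
move=> [mu_ uoo]; apply/integrableP; split => //.
apply: le_lt_trans (integral_abs_le_luxemburg mO dp mu_ Ofin) _.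
rewrite -(fineK (luxfin mu_ uoo)) -EFinM; exact: ltry.
Qed.

Lemma newtonian_measurable u : newt u -> measurable_fun (Omega : set T) (u : T -> \bar R).
Proof. by move=> [[]]. Qed.

(** If u is infinite at an end of a curve, |u - u| between the ends is +oo even for equal values, so
    either the inequality for g fails on the curve or g has infinite integral along it. Both
    families are null. *)
Lemma exceptional_infinite u : newt u -> exceptional [set x | u x \isn't a fin_num].
Proof.
move=> [Lu [g [/weak_upper_gradientP[_ bg G] [mg goo]]]]; split.
  have [B [mB B0 hB]] := integrable_ae mO (orlicz_integrable Lu).
  apply: outer_null_sub B0 => x [/= ux Ox]; apply: hB => /= /(_ Ox).
  by rewrite (negbTE ux).
have Ginf := null_family_infinite bg goo.
apply: null_family_sub (null_familyU G Ginf) => c rc /= Uc.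
apply: contrapT => /not_orP[/contrapT h]; apply.
apply/eqP; rewrite -leye_eq; apply: le_trans h.
rewrite leye_eq; apply/eqP; move: Uc.
by case: (u (cpath c 0%R)) => [r||]; case: (u (cpath c (clen c))) => [s||] //= -[].
Qed.

Lemma open_line_meets (c : curve (R := R) (X := X)) (B : set X) (s t : R) :
  rectifiable_in Omega c -> <<s open >> B ->
  ~ (lebesgue_measure [set t | t \in `[0%R, clen c] /\ B (cpath c t)] > 0) ->
  (0 <= s)%R -> (s < t)%R -> (t <= clen c)%R ->
  exists2 r, (s < r < t)%R & ~ B (cpath c r).
Proof.
move=> rc bB Bc s0 st tl; apply: contrapT => h; apply: Bc.
set A := [set t | _].
have mA : measurable A.
  have := @measurable_cpath _ _ Omega c rc (measurable_itv _) _ (bB : measurable (B : set borel)).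
  by congr measurable; apply/seteqP; split.
apply: (@lt_le_trans _ _ (lebesgue_measure `]s, t[%classic)).
  by rewrite lebesgue_measure_itv/= lte_fin st -EFinB lte_fin subr_gt0.
apply: le_measure; rewrite ?inE// => r /=; rewrite in_itv/= => srt; split.
  by rewrite in_itv/=; lra.
by apply: contrapT => nB; apply: h; exists r.
Qed.

(* Along a non-exceptional curve u is continuous, and on almost every curve it
   equals k almost everywhere. *)
Lemma weak_upper_gradient_const u (k : R) : newt u ->
  (\forall x \ae cara mu, Omega x -> u x = k%:E) ->
  weak_upper_gradient mu Omega H u (cst 0).
Proof.
move=> nu_ [E [mE E0 hE]].
have [B [bB EB B0]] := bmu.2 E.
have [_ [g [/weak_upper_gradientP[mu_ bg G] [mg goo]]]] := nu_.
apply/weak_upper_gradientP; split => //.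
have BO0 : mu (B `&` Omega) = 0.
  by apply: (@outer_null_sub _ B); [move=> x []|rewrite B0; exact: E0].
(* Discarded are the curves that violate the inequality for g, those with a violating subcurve,
   those along which g has infinite integral, and those spending positive time in the Borel null set
   B. *)
have := null_familyU
  (null_familyU G (null_family_subcurve G))
  (null_familyU (null_family_infinite bg goo)
     (null_family_null_set bB BO0)).
apply: null_family_sub => c rc /= h; apply: contrapT => hn; apply: h.
have [hG hsub hinf hB] : [/\
    `|u (cpath c 0%R) - u (cpath c (clen c))| <= line_integral c g,
    forall s t, (0 <= s)%R -> (s < t)%R -> (t <= clen c)%R ->
      `|u (cpath c s) - u (cpath c t)| <=
        \int[lebesgue_measure]_(r in `[s, t]) g (cpath c r),
    line_integral c g < +oo &
    ~ (lebesgue_measure [set t | t \in `[0%R, clen c] /\ B (cpath c t)] > 0)].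
  split.
  - by apply: contrapT => h; apply: hn; left; left.
  - move=> s t s0 st tl; rewrite -(line_integral_subcurve oOmega rc bg)//.
    apply: contrapT => h; apply: hn; left; right; exists s, t; split => //.
    by rewrite /= addr0 (addrC s) subrK.
  - by rewrite ltey; apply/eqP => h; apply: hn; right; left.
  - by move=> h; apply: hn; right; right.
have cO t : (0 <= t <= clen c)%R -> Omega (cpath c t) by have [_ _ _] := rc; apply.
have l0 : (0 < clen c)%R by have [] := rc.
have uk t : (0 <= t <= clen c)%R -> ~ B (cpath c t) -> u (cpath c t) = k%:E.
  move=> tl nB; apply: contrapT => h; apply: nB; apply/EB/hE => /=.
  by move=> h'; apply/h/h'/cO.
have gc0 t : t \in `[0%R, clen c] -> 0 <= g (cpath c t).
  by rewrite in_itv/= => tl; apply/bg.2/cO.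
have small (e : R) : (0 < e)%R -> exists2 r : R, (0 < r)%R & forall s t : R,
    (0 <= s)%R -> (s < t)%R -> (t <= clen c)%R -> (t - s < r)%R ->
    \int[lebesgue_measure]_(r in `[s, t]) g (cpath c r) < e%:E.
  move=> e0.
  have [r r0 rP] := @integral_absolutely_continuous _ _ _ lebesgue_measure
    `[0%R, clen c]%classic _ e (measurable_itv _) (measurable_comp_cpath oOmega rc bg)
    gc0 hinf e0.
  exists r => // s t s0 st tl str; apply: rP => //.
  + by move=> x /=; rewrite !in_itv/=; lra.
  + have mst : lebesgue_measure `[s, t]%classic = (t - s)%:E.
      by rewrite lebesgue_measure_itv/= lte_fin st -EFinB.
    by rewrite [ltLHS]mst lte_fin.
have close x : (forall e : R, (0 < e)%R -> `|x - k%:E| <= e%:E) -> x = k%:E.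
  move=> xk; have : `|x - k%:E| == 0.
    rewrite eq_le abse_ge0 andbT; apply/lee_addgt0Pr => e e0.
    by rewrite add0e xk.
  by rewrite abse_eq0; case: (x) => [r||] //=; rewrite -EFinB eqe subr_eq0 => /eqP ->.
have -> : u (cpath c 0%R) = k%:E.
  (* Some time b in ]0, t[ avoids B, so u = k there, and the integral of g over the short interval
     from 0 to b is below e. *)
  apply: close => e /small[r r0 rP]; set t := Num.min r (clen c).
  have t0 : (0 < t)%R by rewrite lt_min r0.
  have tl : (t <= clen c)%R by rewrite ge_min lexx orbT.
  have tr : (t <= r)%R by rewrite ge_min lexx.
  have [b /andP[b0 bt] nB] := open_line_meets rc bB hB (lexx 0%R) t0 tl.
  have bl : (b <= clen c)%R by lra.
  rewrite -(uk b) ?(ltW b0)//; apply: le_trans (hsub _ _ (lexx _) b0 bl) _.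
  by apply/ltW/rP => //; lra.
have -> : u (cpath c (clen c)) = k%:E.
  apply: close => e /small[r r0 rP]; set t := Num.max (clen c - r)%R 0%R.
  have t0 : (0 <= t)%R by rewrite le_max lexx orbT.
  have tl : (t < clen c)%R by rewrite gt_max l0 andbT; lra.
  have tr : (clen c - r <= t)%R by rewrite le_max lexx.
  have [b /andP[b0 bt] nB] := open_line_meets rc bB hB t0 tl (lexx _).
  have b_ge0 : (0 <= b)%R by lra.
  rewrite -(uk b) ?b_ge0 ?(ltW bt)//.
  have -> : `|u (cpath c (clen c)) - u (cpath c b)| = `|u (cpath c b) - u (cpath c (clen c))|.
    by case: (u _) => [x||]; case: (u _) => [y||] //=; rewrite distrC.
  apply: le_trans (hsub _ _ b_ge0 bt (lexx _)) _.
  by apply/ltW/rP => //; lra.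
rewrite subee// abse0; by apply: (line_integral_ge0 rc); split.
Qed.

Hypothesis poincare : global_poincare mu Omega H.

Lemma luxemburg_ae0 u : measurable_fun (Omega : set T) (u : T -> \bar R) ->
  (\forall x \ae cara mu, Omega x -> u x = 0) -> lux u = 0.
Proof.
move=> mu_ u0; apply/eqP; rewrite eq_le luxemburg_ge0 andbT.
have := @le_luxemburg_scale _ _ _ (cara mu) Omega H mO gH 0 u u mu_ mu_.
rewrite normr0 mul0e; apply.
by apply: ae_mono u0 => x h Ox; rewrite (h Ox) abse0 mule0.
Qed.

Lemma min_grad_minimal u : newt u -> minimal_weak_upper_gradient mu Omega H u (grad u).
Proof.
move=> nu_.
suff [g hg] : exists g, minimal_weak_upper_gradient mu Omega H u g.
  exact: (@xgetPex _ (cst 0) [set g | minimal_weak_upper_gradient mu Omega H u g]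
    (ex_intro _ g hg)).
apply: contrapT => /forallNP hn.
have g0 : grad u = cst 0 by apply: xgetPN => g; exact: hn.
have [Lu _] := nu_; have Iu := orlicz_integrable Lu; have mu_ := newtonian_measurable nu_.
have m0 : measurable_fun (Omega : set T) (cst 0 : T -> \bar R) by exact: measurable_cst.
have fk : average (cara mu) Omega u \is a fin_num.
  by rewrite fin_numM//; exact: integrable_fin_num.
have mk : measurable_fun (Omega : set T)
    ((fun x => u x - average (cara mu) Omega u) : T -> \bar R).
  by apply: emeasurable_funB => //; exact: measurable_cst.
have uk : \forall x \ae cara mu, Omega x -> u x - average (cara mu) Omega u = 0.
  have [C C0 /(_ _ nu_)] := poincare; rewrite g0 (luxemburg_ae0 m0); last exact: aeW.
  rewrite mule0 => le0.
  (* Since Omega has finite measure, the vanishing Luxemburg norm of u - u_Omega forces its L1 norm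
     to vanish. *)
  apply/(ae_eq_integral_abs (cara mu) mO mk)/eqP.
  rewrite eq_le integral_ge0// andbT.
  apply: le_trans (integral_abs_le_luxemburg mO dp mk Ofin) _.
  have /eqP -> : lux (fun x => u x - average (cara mu) Omega u) == 0.
    by rewrite eq_le le0 luxemburg_ge0.
  by rewrite mule0.
apply: (hn (cst 0)); split; first split.
- apply: (@weak_upper_gradient_const _ (fine (average (cara mu) Omega u))) => //.
  apply: ae_mono uk => x /[apply] /eqP; move: fk.
  by case: (average _ _ _) => //= k _; case: (u x) => [r||] //=; rewrite -EFinB eqe subr_eq0 => /eqP ->.
- split => //; rewrite (modular0 mO gH)//; exact: aeW.
- move=> g' [/weak_upper_gradientP[_ [_ g'0] _] _].
  by apply: aeW => x Ox /=; exact: g'0.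
Qed.

Let Hmeas (h : X -> \bar R) : measurable_fun (Omega : set T) (h : T -> \bar R) ->
  measurable_fun (Omega : set T) ((fun x => H x `|h x|) : T -> \bar R).
Proof. by have [P _ _ _] := gH; exact: P. Qed.

Let min_gradP u : newt u -> [/\ weak_upper_gradient mu Omega H u (grad u),
  nonneg_borel_on Omega (grad u),
  measurable_fun (Omega : set T) (grad u : T -> \bar R) & rho (grad u) < +oo].
Proof.
by move=> /min_grad_minimal[[/[dup] wu /weak_upper_gradientP[_ bg _] [mg goo]] _]; split.
Qed.

Lemma min_grad_ge0 u x : newt u -> Omega x -> 0 <= grad u x.
Proof. by move=> /min_gradP[_ [_ g0] _ _]; exact: g0. Qed.

Lemma min_grad_le u g : newt u -> owug u g ->
  \forall x \ae cara mu, Omega x -> grad u x <= g x.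
Proof. by move=> /min_grad_minimal[_ h]; exact: h. Qed.

Lemma orlicz_upper_gradientD u v g h : owug u g -> owug v h ->
  owug (fun x => u x + v x) (fun x => g x + h x).
Proof.
move=> [ug [mg goo]] [vh [mh hoo]]; split; first exact: weak_upper_gradientD.
have mgh : measurable_fun (Omega : set T) ((fun x => g x + h x) : T -> \bar R).
  exact: emeasurable_funD.
split => //; apply: (modularD_lty mO dp mg mh mgh) => //.
by apply: aeW => x _; exact: lee_abs_add.
Qed.

Lemma orlicz_upper_gradientZ (k : R) u g : owug u g ->
  owug (fun x => k%:E * u x) (fun x => `|k|%:E * g x).
Proof.
move=> [ug [mg goo]]; split; first exact: weak_upper_gradientZ.
have mkg : measurable_fun (Omega : set T) ((fun x => `|k|%:E * g x) : T -> \bar R).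
  exact: measurable_funeM.
split => //; apply: (modularZ_lty (c := `|k|%R) mO dp mg mkg) => //.
by apply: aeW => x _; rewrite abseM /= normr_id.
Qed.

Lemma newtonianD u v : newt u -> newt v -> newt (fun x => u x + v x).
Proof.
move=> [[mu_ uoo] [g ug]] [[mv voo] [h vh]]; split; last first.
  by exists (fun x => g x + h x); exact: orlicz_upper_gradientD.
have muv : measurable_fun (Omega : set T) ((fun x => u x + v x) : T -> \bar R).
  exact: emeasurable_funD.
split => //; apply: (modularD_lty mO dp mu_ mv muv) => //.
by apply: aeW => x _; exact: lee_abs_add.
Qed.

Lemma newtonianZ (k : R) u : newt u -> newt (fun x => k%:E * u x).
Proof.
move=> [[mu_ uoo] [g ug]]; split; last first.
  by exists (fun x => `|k|%:E * g x); exact: orlicz_upper_gradientZ.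
have mku : measurable_fun (Omega : set T) ((fun x => k%:E * u x) : T -> \bar R).
  exact: measurable_funeM.
split => //; apply: (modularZ_lty (c := `|k|%R) mO dp mu_ mku) => //.
by apply: aeW => x _; rewrite abseM.
Qed.

Let orlicz0 : orlicz_space (cara mu) H Omega (cst 0).
Proof.
by split => //; rewrite (modular0 mO gH)//; exact: aeW.
Qed.

Let owug0 : owug (cst 0) (cst 0).
Proof.
split => //; apply/weak_upper_gradientP; split => //.
apply: null_family_sub null_family0 => c rc /= h; apply: h.
apply: (@le_trans _ _ 0); last by apply: (line_integral_ge0 rc); split.
by rewrite /= subr0 normr0.
Qed.

Lemma newtonian0 : newt (cst 0).
Proof. by split => //; exists (cst 0). Qed.

Lemma min_grad0 : \forall x \ae cara mu, Omega x -> grad (cst 0) x = 0.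
Proof.
apply: ae_mono (min_grad_le newtonian0 owug0) => x h Ox.
by apply/eqP; rewrite eq_le (min_grad_ge0 newtonian0)// andbT; exact: h.
Qed.

Lemma min_gradD u v : newt u -> newt v -> \forall x \ae cara mu, Omega x ->
  grad (fun y => u y + v y) x <= grad u x + grad v x.
Proof.
move=> nu_ nv; apply: min_grad_le; first exact: newtonianD.
by apply: orlicz_upper_gradientD; [have [] := min_grad_minimal nu_|
  have [] := min_grad_minimal nv].
Qed.

Lemma min_gradZ (k : R) u : newt u -> \forall x \ae cara mu, Omega x ->
  grad (fun y => k%:E * u y) x <= `|k|%:E * grad u x.
Proof.
move=> nu_; apply: min_grad_le; first exact: newtonianZ.
by apply: orlicz_upper_gradientZ; have [] := min_grad_minimal nu_.
Qed.

(** The functions u and v have the same weak upper gradients, so [xget] chooses from the same set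
    for both and [grad v = grad u] holds as an equality of functions, not just almost everywhere. *)
Lemma newtonian_exceptional u v : exceptional [set x | u x <> v x] ->
  measurable_fun (Omega : set T) (v : T -> \bar R) -> newt u ->
  [/\ newt v, grad v = grad u & lux v = lux u].
Proof.
move=> uv mv nu_; have mu_ := newtonian_measurable nu_.
have vu : exceptional [set x | v x <> u x].
  by apply: exceptional_sub uv => x [/= h _] h'; exact: h.
have aeuv : \forall x \ae cara mu, Omega x -> u x = v x.
  by apply: exceptional_ae uv _ => x Ox /contrapT.
have wuv g : owug u g <-> owug v g.
  by split=> -[w ?]; split => //; [exact: (weak_upper_gradient_exceptional uv)|
    exact: (weak_upper_gradient_exceptional vu)].
split.
- have [[_ uoo] [g /wuv ug]] := nu_; split; last by exists g.
  split => //; apply: le_lt_trans uoo; apply: (le_modular mO gH) => //.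
  by apply: ae_mono aeuv => x h Ox; rewrite h.
- rewrite /min_grad; congr xget; apply/seteqP; split => g [/wuv vg gmin];
    by split => // g' /wuv /gmin.
- apply/eqP; rewrite eq_le !(le_luxemburg mO gH)//.
  + by apply: ae_mono aeuv => x h Ox; rewrite h.
  + by apply: ae_mono aeuv => x h Ox; rewrite h.
Qed.

Local Notation nn := (newtonian_norm mu Omega H).

Lemma newtonian_norm_ge0 u : 0 <= nn u.
Proof. by rewrite adde_ge0// luxemburg_ge0. Qed.

Lemma luxemburg_fin_num u : orlicz_space (cara mu) H Omega u -> lux u \is a fin_num.
Proof. by move=> [mu_ uoo]; exact: luxfin. Qed.

Lemma luxemburg_grad_fin_num u : newt u -> lux (grad u) \is a fin_num.
Proof. by move=> /min_gradP[_ _ mg goo]; exact: luxfin. Qed.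

Lemma newtonian_norm_fin_num u : newt u -> nn u \is a fin_num.
Proof.
by move=> nu_; rewrite fin_numD luxemburg_fin_num ?luxemburg_grad_fin_num//; case: nu_.
Qed.

Lemma newtonian_norm_triangle u v : newt u -> newt v ->
  nn (fun x => u x + v x) <= nn u + nn v.
Proof.
move=> nu_ nv; rewrite /newtonian_norm [leRHS]addeACA; apply: leeD.
  apply: (luxemburg_triangle mO gH); try exact: newtonian_measurable.
    exact/newtonian_measurable/newtonianD.
  by apply: aeW => x _; exact: lee_abs_add.
have [_ _ mgu _] := min_gradP nu_; have [_ _ mgv _] := min_gradP nv.
have [_ _ mguv _] := min_gradP (newtonianD nu_ nv).
apply: (luxemburg_triangle mO gH) => //.
apply: ae_mono (min_gradD nu_ nv) => x h Ox.
by rewrite !gee0_abs ?h// min_grad_ge0//; exact: newtonianD.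
Qed.

Lemma newtonian_norm_scale (k : R) u : newt u ->
  nn (fun x => k%:E * u x) <= `|k|%:E * nn u.
Proof.
move=> nu_; rewrite /newtonian_norm ge0_muleDr ?luxemburg_ge0//; apply: leeD.
  apply: (le_luxemburg_scale mO gH); first exact: newtonian_measurable.
    exact/newtonian_measurable/newtonianZ.
  by apply: aeW => x _; rewrite abseM.
have [_ _ mgu _] := min_gradP nu_; have [_ _ mgku _] := min_gradP (newtonianZ k nu_).
apply: (le_luxemburg_scale mO gH) => //.
apply: ae_mono (min_gradZ k nu_) => x h Ox.
by rewrite !gee0_abs ?h// min_grad_ge0//; exact: newtonianZ.
Qed.

Local Notation energy_part u :=
  (\int[cara mu]_(x in Omega) energy_density p q a x (grad u x)).

Let gA : generalized_phi (Omega : set T) (energy_density p q a) :=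
  energy_density_generalized_phi mO dp.

Lemma energy_part_modular u : newt u ->
  energy_part u = modular (cara mu) (energy_density p q a) Omega (grad u).
Proof.
move=> nu_; apply: eq_integral => x; rewrite inE => Ox.
by rewrite gee0_abs// min_grad_ge0.
Qed.

Lemma energy_part_ge0 u : newt u -> 0 <= energy_part u.
Proof. by move=> nu_; rewrite energy_part_modular//; exact: modular_ge0. Qed.

Lemma energy_part_le u : newt u -> energy_part u <= rho (grad u).
Proof.
move=> nu_; rewrite energy_part_modular//; have [_ _ mg _] := min_gradP nu_.
apply: ge0_le_integral => //.
- by move=> x Ox; exact: (generalized_phi_ge0 gA).
- by have [h _ _ _] := gA; exact: h.
- exact: Hmeas.
- by move=> x Ox; exact: (energy_density_le dp).
Qed.

Lemma energy_part_fin_num u : newt u -> energy_part u \is a fin_num.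
Proof.
move=> nu_; rewrite ge0_fin_numE; last exact: energy_part_ge0.
by apply: le_lt_trans (energy_part_le nu_) _; have [] := min_gradP nu_.
Qed.

Lemma energy_part0 : energy_part (cst 0) = 0.
Proof.
rewrite energy_part_modular; last exact: newtonian0.
apply: (modular0 mO gA) min_grad0.
by have [] := min_gradP newtonian0.
Qed.

Lemma energy_part_convex (t : R) u v : newt u -> newt v -> (0 <= t <= 1)%R ->
  energy_part (fun y => t%:E * u y + (1 - t)%:E * v y) <=
  t%:E * energy_part u + (1 - t)%:E * energy_part v.
Proof.
move=> nu_ nv /[dup] t01 /andP[t0 t1].
have ntu := newtonianZ t nu_; have ntv := newtonianZ (1 - t) nv.
have nw := newtonianD ntu ntv.
rewrite !energy_part_modular//.
have [_ _ mgu _] := min_gradP nu_; have [_ _ mgv _] := min_gradP nv.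
have [_ _ mgw _] := min_gradP nw.
apply: (modular_convex mO gA t01 mgu mgv mgw).
have := ae_mono2 _ (min_gradZ t nu_) (min_gradZ (1 - t) nv); move=> h.
apply: (ae_mono2 _ (min_gradD ntu ntv) (h (fun x => Omega x ->
  grad (fun y => t%:E * u y) x <= t%:E * grad u x /\
  grad (fun y => (1 - t)%:E * v y) x <= (1 - t)%:E * grad v x) _)).
  move=> x hD hZ Ox; have [h1 h2] := hZ Ox.
  rewrite !gee0_abs ?min_grad_ge0//; apply: le_trans (hD Ox) _; exact: leeD.
move=> x h1 h2 Ox; split.
  by have := h1 Ox; rewrite ger0_norm.
by have := h2 Ox; rewrite ger0_norm// subr_ge0.
Qed.

Lemma energy_part_le1 u : newt u -> nn u < 1 -> energy_part u <= 1.
Proof.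
move=> nu_ nu1; apply: le_trans (energy_part_le nu_) _.
have [_ _ mg _] := min_gradP nu_.
have g1 : lux (grad u) < 1%:E.
  by apply: le_lt_trans nu1; rewrite leeDr// luxemburg_ge0.
have [_] := luxemburg_lt mO gH mg g1.
have -> // : (fun x => (1^-1)%:E * grad u x) = grad u.
by apply/funext => x; rewrite invr1 mul1e.
Qed.

Lemma newtonian_norm_le_grad : exists2 C : R, (0 < C)%R & forall u, newt u ->
  \int[cara mu]_(x in Omega) u x = 0 -> nn u <= C%:E * lux (grad u).
Proof.
have [C C0 hC] := poincare; exists (C + 1)%R; first exact: addr_gt0.
move=> u nu_ u0; have := hC _ nu_; rewrite /average u0 mule0.
have -> : (fun x => u x - 0) = u by apply/funext => x; rewrite sube0.
move=> h; have -> : (C + 1)%:E * lux (grad u) = C%:E * lux (grad u) + lux (grad u).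
  rewrite -[in RHS](mul1e (lux (grad u))) muleA mule1 -ge0_muleDl ?lee_fin ?(ltW C0)//.
by rewrite leeD2r.
Qed.

(** If t >= 1 lies below the norm of g_u, the modular of g_u / t exceeds 1 and that of g_u exceeds t
    ^ r0. Up to the factor Q the energy dominates this modular, hence grows superlinearly in t, and
    the Poincaré inequality makes t comparable to the full norm. *)
Lemma energy_part_coercive (c : R) : exists S : R, forall u, newt u ->
  \int[cara mu]_(x in Omega) u x = 0 -> S%:E < nn u -> c%:E * nn u < energy_part u.
Proof.
have [C C0 hC] := newtonian_norm_le_grad.
have [r0 [Q [K [r1 Q1 K0 bnd]]]] := exponents_bounded dp.
have Q0 : (0 < Q)%R by exact: lt_trans Q1.
have r10 : (0 < r0 - 1)%R by rewrite subr_gt0.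
(* The norm of g_u is at least n / C = 2 t; the factor 2 puts t strictly below it, so t is not
   admissible in the Luxemburg infimum. *)
pose D := (2 * C)%R; have D0 : (0 < D)%R by rewrite mulr_gt0.
(* Beyond b one has t > 1 and t ^ (r0 - 1) > M >= c D Q. Clipping at 0 covers negative c, so that
   the power of M with exponent 1 / (r0 - 1) can be inverted. *)
pose M := Num.max 0%R (c * D * Q)%R.
pose b := Num.max 1%R (M `^ (r0 - 1)^-1)%R.
exists (D * b)%R => u nu_ u0.
have nf := newtonian_norm_fin_num nu_; rewrite -(fineK nf) lte_fin => bu.
set n := fine (nn u) in bu *; pose t := (n / D)%R.
have bt : (b < t)%R by rewrite ltr_pdivlMr// mulrC.
have t1 : (1 < t)%R by apply: le_lt_trans bt; rewrite le_max lexx.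
have t0 : (0 < t)%R by exact: lt_trans t1.
have [_ bg mg goo] := min_gradP nu_.
have gf := luxemburg_grad_fin_num nu_.
have tg : t%:E < lux (grad u).
  have := hC _ nu_ u0; rewrite -(fineK nf) -(fineK gf) -EFinM lee_fin lte_fin -/n.
  have nt : n = (t * (2 * C))%R by rewrite /t -/D divfK// gt_eqF.
  rewrite nt => h; have := ltr_pM2l C0 t (fine (lux (grad u))); nra.
have mtg : measurable_fun (Omega : set T) ((fun x => (t^-1)%:E * grad u x) : T -> \bar R).
  exact: measurable_funeM.
have gt1 : 1 < rho (fun x => (t^-1)%:E * grad u x).
  rewrite ltNge; apply/negP => /(luxemburg_le t0) h.
  by move: tg; rewrite ltNge h.
have tr : (t `^ r0)%:E * rho (fun x => (t^-1)%:E * grad u x) <= rho (grad u).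
  rewrite -ge0_integralZl_EFin ?powR_ge0//; last 2 first.
  - by move=> x Ox; exact: (generalized_phi_ge0 gH).
  - exact: Hmeas.
  apply: ae_ge0_le_integral => //.
  - by move=> x Ox; rewrite mule_ge0 ?lee_fin ?powR_ge0// (generalized_phi_ge0 gH).
  - by apply: measurable_funeM; exact: Hmeas.
  - by move=> x Ox; exact: (generalized_phi_ge0 gH).
  - exact: Hmeas.
  apply: ae_mono bnd => x bx Ox; have [rp _ _] := bx Ox.
  apply: le_trans (double_phaseZ_ge dp Ox rp (ltW t1) (abse_ge0 _)) _.
  rewrite abseM muleA /= gtr0_norm ?invr_gt0// -EFinM mulfV ?gt_eqF// mul1e.
  by rewrite lexx.
have gE : rho (grad u) <= Q%:E * energy_part u.
  rewrite energy_part_modular// -ge0_integralZl_EFin ?(ltW Q0)//; last 2 first.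
  - by move=> x Ox; exact: (generalized_phi_ge0 gA).
  - by have [h _ _ _] := gA; exact: h.
  apply: ae_ge0_le_integral => //.
  - by move=> x Ox; exact: (generalized_phi_ge0 gH).
  - exact: Hmeas.
  - by move=> x Ox; rewrite mule_ge0 ?lee_fin ?(ltW Q0)// (generalized_phi_ge0 gA).
  - by apply: measurable_funeM; have [h _ _ _] := gA; exact: h.
  apply: ae_mono bnd => x bx Ox; have [_ qQ _] := bx Ox.
  exact: (double_phase_le_energy dp).
have tE : (t `^ r0)%:E < Q%:E * energy_part u.
  apply: lt_le_trans gE; apply: lt_le_trans tr.
  by rewrite -[ltLHS]mule1 lte_pmul2l// lte_fin powR_gt0.
move: tE; rewrite -(fineK (energy_part_fin_num nu_)) -!EFinM !lte_fin => tE.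
have tM : (M < t `^ (r0 - 1))%R.
  have M0 : (0 <= M)%R by rewrite le_max lexx.
  have Mb : (M `^ (r0 - 1)^-1 < t)%R by apply: le_lt_trans bt; rewrite le_max lexx orbT.
  have := gt0_ltr_powR r10 (powR_ge0 _ _) (ltW t0) Mb.
  by rewrite -powRrM mulVf ?gt_eqF// powRr1.
have tt : (t `^ r0 = t * t `^ (r0 - 1))%R.
  by rewrite mulr_powRB1 ?(ltW t0)// (lt_trans _ r1).
have cM : (c * D * Q <= M)%R by rewrite le_max lexx orbT.
have nt : (n = t * D)%R by rewrite /t divfK// gt_eqF.
rewrite -(ltr_pM2l Q0); apply: lt_trans tE; rewrite tt nt.
have -> : (Q * (c * (t * D)) = t * (c * D * Q))%R by ring.
by rewrite ltr_pM2l//; exact: le_lt_trans tM.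
Qed.

(** * The module of real-valued Newtonian functions *)

Definition real_newtonian : set (X -> R) := [set v : X -> R | newt (EFin \o v)].

Lemma real_newtonian_closed : linear_subset real_newtonian.
Proof.
split; first exact: newtonian0.
by move=> c u v nu_ nv; exact: (newtonianD (newtonianZ c nu_) nv).
Qed.

Local Notation V := (submodule real_newtonian_closed).

Definition emb (v : V) : X -> \bar R := EFin \o val v.

Lemma emb_newtonian (v : V) : newt (emb v).
Proof. by have := valP v => /asboolP. Qed.

Lemma embD (u v : V) : emb (u + v)%R = fun x => emb u x + emb v x.
Proof. by []. Qed.

Lemma embZ (c : R) (v : V) : emb (c *: v)%R = fun x => c%:E * emb v x.
Proof. by rewrite /emb submodule_valZ; apply/funext => x /=; rewrite -EFinM. Qed.

Lemma emb0 : emb 0%R = cst 0.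
Proof. by []. Qed.

Lemma exceptional_fine u : newt u ->
  exceptional [set x | u x <> (fine (u x))%:E].
Proof.
move=> nu_; apply: exceptional_sub (exceptional_infinite nu_) => x [/= h _].
by apply/negP => ux; apply: h; rewrite fineK.
Qed.

Lemma fine_newtonian u : newt u -> real_newtonian (fine \o u).
Proof.
move=> nu_; have [] // := @newtonian_exceptional u (EFin \o (fine \o u)) _ _ nu_.
  exact: exceptional_fine.
apply/measurable_EFinP; apply: measurableT_comp => //.
exact: newtonian_measurable.
Qed.

(** Total, with value 0 off the Newtonian space, so that a functional on the module composed with it
    is defined on all extended real functions. *)
Definition real_part (u : X -> \bar R) : V :=
  match pselect (newt u) with
  | left nu_ => exist _ (fine \o u) (introT (asboolP _) (fine_newtonian nu_))
  | right _ => 0%R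
  end.

Lemma emb_real_part u : newt u -> emb (real_part u) = EFin \o (fine \o u).
Proof. by rewrite /real_part; case: pselect. Qed.

Lemma real_part_emb (v : V) : real_part (emb v) = v.
Proof.
apply: val_inj; rewrite /real_part; case: pselect => [//|h].
by exfalso; apply: h; exact: emb_newtonian.
Qed.

Lemma exceptional_real_part u : newt u ->
  exceptional [set x | u x <> emb (real_part u) x].
Proof. by move=> nu_; rewrite emb_real_part//; exact: exceptional_fine. Qed.

Definition newtonian_seminorm (v : V) : R := fine (nn (emb v)).
Local Notation N := newtonian_seminorm.

Lemma newtonian_seminormK (v : V) : (N v)%:E = nn (emb v).
Proof. exact: fineK (newtonian_norm_fin_num (emb_newtonian v)). Qed.

Lemma newtonian_seminorm_triangle (u v : V) : (N (u + v) <= N u + N v)%R.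
Proof.
have := newtonian_norm_triangle (emb_newtonian u) (emb_newtonian v).
by rewrite -embD -!newtonian_seminormK -EFinD lee_fin.
Qed.

Lemma newtonian_seminorm_scale (c : R) (v : V) : N (c *: v)%R = (`|c| * N v)%R.
Proof.
have le (k : R) (w : V) : (N (k *: w) <= `|k| * N w)%R.
  have := newtonian_norm_scale k (emb_newtonian w).
  by rewrite -embZ -!newtonian_seminormK -EFinM lee_fin.
apply/eqP; rewrite eq_le le/=.
have [->|c0] := eqVneq c 0%R.
  by rewrite normr0 mul0r fine_ge0// newtonian_norm_ge0.
have cp : (0 < `|c|)%R by rewrite normr_gt0.
have h := le (c^-1)%R (c *: v)%R.
rewrite scalerA in h.
rewrite (mulVf c0) in h.
rewrite scale1r in h.
rewrite normfV in h.
rewrite -(ler_pdivlMl _ _ cp).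
exact: h.
Qed.

Lemma newtonian_seminorm_exceptional (u v : V) :
  exceptional [set x | emb u x <> emb v x] -> N (u - v)%R = 0%R.
Proof.
move=> uv; have [||_ g0 l0] := @newtonian_exceptional (emb 0%R) (emb (u - v)%R) _ _ newtonian0.
- apply: exceptional_sub uv => x [/= h _] h'; apply: h.
  have {}h' : val u x = val v x by case: h'.
  by rewrite /emb /=; congr EFin; rewrite -[RHS]/(val u x - val v x)%R h' subrr.
- exact/newtonian_measurable/emb_newtonian.
have [_ _ mg0 _] := min_gradP newtonian0.
have lux0 : lux (cst 0) = 0.
  by apply: luxemburg_ae0; [exact: measurable_cst|exact: aeW].
by rewrite /N /newtonian_norm g0 l0 emb0 (luxemburg_ae0 mg0 min_grad0) lux0 adde0.
Qed.

Local Notation nn_real := (fun v : V => (N v)%:E).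

Let add (u v : X -> \bar R) x := u x + v x.
Let scale (c : R) (u : X -> \bar R) x := c%:E * u x.

(* A functional phi on the real-valued functions is bounded, hence determined up
   to null vectors, so composing it with real_part is linear on all of N^{1,H}. *)
Lemma newtonian_seminorm_reflexive : newtonian_reflexive mu Omega H ->
  reflexive_space [set: V] +%R *:%R nn_real.
Proof.
move=> refl Lam [LamD LamZ [C LamC]].
pose Lam' (phi : (X -> \bar R) -> R) := Lam (fun v : V => phi (emb v)).
have dualE phi : dual_space newt add scale nn phi ->
    dual_space [set: V] +%R *:%R nn_real (fun v : V => phi (emb v)).
  move=> [pD pZ [K pK]]; split.
  - by move=> u v _ _; rewrite embD; apply: pD; exact: emb_newtonian.
  - by move=> c u _; rewrite embZ; apply: pZ; exact: emb_newtonian.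
  - exists K => u _; rewrite newtonian_seminormK; apply: pK; exact: emb_newtonian.
have bLam : bidual_space newt add scale nn Lam'.
  split.
  - by move=> phi psi /dualE dphi /dualE dpsi; exact: LamD.
  - by move=> c phi /dualE dphi; exact: LamZ.
  - exists `|C|%R => phi /dualE dphi; apply: le_trans (LamC _ dphi) _.
    set d := dual_norm _ _ _.
    have d0 : 0 <= d.
      apply: ereal_sup_ubound; exists 0%R.
        by split; [|rewrite (_ : N 0%R = 0%R)// -(subrr (0%R : V));
          apply: newtonian_seminorm_exceptional; apply: exceptional_sub exceptional0 => x []].
      have [pD pZ _] := dphi.
      by have := pZ 0%R (0%R : V) Logic.I; rewrite scale0r mul0r => ->; rewrite normr0.
    apply: (@le_trans _ _ (`|C|%:E * d)).
      by rewrite lee_wpmul2r// lee_fin ler_norm.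
    (* The unit ball of the module embeds into that of the Newtonian space, so restricting a
       functional does not increase its dual norm. *)
    rewrite lee_wpmul2l// ?lee_fin//; apply: le_ereal_sup => _ [v [_ v1] <-].
    exists (emb v); last reflexivity.
    by split; [exact: emb_newtonian|rewrite -newtonian_seminormK; exact: v1].
have [u nu_ uLam] := refl _ bLam; exists (real_part u) => // psi dpsi.
have [pD pZ [K pK]] := dpsi.
have pN0 (v w : V) : N (v - w)%R = 0%R -> psi v = psi w.
  move=> vw; have := pK (v - w)%R Logic.I; rewrite vw mule0 lee_fin normr_le0.
  have -> : (psi (v - w) = psi v - psi w)%R.
    by rewrite -scaleN1r pD// pZ// mulN1r.
  by rewrite subr_eq0 => /eqP.
pose phi (w : X -> \bar R) : R := psi (real_part w).
have dphi : dual_space newt add scale nn phi.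
  split.
  - move=> v w nv nw; rewrite /phi -pD//; apply/pN0/newtonian_seminorm_exceptional.
    have nvw := newtonianD nv nw.
    apply: exceptional_sub (exceptionalU (exceptional_infinite nv)
      (exceptional_infinite nw)) => x [/= h _].
    apply: contrapT => /not_orP[/= /negP/negPn fv /negP/negPn fw]; apply: h.
    by rewrite embD !emb_real_part//= fineD.
  - move=> c v nv; rewrite /phi -pZ//; apply/pN0/newtonian_seminorm_exceptional.
    have ncv := newtonianZ c nv.
    apply: exceptional_sub (exceptional_infinite nv) => x [/= h _].
    apply/negP => fv; apply: h.
    by rewrite embZ !emb_real_part//= fineM// EFinM.
  - exists K => v nv; apply: le_trans (pK _ Logic.I) _.
    rewrite newtonian_seminormK.
    have [||_ g0 l0] := @newtonian_exceptional v (emb (real_part v)) _ _ nv.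
    - exact: exceptional_real_part.
    - exact/newtonian_measurable/emb_newtonian.
    by rewrite /newtonian_norm g0 l0.
rewrite -[RHS]/(phi u) -(uLam _ dphi) /Lam'; congr Lam; apply/funext => v.
by rewrite /phi real_part_emb.
Qed.

(** * The trace pairing and convergence of minimizers *)

Variables (nu : {outer_measure set X -> \bar R}).
Variable Tr : (X -> \bar R) -> (X -> \bar R).
Local Notation bd := (boundary Omega).
Local Notation Tnu := (caratheodory_type nu).
Local Notation Hc := (complementary H).
Local Notation luxb := (luxemburg (cara nu) H bd).
Hypotheses (bnu : borel_regular nu) (dpn : double_phase_data (cara nu) bd p q a).
Hypothesis bdfin : nu bd < +oo.
Hypothesis trace : trace_operator mu Omega H nu Tr.

Lemma cara_measurable_boundary : measurable (bd : set Tnu).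
Proof.
apply: bnu.1; apply: (@measurableD _ borel); last first.
  by apply: sub_sigma_algebra; exact: open_interior.
rewrite -[X in measurable X](@setCK borel); apply: measurableC.
by apply: sub_sigma_algebra; apply: closed_openC; exact: closed_closure.
Qed.

Let mbd := cara_measurable_boundary.

Let gHb : generalized_phi (bd : set Tnu) H := double_phase_generalized_phi mbd dpn.

Definition trace_pairing f u : R := fine (\int[cara nu]_(z in bd) (f z * Tr u z)).
Local Notation trL := trace_pairing.

Let trace_orlicz u : newt u -> orlicz_space (cara nu) H bd (Tr u).
Proof. by have [h _ _ _ _] := trace; exact: h. Qed.

Lemma trace_pairingD f u v : orlicz_space (cara nu) Hc bd f -> newt u -> newt v ->
  trL f (fun x => u x + v x) = (trL f u + trL f v)%R.
Proof.
move=> Lf nu_ nv; apply: (pairingD mbd dpn bdfin) => //.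
- exact: trace_orlicz.
- exact: trace_orlicz.
- by apply: trace_orlicz; exact: newtonianD.
- by have [_ h _ _ _] := trace; exact: h.
Qed.

Lemma trace_pairingZ f (c : R) u : orlicz_space (cara nu) Hc bd f -> newt u ->
  trL f (fun x => c%:E * u x) = (c * trL f u)%R.
Proof.
move=> Lf nu_; apply: (pairingZ mbd dpn) => //.
- exact: trace_orlicz.
- by apply: trace_orlicz; exact: newtonianZ.
- by have [_ _ h _ _] := trace; exact: h.
Qed.

Let trace_norm : exists2 C : R, (0 <= C)%R & forall u, newt u ->
  (fine (luxb (Tr u)) <= C * fine (nn u))%R.
Proof.
have [_ _ _ [C hC] _] := trace; exists `|C|%R => // u nu_.
have Lt := trace_orlicz nu_.
have lf : luxb (Tr u) \is a fin_num.
  rewrite ge0_fin_numE; last exact: luxemburg_ge0.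
  by apply: (luxemburg_lty mbd gHb); case: Lt.
have := hC u nu_; rewrite -(fineK lf) -(fineK (newtonian_norm_fin_num nu_)).
rewrite -EFinM lee_fin => /le_trans; apply.
by apply: ler_wpM2r (ler_norm C); rewrite fine_ge0// newtonian_norm_ge0.
Qed.

Lemma trace_pairing_bound f : orlicz_space (cara nu) Hc bd f ->
  exists2 K : R, (0 <= K)%R & forall u, newt u -> (`|trL f u| <= K * fine (nn u))%R.
Proof.
move=> Lf; have [C C0 hC] := trace_norm.
have [K K0 hK] := pairing_bound mbd dpn Lf; exists (K * C)%R; first exact: mulr_ge0.
move=> u nu_; have Lt := trace_orlicz nu_.
apply: le_trans (pairing_abs_le mbd dpn Lf Lt (hK _ Lt)) _.
by rewrite -mulrA ler_wpM2l// hC.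
Qed.

Lemma trace_pairing_diff : exists2 K : R, (0 < K)%R & forall f g (e : R),
  orlicz_space (cara nu) Hc bd f -> orlicz_space (cara nu) Hc bd g -> (0 < e)%R ->
  luxemburg (cara nu) Hc bd (fun z => f z - g z) < e%:E ->
  forall u, newt u -> (`|trL f u - trL g u| <= e * (K * fine (nn u)))%R.
Proof.
have [C C0 hC] := trace_norm; exists (2 * C + 1)%R.
  by rewrite ltr_wpDl// mulr_ge0.
move=> f g e Lf Lg e0 fge u nu_.
apply: le_trans (pairing_diff mbd dpn bdfin Lf Lg (trace_orlicz nu_) fge) _.
rewrite ler_wpM2l ?(ltW e0)//; have := hC _ nu_.
have : (0 <= fine (nn u))%R by rewrite fine_ge0// newtonian_norm_ge0.
lra.
Qed.

(** The operator T acts on functions rather than on classes. The difference w of the real part and u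
    vanishes off an exceptional set, so its norm is 0; the bound on the pairing annihilates it, and
    linearity gives the equality. *)
Lemma trace_pairing_real_part f u : orlicz_space (cara nu) Hc bd f -> newt u ->
  trL f (emb (real_part u)) = trL f u.
Proof.
move=> Lf nu_; have nr := emb_newtonian (real_part u); have nu1 := newtonianZ (-1) nu_.
pose w x := emb (real_part u) x + (-1)%:E * u x.
have nw : newt w by exact: newtonianD.
have [||_ g0 l0] := @newtonian_exceptional (emb 0%R) w _ _ newtonian0.
- apply: exceptional_sub (exceptional_infinite nu_) => x [/= h _].
  apply/negP => ux; apply: h; rewrite /w emb_real_part//= fineK//.
  by rewrite mulN1e subee.
- exact: newtonian_measurable.
have nw0 : nn w = 0.
  have := newtonian_seminormK 0%R; rewrite /newtonian_norm -g0 -l0 => <-.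
  have -> // : newtonian_seminorm 0%R = 0%R.
  by have := newtonian_seminorm_scale 0 0%R; rewrite scale0r normr0 mul0r.
have [K K0 hK] := trace_pairing_bound Lf.
have := hK _ nw; rewrite nw0 mulr0 normr_le0.
rewrite /w trace_pairingD// trace_pairingZ// mulN1r subr_eq0 => /eqP.
by [].
Qed.

Lemma energyE f u : orlicz_space (cara nu) Hc bd f -> newt u ->
  energy mu nu Omega p q a Tr f u = (fine (energy_part u) + trL f u)%:E.
Proof.
move=> Lf nu_; rewrite /energy EFinD fineK ?energy_part_fin_num//; congr (_ + _).
rewrite fineK//; apply: integrable_fin_num => //.
exact: (pairing_integrable mbd dpn Lf (trace_orlicz nu_)).
Qed.

Lemma integral_newtonian_fin_num u : newt u ->
  \int[cara mu]_(x in Omega) u x \is a fin_num.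
Proof.
by move=> [Lu _]; apply: integrable_fin_num => //; exact: orlicz_integrable.
Qed.

Definition total_mass (v : V) : R := fine (\int[cara mu]_(x in Omega) emb v x).

Lemma integral_real_part u : newt u ->
  \int[cara mu]_(x in Omega) emb (real_part u) x = \int[cara mu]_(x in Omega) u x.
Proof.
move=> nu_; apply: ae_eq_integral => //.
- exact/newtonian_measurable/emb_newtonian.
- exact: newtonian_measurable.
- by apply: (exceptional_ae (exceptional_real_part nu_)) => x Ox /contrapT.
Qed.

Lemma total_mass_bounded_linear : bounded_linear newtonian_seminorm total_mass.
Proof.
split.
- move=> u v; rewrite /total_mass embD.
  have Iu := orlicz_integrable (emb_newtonian u).1.
  have Iv := orlicz_integrable (emb_newtonian v).1.
  by rewrite integralD// fineD//; exact: integrable_fin_num.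
- move=> c u; rewrite /total_mass embZ.
  have Iu := orlicz_integrable (emb_newtonian u).1.
  by rewrite integralZl// fineM//; exact: integrable_fin_num.
- exists (fine (mu Omega) + 1)%R => u.
  have nu_ := emb_newtonian u; have mu_ := newtonian_measurable nu_.
  rewrite -lee_fin /total_mass -abse_EFin fineK ?integral_newtonian_fin_num//.
  apply: le_trans (le_abse_integral _ mO mu_) _.
  apply: le_trans (integral_abs_le_luxemburg mO dp mu_ Ofin) _.
  rewrite EFinM newtonian_seminormK; apply: lee_wpmul2l.
    by rewrite lee_fin addr_ge0// fine_ge0.
  by rewrite leeDl// luxemburg_ge0.
Qed.

Lemma total_mass_real_part u : newt u ->
  \int[cara mu]_(x in Omega) u x = 0 -> total_mass (real_part u) = 0%R.
Proof. by move=> nu_ u0; rewrite /total_mass integral_real_part// u0. Qed.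

Lemma energy_part_real_part u : newt u ->
  energy_part (emb (real_part u)) = energy_part u.
Proof.
move=> nu_; have [||_ g0 _] := @newtonian_exceptional u (emb (real_part u)) _ _ nu_.
- exact: exceptional_real_part.
- exact/newtonian_measurable/emb_newtonian.
by rewrite g0.
Qed.

Lemma real_newtonian_star (v : V) : total_mass v = 0%R -> newtonian_star mu Omega H (emb v).
Proof.
move=> v0; split; first exact: emb_newtonian.
rewrite -(fineK (integral_newtonian_fin_num (emb_newtonian v))).
by rewrite -[fine _]/(total_mass v) v0.
Qed.

Lemma exceptional_infinite_seq (w : nat -> X -> \bar R) n : (forall k, newt (w k)) ->
  exceptional [set x | exists2 j, (j < n)%N & w j x \isn't a fin_num].
Proof.
move=> nw; elim: n => [|n ih].
  by apply: exceptional_sub exceptional0 => x [[]].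
apply: exceptional_sub (exceptionalU ih (exceptional_infinite (nw n))) => x [[j jn wj] _].
move: jn; rewrite ltnS leq_eqVlt => /predU1P[jn|jn]; last by left; exists j.
by right; rewrite -jn.
Qed.

Lemma embB (u v : V) x : emb (u - v)%R x = emb u x - emb v x.
Proof.
have -> : emb (u - v)%R = fun x => emb u x + emb (- v)%R x by exact: embD.
by congr (_ + _); rewrite -scaleN1r embZ mulN1e.
Qed.

Lemma emb_sum (l : nat -> R) (z : nat -> V) (s : seq nat) x :
  emb (\sum_(j <- s) l j *: z j)%R x = \sum_(j <- s) (l j)%:E * emb (z j) x.
Proof.
elim: s => [|j s ih]; first by rewrite !big_nil.
by rewrite !big_cons embD embZ ih.
Qed.

(** Opposite infinities may meet in the pointwise sum, but only on the finite union of the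
    exceptional sets where some w j is infinite; elsewhere the sum is the combination of real
    parts. *)
Lemma newtonian_norm_combination (w : nat -> X -> \bar R) (l : nat -> R) (v : V) k n :
  (forall j, newt (w j)) ->
  nn (fun x => \sum_(k <= j < n) (l j)%:E * w j x - emb v x) =
  (newtonian_seminorm (\sum_(k <= j < n) l j *: real_part (w j) - v))%:E.
Proof.
move=> nw; rewrite newtonian_seminormK.
have [||_ g0 l0] := @newtonian_exceptional
  (emb (\sum_(k <= j < n) l j *: real_part (w j) - v)%R)
  (fun x => \sum_(k <= j < n) (l j)%:E * w j x - emb v x) _ _
  (emb_newtonian _).
- apply: exceptional_sub (exceptional_infinite_seq n nw) => x [/= h _].
  apply: contrapT => fw; apply: h; rewrite embB emb_sum; congr (_ + _).
  apply: eq_big_nat => j /andP[_ jn].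
  rewrite emb_real_part//= fineK//; apply/negPn/negP => wj.
  by apply: fw; exists j.
- apply: emeasurable_funB; last exact/newtonian_measurable/emb_newtonian.
  by apply: emeasurable_sum => j; apply: measurable_funeM; exact: newtonian_measurable.
by rewrite /newtonian_norm g0 l0.
Qed.

Let trace_pairing_bounded_linear f : orlicz_space (cara nu) Hc bd f ->
  bounded_linear newtonian_seminorm (fun v : V => trL f (emb v)).
Proof.
move=> Lf; split.
- move=> u v; have := trace_pairingD Lf (emb_newtonian u) (emb_newtonian v).
  by rewrite -embD.
- move=> c u; have := trace_pairingZ c Lf (emb_newtonian u).
  by rewrite -embZ.
- have [K K0 hK] := trace_pairing_bound Lf; exists K => u.
  by apply: hK; exact: emb_newtonian.
Qed.

Theorem minimizers_converge (f : X -> \bar R) (fk uk : nat -> X -> \bar R) :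
  newtonian_reflexive mu Omega H ->
  (forall k, orlicz_space (cara nu) Hc bd (fk k)) ->
  orlicz_space (cara nu) Hc bd f ->
  (fun k => luxemburg (cara nu) Hc bd (fun z => fk k z - f z)) @ \oo --> 0 ->
  (forall k, newtonian_star mu Omega H (uk k)) ->
  (forall k, energy mu nu Omega p q a Tr (fk k) (uk k) =
             energy_inf mu nu Omega p q a Tr (fk k)) ->
  exists (n : nat -> nat) (l : nat -> nat -> R) (u : X -> \bar R),
    [/\ forall k, [/\ (k <= n k)%N,
          (forall j, (k <= j <= n k)%N -> (0 <= l k j)%R) &
          (\sum_(k <= j < (n k).+1) l k j = 1)%R],
        newtonian_star mu Omega H u,
        (fun k => nn (fun x => \sum_(k <= j < (n k).+1) (l k j)%:E * uk j x - u x))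
          @ \oo --> 0 &
        energy mu nu Omega p q a Tr f u = energy_inf mu nu Omega p q a Tr f].
Proof.
move=> refl Lfk Lf fkf suk muk.
have nuk k : newt (uk k) by have [] := suk k.
pose E (v : V) : R := fine (energy_part (emb v)).
pose L (v : V) : R := trL f (emb v).
pose Lk k (v : V) : R := trL (fk k) (emb v).
have EK (v : V) : (E v)%:E = energy_part (emb v).
  exact: fineK (energy_part_fin_num (emb_newtonian v)).
have [|||||||||||n [l [v [nl v0 vlim vmin]]]] := @minimizers_hull_converge R V
    newtonian_seminorm newtonian_seminorm_triangle newtonian_seminorm_scale
    (newtonian_seminorm_reflexive refl) E L Lk total_mass (fun k => real_part (uk k)).
- move=> s v v' s01.
  have h := energy_part_convex (emb_newtonian v) (emb_newtonian v') s01.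
  have e : (fun y => s%:E * emb v y + (1 - s)%:E * emb v' y) =
    emb (s *: v + (1 - s) *: v')%R by rewrite embD !embZ.
  rewrite e in h.
  rewrite -!EK -!EFinM -EFinD lee_fin in h.
  exact: h.
- move=> v v1; have nv1 : nn (emb v) < 1 by rewrite -newtonian_seminormK lte_fin.
  by have := energy_part_le1 (emb_newtonian v) nv1; rewrite -EK lee_fin.
- by move=> v; have := energy_part_ge0 (emb_newtonian v); rewrite -EK lee_fin.
- by rewrite /E emb0 energy_part0.
- exact: trace_pairing_bounded_linear.
- move=> k; have [_ LZ _] := trace_pairing_bounded_linear (Lfk k).
  by have := LZ 0%R 0%R; rewrite scale0r mul0r.
- move=> e e0; have [K K0 hK] := trace_pairing_diff.
  (* The constant K of the trace pairing is absorbed into the tolerance. *)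
  have eK : (0 < e / K)%R by exact: divr_gt0.
  have /fine_cvgP[fin /cvgrPdist_lt/(_ _ eK) lt] := fkf.
  have [k0 _ hk0] := filterI fin lt; exists k0 => k kk0 v.
  have [kfin klt] := hk0 k kk0.
  rewrite -[leRHS](_ : (e / K * (K * newtonian_seminorm v) = _)%R); last first.
    by field; rewrite gt_eqF.
  apply: (hK _ _ _ (Lfk k) Lf eK _ _ (emb_newtonian v)).
  move: klt; rewrite /= sub0r normrN -lte_fin -abse_EFin fineK// => /le_lt_trans; apply.
  by case: (luxemburg _ _ _ _) => [r||] //=; rewrite lee_fin ler_norm.
- exact: total_mass_bounded_linear.
- move=> c; have [S hS] := energy_part_coercive c; exists S => v v0 Sv.
  have nv := emb_newtonian v.
  rewrite -lte_fin EFinM EK newtonian_seminormK; apply: hS => //.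
    by have [] := real_newtonian_star v0.
  by rewrite -newtonian_seminormK lte_fin.
- by move=> k; apply: total_mass_real_part => //; have [] := suk k.
- move=> k v v0.
  rewrite /E /Lk (energy_part_real_part (nuk k)).
  rewrite (trace_pairing_real_part (Lfk k) (nuk k)) -lee_fin.
  rewrite -(energyE (Lfk k) (nuk k)) -(energyE (Lfk k) (emb_newtonian v)).
  rewrite muk; apply: ereal_inf_lbound.
  by exists (emb v); [exact: real_newtonian_star|reflexivity].
exists n, l, (emb v); split.
- by move=> k; have [kn l0 l1] := nl k; split => // j _; exact: l0.
- exact: real_newtonian_star.
- under eq_fun do rewrite newtonian_norm_combination//.
  apply/fine_cvgP; split; first by near=> k.
  apply/cvgrPdist_lt => e e0; near=> k; rewrite /= sub0r normrN.
  have N0 w : (0 <= newtonian_seminorm w)%R by rewrite fine_ge0// newtonian_norm_ge0.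
  rewrite ger0_norm//; apply: lt_trans (vlim k) _.
  by near: k; exact: (near_infty_natSinv_lt (PosNum e0)).
- apply/eqP; rewrite eq_le; apply/andP; split; last first.
    apply: ereal_inf_lbound.
    by exists (emb v); [exact: real_newtonian_star|reflexivity].
  apply: le_ereal_inf_tmp => _ [w [nw w0] <-].
  rewrite (energyE Lf (emb_newtonian v)) (energyE Lf nw) lee_fin.
  (* An extended real competitor has the same energy and integral as its real part, against which v
     is minimal. *)
  have := vmin (real_part w) (total_mass_real_part nw w0).
  by rewrite /E /L (energy_part_real_part nw) (trace_pairing_real_part Lf nw).
Unshelve. all: by end_near.
Qed.

End weak_upper_gradients.

(** * Stability of minimizers *)

(** The data are given on the closure of Omega, while the modulars are taken over Omega. *)
Lemma double_phase_data_sub d (T : measurableType d) (R : realType)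
    (m : {measure set T -> \bar R}) (D E : set T) (p q a : T -> R) :
  measurable D -> E `<=` D -> double_phase_data m D p q a ->
  double_phase_data m E p q a.
Proof.
move=> mD ED [[mp mq ma] pq [p1 p2] [q1 q2] [a0 a1]].
have inf_sub (b : T -> R) : (ess_inf_on m D b <= ess_inf_on m E b)%E.
  by apply: le_ereal_sup => y; apply: filterS => x h /ED; exact: h.
have sup_sub (b : T -> R) : (ess_sup_on m E b <= ess_sup_on m D b)%E.
  by apply: ereal_inf_le_tmp => y; apply: filterS => x h /ED; exact: h.
split.
- by split; exact: measurable_funS mD ED _.
- by move=> x /ED; exact: pq.
- by split; [exact: lt_le_trans p1 (inf_sub p)|exact: le_lt_trans (sup_sub p) p2].
- by split; [exact: lt_le_trans q1 (inf_sub q)|exact: le_lt_trans (sup_sub q) q2].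
- by split; [move=> x /ED; exact: a0|exact: le_lt_trans (sup_sub _) a1].
Qed.

(** The codimension condition concerns balls centered on the boundary; recentering a ball that
    contains Omega at a boundary point gives the boundary finite measure. *)
Lemma closure_ball_sub {R : realType} {X : completeMetricType R} (A : set X)
    (x z : X) (r : R) : A `<=` ball x r -> closure A z ->
  exists s, 0 < s /\ closure A `<=` ball z s.
Proof.
move=> Ar cAz.
have near_x y : closure A y -> ball x (r + 1) y.
  move=> /(_ (ball y 1) (nbhsx_ballx _ _ ltr01))[w [Aw yw]].
  by apply: ball_triangle (Ar _ Aw) _; exact: ball_sym.
exists (`|r| + 1 + (`|r| + 1)); split; first by rewrite addr_gt0// ltr_wpDl.
move=> y /near_x xy; apply: (@le_ball _ _ _ ((r + 1) + (r + 1))).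
  by rewrite lerD// lerD2r ler_norm.
by apply: ball_triangle xy; apply: ball_sym; exact: near_x.
Qed.

(** The constant 1 belongs to the Orlicz space because D has finite measure. Pairing it with f_k - f
    bounds the integral of f by a multiple of a null sequence. *)
Lemma complementary_limit_integral0 d (T : measurableType d) (R : realType)
    (m : {measure set T -> \bar R}) (D : set T) (p q a : T -> R)
    (f : T -> \bar R) (fk : nat -> T -> \bar R) :
  measurable D -> double_phase_data m D p q a -> (m D < +oo)%E ->
  let Hc := complementary (double_phase p q a) in
  (forall k, orlicz_space m Hc D (fk k)) -> orlicz_space m Hc D f ->
  (forall k, \int[m]_(z in D) fk k z = 0)%E ->
  (fun k => luxemburg m Hc D (fun z => fk k z - f z)%E) @ \oo --> 0%E ->
  (\int[m]_(z in D) f z = 0)%E.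
Proof.
move=> mD dp Doo Hc Lfk Lf fk0 fkf.
have L1 := orlicz1 mD dp Doo.
have ff : (\int[m]_(z in D) f z)%E \is a fin_num.
  by apply: integrable_fin_num => //; exact: (complementary_integrable mD dp Doo Lf).
have mul1 (g : T -> \bar R) : (\int[m]_(z in D) (g z * cst 1 z) = \int[m]_(z in D) g z)%E.
  by apply: eq_integral => z _; rewrite mule1.
set l := fine (luxemburg m (double_phase p q a) D (cst 1%E)).
have l0 : 0 <= l by rewrite fine_ge0// luxemburg_ge0.
have small e : 0 < e -> `|fine (\int[m]_(z in D) f z)%E| <= e.
  (* The summand 1 keeps the denominator positive when the norm l of the constant is 0. *)
  move=> e0; pose e' := e / (2 * l + 1).
  have k0 : 0 < 2 * l + 1 by lra.
  have e'0 : 0 < e' by rewrite divr_gt0.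
  have /fine_cvgP[fin /cvgrPdist_lt/(_ _ e'0) lt] := fkf.
  have [k _ hk] := filterI fin lt; have [kfin klt] := hk k (leqnn k).
  have : (luxemburg m Hc D (fun z => fk k z - f z) < e'%:E)%E.
    move: klt; rewrite /= sub0r normrN -lte_fin -abse_EFin fineK// => /le_lt_trans; apply.
    by case: (luxemburg _ _ _ _) => [r||] //=; rewrite lee_fin ler_norm.
  move=> /(pairing_diff mD dp Doo (Lfk k) Lf L1).
  rewrite !mul1 fk0 sub0r normrN => /le_trans; apply.
  have e'E : e' * (2 * l + 1) = e by rewrite /e' divfK// gt_eqF.
  by rewrite -/l; lra.
rewrite -(fineK ff); congr EFin; apply/eqP; rewrite -normr_le0.
by apply/ler_addgt0Pr => e e0; rewrite add0r small.
Qed.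

Theorem theorem5p1 (R : realType) (X : completeMetricType R)
  (mu nu : {outer_measure set X -> \bar R}) (Omega : set X) (theta : R)
  (p q a : X -> R) (T : (X -> \bar R) -> (X -> \bar R))
  (f : X -> \bar R) (fk uk : nat -> X -> \bar R) :
  let H : X -> \bar R -> \bar R := double_phase p q a in
  let Hc : X -> \bar R -> \bar R := complementary H in
  let bd : set X := boundary Omega in
  borel_regular mu ->
  sigma_finite [set: caratheodory_type mu] (cara mu) ->
  (forall (x : X) (r : R), 0 < r -> (0 < mu (ball x r) < +oo)%E) ->
  domain Omega ->
  (forall (x : X) (r : R), closure Omega x -> 0 < r ->
    (0 < mu (ball x r `&` Omega) < +oo)%E) ->
  restricted_doubling mu Omega ->
  (* the boundary measure, extended by zero to X *)
  nu (~` bd) = 0%E ->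
  borel_regular nu ->
  sigma_finite [set: caratheodory_type nu] (cara nu) ->
  0 <= theta < 1 ->
  upper_codimension mu nu Omega theta ->
  double_phase_data (cara mu) (closure Omega) p q a ->
  double_phase_data (cara nu) bd p q a ->
  metric_bounded Omega ->
  local_comparability H (closure Omega) ->
  weak_11_poincare mu Omega H ->
  global_poincare mu Omega H ->
  newtonian_reflexive mu Omega H ->
  trace_operator mu Omega H nu T ->
  (forall k, orlicz_space (cara nu) Hc bd (fk k)) ->
  orlicz_space (cara nu) Hc bd f ->
  (forall k, (\int[cara nu]_(z in bd) fk k z = 0)%E) ->
  (fun k => luxemburg (cara nu) Hc bd (fun z => (fk k z - f z)%E)) @ \oo
    --> 0%E ->
  (forall k, newtonian_star mu Omega H (uk k)) ->
  (forall k, energy mu nu Omega p q a T (fk k) (uk k) =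
             energy_inf mu nu Omega p q a T (fk k)) ->
  (\int[cara nu]_(z in bd) f z = 0)%E /\
  exists (N : nat -> nat) (lam : nat -> nat -> R) (u : X -> \bar R),
    [/\ forall k, [/\ (k <= N k)%N,
          (forall j, (k <= j <= N k)%N -> 0 <= lam k j) &
          \sum_(k <= j < (N k).+1) lam k j = 1],
        newtonian_star mu Omega H u,
        (fun k => newtonian_norm mu Omega H
          (fun x => (\sum_(k <= j < (N k).+1) (lam k j)%:E * uk j x - u x)%E))
          @ \oo --> 0%E &
        energy mu nu Omega p q a T f u = energy_inf mu nu Omega p q a T f].
Proof.
move=> H Hc bd bmu _ muball dom muO _ nubd bnu _ _ codim dpc dpn [x0 [r0 Or0]]
  _ _ poin refl trace Lfk Lf fk0 fkf suk muk.
have [oO _ O0] := dom.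
have dp : double_phase_data (cara mu) Omega p q a.
  apply: double_phase_data_sub dpc; last exact: subset_closure.
  rewrite -[X in measurable X](@setCK X); apply: measurableC.
  apply: bmu.1; apply: sub_sigma_algebra; apply: closed_openC; exact: closed_closure.
have Ofin : (mu Omega < +oo)%E.
  (* Balls are known to have finite measure for positive radii, hence the maximum with 1. *)
  have /andP[_] := muball x0 (Num.max r0 1) (ltac:(by rewrite lt_max ltr01 orbT)).
  apply: le_lt_trans; apply: le_outer_measure; apply: subset_trans Or0 _.
  by apply: le_ball; rewrite le_max lexx.
have bdfin : (nu bd < +oo)%E.
  have [[z bz]|/set0P/negP/negPn/eqP ->] := pselect (bd !=set0); last first.
    by rewrite outer_measure0.
  have [cz _] := bz.
  have [s [s0 cs]] := closure_ball_sub Or0 cz.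
  have [C C0 hC] := codim; have := hC z s bz s0.
  have -> : ball z s `&` boundary Omega = bd.
    by apply/seteqP; split => [y []//|y by_]; split => //; apply: cs; case: by_.
  move=> /le_lt_trans; apply; have /andP[_ mufin] := muO z s cz s0.
  by rewrite lte_mul_pinfty// lee_fin mulr_ge0// ?powR_ge0// ltW.
have mbd := cara_measurable_boundary Omega bnu.
split; first exact: complementary_limit_integral0 mbd dpn bdfin Lfk Lf fk0 fkf.
exact: (minimizers_converge bmu oO dp Ofin poin bnu dpn bdfin trace refl Lfk Lf fkf suk muk).
Qed.
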